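(* $\mathrm{GMI}$ is $\mathrm{NL}$-hard under $\mathrm{AC}^0$ many-one reductions.
   Context: For a graph $X=(V,E)$, its graphic matroid $M(X)$ has ground set $E$ and circuits the edge sets of simple cycles. $\mathrm{GMI}$: given two graphs $X_1,X_2$, decide whether $M(X_1)\cong M(X_2)$, i.e. whether there is a bijection between their edge sets mapping edge sets of simple cycles exactly onto edge sets of simple cycles. *)

(* Defs.v *)
From mathcomp Require Import all_boot.
From Stdlib Require Import Relation_Operators.

Set Implicit Arguments.
Unset Strict Implicit.
Unset Printing Implicit Defensive.

Definition language := seq bool -> Prop.

(** * Graphic matroids and the problem GMI *)

Record graph := Graph {
  order : nat;
  adj : rel 'I_order;
  adj_sym : symmetric adj;
  adj_irr : irreflexive adj }.

Definition edges (X : graph) : {set {set 'I_(order X)}} :=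
  [set [set p.1; p.2] | p : 'I_(order X) * 'I_(order X) & adj p.1 p.2].

Definition edge (X : graph) : finType := {e : {set 'I_(order X)} | e \in edges X}.

(** A simple cycle is the cyclic sequence of its vertices; [next c x] is the
    cyclic successor of [x] in [c]. *)
Definition simple_cycle (X : graph) (c : seq 'I_(order X)) : Prop :=
  2 < size c /\ ucycle (@adj X) c.

Definition cycle_edges (X : graph) (c : seq 'I_(order X)) :
    {set {set 'I_(order X)}} :=
  [set [set x; next c x] | x in c].

(** A matroid is presented by its ground set and its circuits. *)
Record set_system := SetSystem {
  ground : finType;
  circuits : {set ground} -> Prop }.

Definition isomorphic (M N : set_system) : Prop :=
  exists2 f : ground M -> ground N, bijective f &
    forall C : {set ground M}, circuits C <-> circuits (f @: C).

Definition graphic_matroid (X : graph) : set_system :=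
  @SetSystem (edge X) (fun C : {set edge X} =>
    exists2 c : seq 'I_(order X), simple_cycle c &
      val @: C = cycle_edges c).

(** The code of a graph on N vertices is 1^N 0 followed by the N^2 bits of its
    adjacency matrix, row by row. This code is prefix-free, so a pair of graphs
    is coded by concatenation. *)
Definition encode_graph (X : graph) : seq bool :=
  nseq (order X) true ++ false ::
    [seq adj u v | u <- enum 'I_(order X), v <- enum 'I_(order X)].

Definition GMI : language := fun w =>
  exists X1 X2 : graph,
    w = encode_graph X1 ++ encode_graph X2 /\
    isomorphic (graphic_matroid X1) (graphic_matroid X2).

(** * Turing machine tapes *)

Inductive move := MoveLeft | Stay | MoveRight.

(** A two-way infinite tape, of which only the cells visited or written so far
    are stored: [tleft] lists the cells left of the head, nearest first, and
    [tright] those to its right, nearest first. *)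
Record tape (S : Type) := Tape { tleft : seq S; thead : S; tright : seq S }.

Definition tape_size S (t : tape S) := size (tleft t) + (size (tright t)).+1.

Definition tape_step S (blank : S) (t : tape S) (s : S) (m : move) : tape S :=
  match m with
  | Stay => Tape (tleft t) s (tright t)
  | MoveLeft =>
      Tape (behead (tleft t)) (head blank (tleft t)) (s :: tright t)
  | MoveRight =>
      Tape (s :: tleft t) (head blank (tright t)) (behead (tright t))
  end.

Definition tape_of S (blank : S) (w : seq S) : tape S :=
  Tape [::] (head blank w) (behead w).

(** * Nondeterministic logarithmic space *)

Inductive insym := LeftEnd | Bit of bool | RightEnd.

(** Nondeterministic machines with a two-way read-only input tape, whose
    content is delimited by end markers, and one work tape. [ndelta q a s q' s' d e]
    allows, in state [q] when reading [a] on the input and [s] on the work tape,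
    to enter state [q'], write [s'], and move the input head along [d] and the
    work head along [e]. *)
Record ntm := NTM {
  nstate : finType;
  nsym : finType;
  nblank : nsym;
  nstart : nstate;
  naccept : pred nstate;
  ndelta : nstate -> insym -> nsym -> nstate -> nsym -> move -> move -> bool }.

(** Input head positions are 0 (left marker), 1, ..., |x|, |x|+1 (right
    marker). *)
Definition read_input (x : seq bool) (p : nat) : insym :=
  if p is i.+1 then
    if i < size x then Bit (nth false x i) else RightEnd
  else LeftEnd.

Definition move_input (x : seq bool) (p : nat) (m : move) : nat :=
  match m with
  | Stay => p
  | MoveLeft => p.-1
  | MoveRight => minn p.+1 (size x).+1
  end.

Record nconf (M : ntm) := NConf {
  nc_state : nstate M;
  nc_pos : nat;
  nc_tape : tape (nsym M) }.

Definition ninit (M : ntm) : nconf M :=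
  NConf (nstart M) 0 (tape_of (nblank M) [::]).

Definition nstep (M : ntm) (x : seq bool) (c c' : nconf M) : Prop :=
  exists (q : nstate M) (s : nsym M) (d e : move),
    ndelta (nc_state c) (read_input x (nc_pos c)) (thead (nc_tape c)) q s d e /\
    c' = NConf q (move_input x (nc_pos c) d)
               (tape_step (nblank M) (nc_tape c) s e).

Definition nreach (M : ntm) (x : seq bool) (c : nconf M) : Prop :=
  clos_refl_trans _ (@nstep M x) (ninit M) c.

Definition naccepts (M : ntm) (x : seq bool) : Prop :=
  exists2 c : nconf M, nreach x c & naccept (nc_state c).

Definition in_NL (A : language) : Prop :=
  exists (M : ntm) (k : nat),
    (forall (x : seq bool) (c : nconf M), nreach x c ->
       tape_size (nc_tape c) <= k * (trunc_log 2 (size x)).+1) /\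
    (forall x : seq bool, A x <-> naccepts M x).

(** * Deterministic linear time on multitape machines *)

(** A state with [dverdict q = Some b] is halting, with answer [b]. *)
Record dtm := DTM {
  dtapes : nat;
  dstate : finType;
  dsym : finType;
  dblank : dsym;
  dbit : bool -> dsym;
  dstart : dstate;
  dverdict : dstate -> option bool;
  ddelta : dstate -> {ffun 'I_dtapes -> dsym} ->
           dstate * ('I_dtapes -> dsym * move) }.

Record dconf (M : dtm) := DConf {
  dc_state : dstate M;
  dc_tape : 'I_(dtapes M) -> tape (dsym M) }.

(** The i-th input word is written on tape i; the remaining tapes are blank. *)
Definition dinit (M : dtm) (ws : seq (seq bool)) : dconf M :=
  DConf (dstart M)
    (fun i => tape_of (dblank M) [seq dbit M b | b <- nth [::] ws i]).

Definition dstep (M : dtm) (c : dconf M) : dconf M :=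
  if dverdict (dc_state c) is Some _ then c else
  let r := ddelta (dc_state c) [ffun i => thead (dc_tape c i)] in
  DConf r.1 (fun i =>
    tape_step (dblank M) (dc_tape c i) (r.2 i).1 (r.2 i).2).

(** Binary expansion, least significant bit first, without superfluous zeros
    ([binary 0] is empty). *)
Definition binary (n : nat) : seq bool :=
  mkseq (fun i => odd (n %/ 2 ^ i)) (up_log 2 n.+1).

(** The ternary relation R on numbers written in binary is decided in time linear in
    the length of the input. *)
Definition linear_time (R : nat -> nat -> nat -> bool) : Prop :=
  exists (M : dtm) (k : nat), forall n a b : nat,
    let ws := [:: binary n; binary a; binary b] in
    let t := k * (size (binary n) + size (binary a) + size (binary b)).+1 in
    dverdict (dc_state (iter t (@dstep M) (dinit M ws))) = Some (R n a b).

(** * Uniform AC^0 *)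

Inductive gate (n : nat) := Input of 'I_n | Not | And | Or.
Arguments Not {n}.
Arguments And {n}.
Arguments Or {n}.

Definition arity_ok n (k : gate n) (fanin : nat) : bool :=
  match k with
  | Input _ => fanin == 0
  | Not => fanin == 1
  | And | Or => true
  end.

(** Circuits over n input bits with an ordered list of output gates. [cwire g h]
    means that the value of [h] is fed into [g]. The constants are the gates
    [And] and [Or] of fan-in 0. *)
Record circuit (n : nat) := Circuit {
  cgates : nat;
  ckind : 'I_cgates -> gate n;
  cwire : rel 'I_cgates;
  couts : seq 'I_cgates;
  cwire_arity : forall g, arity_ok (ckind g) #|cwire g|;
  cwire_acyclic : forall g h, cwire g h -> ~~ connect cwire h g }.

(** The value of a gate, by recursion on the bound [k] on the number of gates on
    a path ending in it; by acyclicity [cgates C] is such a bound. *)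
Fixpoint gate_value n (C : circuit n) (x : n.-tuple bool) (k : nat)
    (g : 'I_(cgates C)) : bool :=
  if k is k'.+1 then
    match ckind g with
    | Input i => tnth x i
    | Not => ~~ [exists h, cwire g h && gate_value x k' h]
    | And => [forall h, cwire g h ==> gate_value x k' h]
    | Or => [exists h, cwire g h && gate_value x k' h]
    end
  else false.

Definition circuit_eval n (C : circuit n) (x : n.-tuple bool) : seq bool :=
  [seq gate_value x (cgates C) g | g <- couts C].

Definition circuit_size n (C : circuit n) : nat := cgates C + size (couts C).

Definition depth_le n (C : circuit n) (d : nat) : Prop :=
  forall (g : 'I_(cgates C)) (p : seq 'I_(cgates C)),
    path (@cwire n C) g p -> size p <= d.

Inductive query := QInput | QNot | QAnd | QOr | QWire | QOutput.

(** Direct connection language, with gates denoted by their numbers: is [a] a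
    gate reading input bit [b] / a negation / a conjunction / a disjunction /
    fed by gate [b] / the output gate of index [b]? *)
Definition connection n (C : circuit n) (q : query) (a b : nat) : bool :=
  [exists g : 'I_(cgates C), (val g == a) &&
    match q with
    | QInput => if ckind g is Input i then val i == b else false
    | QNot => if ckind g is Not then true else false
    | QAnd => if ckind g is And then true else false
    | QOr => if ckind g is Or then true else false
    | QWire => [exists h : 'I_(cgates C), (val h == b) && cwire g h]
    | QOutput => (b < size (couts C)) && (nth g (couts C) b == g)
    end].

(** With n written in binary, time linear in the input length is O(log n) on the
    gates of a circuit of polynomial size. *)
Definition dlogtime_uniform (C : forall n, circuit n) : Prop :=
  forall q : query, linear_time (fun n a b => connection (C n) q a b).

Definition AC0_function (f : seq bool -> seq bool) : Prop :=
  exists C : forall n, circuit n,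
    [/\ exists d : nat, forall n, depth_le (C n) d,
        exists k : nat, forall n, circuit_size (C n) <= n ^ k + k,
        dlogtime_uniform C
      & forall x : seq bool, f x = circuit_eval (C (size x)) (in_tuple x)].

Definition AC0_reducible (A B : language) : Prop :=
  exists2 f : seq bool -> seq bool, AC0_function f &
    forall x : seq bool, A x <-> B (f x).

Definition NL_hard (B : language) : Prop :=
  forall A : language, in_NL A -> AC0_reducible A B.

(* Main.v *)
From Stdlib Require Import Relation_Operators Operators_Properties.
From mathcomp Require Import all_boot zify.
Require Import Defs.

Set Implicit Arguments.
Unset Strict Implicit.
Unset Printing Implicit Defensive.

(* A language in NL is decided by whether the number c of walks of a fixed length
   from the initial to an accepting configuration is positive. Since
   lcm(1, ..., n + 1) >= 2^n, this holds iff c has a nonzero residue r modulo some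
   m + 1 of polynomial size. Consider a ladder with one rung for every pair (m, r)
   and a two-element fibre over every rung; between the elements of consecutive
   fibres stand copies, modulo m + 1, of the equations that define c as a sum over
   last steps. Two versions of the ladder, which differ in the marked element of
   the last fibre, are isomorphic iff the fibres can be swapped from some rung on;
   this shifts the solutions between them, and the marks at the output only admit
   a shift by r <> 0, that is c = r modulo m + 1. So they are isomorphic iff c > 0.
   A ladder is coded as a graph with two adjacent apexes joined to all vertices,
   links being paths of length 2 or 3; the triangles through the edge of the apexes
   make the matroid determine the links.

   Each vertex is a number whose bits interleave its fields, so that one finite
   automaton reading bits block by block decides adjacency. An entry of the
   adjacency matrix depends on at most one input bit, hence the circuit has depth
   one, and its direct connection language is decided by such automata, which a
   Turing machine with four tapes runs in linear time. *)

(** * Graphic matroid isomorphisms *)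

(** Gadgets of this kind express linear equations modulo a number, while reachability asks whether a
    count is nonzero, which is no such equation. Hence the detour over residues: for a fixed modulus
    and a fixed nonzero residue the question becomes an equation, and the ladder is a disjunction
    over these pairs, since the fibres agree at the first rung, disagree at the last and may begin
    to disagree at any rung between. Each rung needs its own copy of the equations because the
    modulus changes. The two directions need different things. If the count is 0, its partial sums
    are 0 too, and any isomorphism fixes the values of a vanishing partial sum; nothing has to be
    known about its action elsewhere. As everything is finite, an injective map that preserves links
    and labels in one direction suffices there. If the count is positive, the isomorphism is given
    explicitly. A graphic matroid sees neither the order of edges in series nor a twist at the pair
    of apexes. So only the unordered pair of ends of a link is recovered; directions come back from
    the tags of the cells. *)

Section Cycles.
Variable T : finType.
Implicit Types (e : rel T) (c : seq T).

Definition cyc_edges c : {set {set T}} := [set [set x; next c x] | x in c].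

Lemma cyc_edges_rot n c : uniq c -> cyc_edges (rot n c) = cyc_edges c.
Proof.
move=> u; apply/setP => s; apply/imsetP/imsetP => -[x hx ->]; exists x => //;
  by rewrite ?next_rot // ?mem_rot // -(mem_rot n).
Qed.

(** Two vertices with the same edge would be each other's successor, and the cycle would close after
    two steps; a third vertex excludes this. *)
Lemma card_cyc_edges c : 2 < size c -> uniq c -> #|cyc_edges c| = size c.
Proof.
move=> hs u; rewrite card_in_imset ?(card_uniqP u) // => x y hx hy /setP E.
apply/eqP; apply: contraT => nxy.
have := E y; have := E x; rewrite !inE !eqxx /= [y == x]eq_sym (negPf nxy) /=.
move=> /esym/eqP ex /eqP ey.
have [i s hr] := rot_to hx.
have us : uniq (x :: s) by rewrite -hr rot_uniq.
have hs' : 2 < size (x :: s) by rewrite -hr size_rot.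
move: ex ey; rewrite -!(next_rot i u) hr.
case: s {hr} us hs' => [|a [|b s]] //= /and3P[h1 h2 _] _.
rewrite eqxx => + ya; rewrite ya.
move: h1; rewrite !inE !negb_or => /and3P[xa xb _].
by rewrite eq_sym (negPf xa) eqxx => xb'; rewrite xb' eqxx in xb.
Qed.

Lemma cyc_edges_cycle e c s : cycle e c -> s \in cyc_edges c ->
  exists x y, [/\ s = [set x; y], e x y, x \in c & y \in c].
Proof.
move=> h /imsetP[x hx ->]; exists x, (next c x); split=> //.
  exact: next_cycle.
by rewrite mem_next.
Qed.

Definition rel_edges e : {set {set T}} := [set [set p.1; p.2] | p : T * T & e p.1 p.2].

Lemma rel_edgesP e s : reflect (exists x y, s = [set x; y] /\ e x y) (s \in rel_edges e).
Proof.
apply: (iffP imsetP) => [[[x y]]|[x [y [-> h]]]]; first by rewrite inE => h ->; exists x, y.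
by exists (x, y); rewrite ?inE.
Qed.

Definition rel_circuit e (S : {set {set T}}) : Prop :=
  exists c, [/\ 2 < size c, ucycle e c & S = cyc_edges c].

Lemma rel_circuit_sub e S : rel_circuit e S -> S \subset rel_edges e.
Proof.
case=> c [_ /andP[h _] ->]; apply/subsetP => s hs.
have [x [y [-> exy _ _]]] := cyc_edges_cycle h hs.
by apply/rel_edgesP; exists x, y.
Qed.

(** Circuits are cyclic, so one through an edge at [x] may be read from [x] on. Below it is opened
    at an apex and its few vertices are enumerated. *)
Lemma rel_circuit_rot e S x y : rel_circuit e S -> [set x; y] \in S ->
  exists c, [/\ size (x :: c) = #|S|, 2 < size (x :: c), ucycle e (x :: c) & S = cyc_edges (x :: c)].
Proof.
case=> c [hs hu ->] hx; have /andP[hc u] := hu.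
have hxc : x \in c.
  have [a [b [E _ ha hb]]] := cyc_edges_cycle hc hx.
  by have := set21 x y; rewrite E !inE => /orP[]/eqP->.
have [i s hr] := rot_to hxc; exists s; rewrite -hr; split.
- by rewrite size_rot card_cyc_edges.
- by rewrite size_rot.
- by rewrite /ucycle rot_cycle rot_uniq.
- by rewrite cyc_edges_rot.
Qed.

Lemma map_next c : uniq c -> map (next c) c = rot 1 c.
Proof.
case: c => [|x c] // u; apply: (@eq_from_nth _ x); first by rewrite size_map size_rot.
move=> i; rewrite size_map => hi; rewrite (nth_map x) // next_nth mem_nth // index_uniq //.
by rewrite rot1_cons nth_rcons; case: ltnP => // h; rewrite nth_default // if_same.
Qed.

(** Pairing the list with its rotation makes the edge set of a concrete cycle computable. *)
Lemma cyc_edges_zip c : uniq c ->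
  cyc_edges c = [set s in [seq [set p.1; p.2] | p <- zip c (rot 1 c)]].
Proof.
move=> u; rewrite -map_next // -[X in zip X _](map_id c) zip_map -map_comp.
by apply/setP => s; rewrite inE; apply/imsetP/mapP => -[x hx ->]; exists x.
Qed.

Lemma cyc_edges3 x y z : uniq [:: x; y; z] ->
  cyc_edges [:: x; y; z] = [set [set x; y]; [set y; z]; [set z; x]].
Proof. by move=> u; rewrite cyc_edges_zip //; apply/setP => s; rewrite !inE -!orbA. Qed.

Lemma cyc_edges4 x y z t : uniq [:: x; y; z; t] ->
  cyc_edges [:: x; y; z; t] = [set [set x; y]; [set y; z]; [set z; t]; [set t; x]].
Proof. by move=> u; rewrite cyc_edges_zip //; apply/setP => s; rewrite !inE -!orbA. Qed.

Lemma cyc_edges5 x y z t r : uniq [:: x; y; z; t; r] ->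
  cyc_edges [:: x; y; z; t; r] = [set [set x; y]; [set y; z]; [set z; t]; [set t; r]; [set r; x]].
Proof. by move=> u; rewrite cyc_edges_zip //; apply/setP => s; rewrite !inE -!orbA. Qed.

Lemma eq_set2 (x y a b : T) : [set x; y] = [set a; b] -> (x = a /\ y = b) \/ (x = b /\ y = a).
Proof.
move=> /setP E; have hx := E x; have hy := E y; have ha := E a; have hb := E b.
move: hx hy ha hb; rewrite !inE !eqxx ?orbT /= => /esym/orP hx /esym/orP hy ha hb.
case: hx hy ha hb => /eqP -> [] /eqP ->; rewrite ?eqxx ?orbb; auto.
  by move=> _ /eqP ->; auto.
by move=> /eqP ->; auto.
Qed.

End Cycles.

Section MapCycles.
Variables (T U : finType) (h : T -> U) (e : rel T) (e' : rel U).
Hypothesis hinj : injective h.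
Hypothesis he : forall x y, e' (h x) (h y) = e x y.

Lemma cyc_edges_map c : uniq c -> cyc_edges (map h c) = [set h @: (s : {set T}) | s in cyc_edges c].
Proof.
move=> u; apply/setP => s; apply/imsetP/imsetP.
  case=> _ /mapP[x hx ->] ->; exists [set x; next c x]; first by apply/imsetP; exists x.
  by rewrite imsetU1 imset_set1 next_map.
case=> _ /imsetP[x hx ->] ->; exists (h x); first exact: map_f.
by rewrite imsetU1 imset_set1 next_map.
Qed.

Lemma ucycle_map c : ucycle e' (map h c) = ucycle e c.
Proof.
rewrite /ucycle map_inj_uniq // cycle_map; congr (_ && _).
by apply: eq_cycle => x y /=; rewrite he.
Qed.

Lemma rel_circuit_map S : rel_circuit e S -> rel_circuit e' [set h @: (s : {set T}) | s in S].
Proof.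
case=> c [hs hu ->]; exists (map h c); rewrite size_map ucycle_map cyc_edges_map //.
by case/andP: hu.
Qed.

End MapCycles.

Lemma isomorphic_sym M N : isomorphic M N -> isomorphic N M.
Proof.
case=> f [g fK gK] hf; exists g; first by exists f.
move=> C; rewrite (hf (g @: C)) -imset_comp.
by rewrite (eq_imset (g := id)) ?imset_id // => x /=; rewrite gK.
Qed.

Lemma isomorphic_trans M N P : isomorphic M N -> isomorphic N P -> isomorphic M P.
Proof.
case=> f bf hf [g bg hg]; exists (g \o f); first exact: bij_comp.
by move=> C; rewrite hf hg imset_comp.
Qed.

Lemma graphic_circuitsE (X : graph) (C : {set edge X}) :
  @circuits (graphic_matroid X) C <-> rel_circuit (@adj X) (val @: C).
Proof.
split; first by case=> c [h1 h2] e; exists c.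
by case=> c [h1 h2] e; exists c.
Qed.

Definition mk_edge (X : graph) (s : {set 'I_(order X)}) (h : s \in edges X) : edge X :=
  exist _ s h.

Section GraphIso.
Variables (X1 X2 : graph) (h : 'I_(order X1) -> 'I_(order X2)).
Hypothesis hb : bijective h.
Hypothesis ha : forall u v, adj (h u) (h v) = adj u v.

Lemma edge_map_sub (e : edge X1) : h @: val e \in edges X2.
Proof.
have /rel_edgesP[x [y [-> hxy]]] := valP e.
by apply/rel_edgesP; exists (h x), (h y); rewrite imsetU1 imset_set1 ha.
Qed.

Definition edge_map (e : edge X1) : edge X2 :=
  exist _ (h @: val e) (edge_map_sub e).

End GraphIso.

Lemma graph_iso_matroid (X1 X2 : graph) (h : 'I_(order X1) -> 'I_(order X2)) :
  bijective h -> (forall u v, adj (h u) (h v) = adj u v) ->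
  isomorphic (graphic_matroid X1) (graphic_matroid X2).
Proof.
move=> [g hK gK] ha.
have ga u v : adj (g u) (g v) = adj u v by rewrite -ha !gK.
have hi := can_inj hK; have gi := can_inj gK.
exists (edge_map ha).
  exists (edge_map ga) => e; apply: val_inj => /=.
    by rewrite -imset_comp (eq_imset (g := id)) ?imset_id // => x /=; rewrite hK.
  by rewrite -imset_comp (eq_imset (g := id)) ?imset_id // => x /=; rewrite gK.
move=> C; rewrite !graphic_circuitsE.
have -> : val @: (edge_map ha @: C) = [set h @: (s : {set 'I_(order X1)}) | s in val @: C].
  by rewrite -!imset_comp.
split=> [|H]; first exact: rel_circuit_map.
have := rel_circuit_map gi ga H.
rewrite -imset_comp (eq_imset (g := id)) ?imset_id // => s /=.
by rewrite -imset_comp (eq_imset (g := id)) ?imset_id // => x /=; rewrite hK.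
Qed.

(** [X] is the graph [e] on [T], up to renaming and isolated vertices. *)
Definition represents (X : graph) (T : finType) (e : rel T) (emb : T -> 'I_(order X)) : Prop :=
  [/\ injective emb, forall x y, adj (emb x) (emb y) = e x y &
      forall a b : 'I_(order X), adj a b -> exists x, a = emb x].

Lemma rep_circuit (X : graph) (T : finType) (e : rel T) (emb : T -> 'I_(order X)) S :
  represents e emb -> rel_circuit (@adj X) S ->
  exists2 S', rel_circuit e S' & S = [set emb @: (s : {set T}) | s in S'].
Proof.
case=> ei ea er [c [hs hu ->]].
have [c' hc'] : exists c', c = map emb c'.
  have : forall x, x \in c -> exists y, x = emb y.
    by have /andP[hc _] := hu; move=> x hx; exact: er (next_cycle hc hx).
  elim: c {hs hu} => [|x c IH] h; first by exists [::].
  have [y hy] := h x (mem_head _ _).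
  have [|c' ->] := IH; first by move=> z hz; apply: h; rewrite inE hz orbT.
  by exists (y :: c'); rewrite hy.
move: hs hu; rewrite hc' size_map (ucycle_map ei ea) => hs hu.
exists (cyc_edges c'); first by exists c'.
by rewrite (cyc_edges_map ei) //; case/andP: hu.
Qed.

(** Injectivity on edges and the forward image of circuits are all that the counting arguments below
    consume. Outside the edges [F] takes a junk value. *)
Lemma rep_iso (X1 X2 : graph) (T1 T2 : finType) (e1 : rel T1) (e2 : rel T2)
    (m1 : T1 -> 'I_(order X1)) (m2 : T2 -> 'I_(order X2)) :
  represents e1 m1 -> represents e2 m2 ->
  isomorphic (graphic_matroid X1) (graphic_matroid X2) ->
  exists F : {set T1} -> {set T2},
    [/\ {in rel_edges e1 &, injective F},
        forall s, s \in rel_edges e1 -> F s \in rel_edges e2 &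
        forall S, rel_circuit e1 S -> rel_circuit e2 (F @: S)].
Proof.
move=> r1 r2 [f bf hf]; have [i1 a1 d1] := r1; have [i2 a2 d2] := r2.
pose F (s : {set T1}) : {set T2} :=
  if insub (m1 @: s) is Some e then m2 @^-1: (val (f e : edge X2)) else set0.
have E1 (s : {set T1}) : s \in rel_edges e1 -> m1 @: s \in edges X1.
  case/rel_edgesP=> x [y [-> h]]; apply/rel_edgesP; exists (m1 x), (m1 y).
  by rewrite imsetU1 imset_set1 a1.
have E2 (e : edge X2) : exists x y, val e = [set m2 x; m2 y] /\ e2 x y.
  have /rel_edgesP[a [b [-> h]]] := valP e.
  have [x hx] := d2 _ _ h; have [|y hy] := d2 b a; first by rewrite adj_sym.
  by exists x, y; rewrite -a2 -hx -hy.
have P2 x y : m2 @^-1: [set m2 x; m2 y] = [set x; y].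
  by apply/setP => z; rewrite !inE !(inj_eq i2).
pose fe : edge X1 -> edge X2 := f.
have FE (s : {set T1}) (h : m1 @: s \in edges X1) : m2 @: F s = val (fe (mk_edge h)).
  rewrite /F (insubT (fun z => z \in edges X1) h) /= -/fe; have [x [y [-> _]]] := E2 (fe (mk_edge h)).
  by rewrite P2 imsetU1 imset_set1.
exists F; split.
- move=> s t hs ht E; have := FE _ (E1 _ hs); have := FE _ (E1 _ ht).
  rewrite E => -> /val_inj /(bij_inj bf) /(congr1 val) /= /imset_inj; auto.
  by move=> h; apply/esym/h.
- move=> s hs; have [x [y [E h]]] := E2 (fe (mk_edge (E1 _ hs))).
  have := FE _ (E1 _ hs); rewrite E => {}E; apply/rel_edgesP; exists x, y; split=> //.
  by apply: (imset_inj i2); rewrite E imsetU1 imset_set1.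
move=> S hS; have hsub := rel_circuit_sub hS.
pose C : {set edge X1} := [set e | val e \in [set m1 @: (s : {set T1}) | s in S]].
have hC : val @: C = [set m1 @: (s : {set T1}) | s in S].
  apply/setP => a; apply/imsetP/idP => [[e]|ha]; first by rewrite inE => h ->.
  have h : a \in edges X1 by case/imsetP: ha => s /(subsetP hsub) /E1 h ->.
  by exists (mk_edge h); rewrite ?inE.
have := (rel_circuit_map i1 a1 hS); rewrite -hC -graphic_circuitsE hf graphic_circuitsE.
case/(rep_circuit r2) => S' hS' E; suff -> : F @: S = S' by [].
apply: (@imset_inj _ _ (fun s : {set T2} => m2 @: s)); first exact: imset_inj.
rewrite -E; apply/setP => a; apply/imsetP/imsetP.
  case=> _ /imsetP[s hs ->] ->; have h := E1 _ (subsetP hsub _ hs).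
  exists (fe (mk_edge h)); last by rewrite FE.
  by apply/imsetP; exists (mk_edge h) => //; rewrite inE; apply/imsetP; exists s.
case=> x /imsetP[e]; rewrite inE => /imsetP[s hs E'] -> ->.
exists (F s); first exact: imset_f.
have h := E1 _ (subsetP hsub _ hs); rewrite (FE _ h); congr (val (fe _)).
by apply: val_inj.
Qed.

(** * Rigid link graphs *)

Section LinkGraph.
Variable V : finType.

(* The two adjacent apexes are joined to all vertices of [V]; an A-link from [x]
   to [y] is the path x, mid 0, y and a B-link the path x, mid 1, mid 2, y. *)
Definition lvert : finType := (bool + V + 'I_3 * V * V)%type.
Definition apex (b : bool) : lvert := inl (inl b).
Definition vtx (v : V) : lvert := inl (inr v).
Definition mid (t : 'I_3) (x y : V) : lvert := inr (t, x, y).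

Definition ldadj (A B : rel V) : rel lvert := fun p q =>
  match p, q with
  | inl (inl b), inl (inl b') => b != b'
  | inl (inl b), inl (inr v) => true
  | inl (inr v), inr (t, x, y) =>
      match val t with
      | 0 => A x y && ((v == x) || (v == y))
      | 1 => B x y && (v == x)
      | _ => B x y && (v == y)
      end
  | inr (t, x, y), inr (t', x', y') =>
      [&& val t == 1, val t' == 2, B x y, x' == x & y' == y]
  | _, _ => false
  end.

Definition ladj A B : rel lvert := fun p q => ldadj A B p q || ldadj A B q p.

Definition is_apex (p : lvert) : bool := if p is inl (inl _) then true else false.
Definition spoke b v : {set lvert} := [set apex b; vtx v].
Definition hub : {set lvert} := [set apex false; apex true].
Definition apex_edge (s : {set lvert}) := [exists p in s, is_apex p].

Section One.
Variables A B : rel V.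
Notation E := (rel_edges (ladj A B)).

Lemma spoke_edge b v : spoke b v \in E.
Proof. by apply/rel_edgesP; exists (apex b), (vtx v). Qed.

Lemma hub_edge : hub \in E.
Proof. by apply/rel_edgesP; exists (apex false), (apex true). Qed.

Lemma spoke_inj b v b' v' : spoke b v = spoke b' v' -> b = b' /\ v = v'.
Proof. by case/eq_set2 => [] [] // [->] [->]. Qed.

Lemma spoke_hub b v : spoke b v != hub.
Proof. by apply/eqP => /eq_set2[] []. Qed.

Lemma apex_nbr b q : ladj A B (apex b) q -> q = apex (~~ b) \/ exists v, q = vtx v.
Proof.
rewrite /ladj; case: q => [[b'|v]|[[t x] y]] //= h; last by right; exists v.
by left; case: b b' h => [] [].
Qed.

Lemma ladjC p q : ladj A B p q = ladj A B q p.
Proof. by rewrite /ladj orbC. Qed.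

Lemma apex_edgeP s : s \in E -> apex_edge s -> s = hub \/ exists b v, s = spoke b v.
Proof.
have main p q : is_apex p -> ladj A B p q ->
    [set p; q] = hub \/ exists b v, [set p; q] = spoke b v.
  case: p => [[b|v]|[[t x] y]] // _ /apex_nbr [->|[v ->]]; last by right; exists b, v.
  by left; case: b => //=; rewrite /hub setUC.
case/rel_edgesP=> [p [q [-> h]]] /existsP[r] /andP[].
rewrite !inE => /orP[] /eqP -> ha; first exact: main.
by rewrite setUC; apply: main => //; rewrite ladjC.
Qed.

Lemma triangle v : rel_circuit (ladj A B) [set hub; spoke true v; spoke false v].
Proof.
exists [:: apex false; apex true; vtx v]; split=> //.
by rewrite cyc_edges3 // /spoke [[set vtx v; _]]setUC.
Qed.

Hypothesis B_irr : irreflexive B.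

(** Adjacent middles are mid 1 and mid 2 of one B-link and hang on its two ends, which differ
    because [B] is irreflexive. *)
Lemma mid_mid_vtx v m m' : ladj A B (inr m) (inr m') ->
  ldadj A B (vtx v) (inr m) -> ldadj A B (vtx v) (inr m') -> False.
Proof.
case: m m' => [[t x] y] [[t' x'] y'] /=.
case/orP => /and5P[/eqP -> /eqP -> hB /eqP -> /eqP ->] /=.
  by move=> /andP[_ /eqP ->] /andP[_ /eqP e]; rewrite e B_irr in hB.
by move=> /andP[_ /eqP ->] /andP[_ /eqP e]; rewrite -e B_irr in hB.
Qed.

(** There are only two apexes, elements of [V] are pairwise non-adjacent and see no two adjacent
    middles, middles do not touch apexes, and adjacent middles have tags 1 and 2, which rules out
    three of them. What remains is both apexes and one vertex. *)
Lemma triangleP S : rel_circuit (ladj A B) S -> #|S| = 3 ->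
  exists v, [/\ hub \in S, spoke true v \in S & spoke false v \in S].
Proof.
case=> c [h2 hu ->]; have /andP[hc u] := hu; rewrite card_cyc_edges // => hs.
case: c hs hu hc u {h2} => [|p [|q [|r [|? ?]]]] //= _ hu.
rewrite andbT => /and3P[pq qr rp] u.
have {hu} pr : p != r by move: u; rewrite !inE negb_or -andbA => /and3P[].
have {u} -> : cyc_edges [:: p; q; r] = [set [set p; q]; [set q; r]; [set r; p]].
  exact: cyc_edges3.
suff [v [h1 h2 h3]] : exists v, [/\ hub \in [:: [set p; q]; [set q; r]; [set r; p]],
    spoke true v \in [:: [set p; q]; [set q; r]; [set r; p]] &
    spoke false v \in [:: [set p; q]; [set q; r]; [set r; p]]].
  by exists v; rewrite !inE -!orbA in h1 h2 h3 *; split.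
have sC x y : [set x; y] = [set y; x] :> {set lvert} by exact: setUC.
move: pq qr rp pr; rewrite /ladj.
case: p => [[b|v]|[[t x] y]]; case: q => [[b'|v']|[[t' x'] y']];
  case: r => [[b''|v'']|[[t'' x''] y'']] //=; rewrite ?orbF.
- by case: b b' b'' => [] [] [].
- move=> bb _ _ _; exists v''; rewrite !inE /hub /spoke.
  by case: b b' bb => [] [] //= _; rewrite ?eqxx ?(sC (vtx v'')) ?eqxx ?orbT ?(sC (apex true) (apex false)) ?eqxx ?orbT.
- move=> _ _ bb _; exists v'; rewrite !inE /hub /spoke.
  by case: b b'' bb => [] [] //= _; rewrite ?eqxx ?(sC (vtx v')) ?eqxx ?orbT ?(sC (apex true) (apex false)) ?eqxx ?orbT.
- move=> _ bb _ _; exists v; rewrite !inE /hub /spoke.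
  by case: b' b'' bb => [] [] //= _; rewrite ?eqxx ?(sC (vtx v)) ?eqxx ?orbT ?(sC (apex true) (apex false)) ?eqxx ?orbT.
- by move=> h1 h2 h3; case: (@mid_mid_vtx v (t', x', y') (t'', x'', y'')).
- move=> h1 h2 h3; case: (@mid_mid_vtx v' (t, x, y) (t'', x'', y'')) => //.
  by rewrite ladjC.
- by move=> h1 h2 h3; case: (@mid_mid_vtx v'' (t, x, y) (t', x', y')).
move=> h1 h2 h3; case/orP: h1 => /and5P[/eqP a1 /eqP a2 _ _ _];
case/orP: h2 => /and5P[/eqP b1 /eqP b2 _ _ _];
case/orP: h3 => /and5P[/eqP c1 /eqP c2 _ _ _]; congruence.
Qed.

(** * Links read off short circuits through an apex *)

Section ShortPaths.
Variables (S : {set {set lvert}}) (b1 b2 : bool) (x y : V).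
Hypothesis circS : rel_circuit (ladj A B) S.
Hypothesis xy : x != y.
Hypothesis spx : spoke b1 x \in S.
Hypothesis spS : forall s, s \in S -> apex_edge s -> s = spoke b1 x \/ s = spoke b2 y.

Lemma apex_next q : [set apex b1; q] \in S -> q = vtx x \/ (q = vtx y /\ b1 = b2).
Proof.
move=> h; have ha : apex_edge [set apex b1; q].
  by apply/existsP; exists (apex b1); rewrite !inE eqxx.
case: (spS h ha) => /eq_set2[] [] // h1 h2; first by left.
by right; split=> //; case: h1.
Qed.

Lemma second_not_apex q r : [set apex b1; q] \in S -> [set q; r] \in S ->
  r != apex b1 -> is_apex r = false.
Proof.
move=> hq hr nr; apply/negbTE/negP => ar.
have ha : apex_edge [set q; r] by apply/existsP; exists r; rewrite !inE eqxx orbT.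
have [eq|[eq eb]] := apex_next hq; move: (spS hr ha); rewrite eq => -[] /eq_set2[] [] //.
- by move=> _ e; rewrite e eqxx in nr.
- by case=> e; have := xy; rewrite e eqxx.
- by case=> e; have := xy; rewrite e eqxx.
by move=> _ e; rewrite eb e eqxx in nr.
Qed.

Lemma ends q r : [set apex b1; q] \in S -> [set apex b1; r] \in S -> q != r ->
  (q = vtx x /\ r = vtx y) \/ (q = vtx y /\ r = vtx x).
Proof.
move=> /apex_next[->|[-> _]] /apex_next[->|[-> _]]; rewrite ?eqxx //; auto.
Qed.

(** Apart from the two spokes two edges remain, through one vertex that is no apex. It is a middle
    adjacent to both ends, and only mid 0 is adjacent to two elements of [V]. *)
Lemma path_A : #|S| = 4 -> A x y || A y x.
Proof.
move=> hS; have [c [hs _ /andP[hc u] e]] := rel_circuit_rot circS spx.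
rewrite hS in hs; case: c hs hc u e => [|q [|r [|z [|? ?]]]] //= _.
rewrite andbT => /and4P[h1 h2 h3 h4] u e.
have {}e : S = [set [set apex b1; q]; [set q; r]; [set r; z]; [set z; apex b1]].
  by rewrite e; apply: cyc_edges4.
have e1 : [set apex b1; q] \in S by rewrite e !inE eqxx.
have e2 : [set q; r] \in S by rewrite e !inE eqxx ?orbT.
have e4 : [set apex b1; z] \in S by rewrite [[set apex b1; z]]setUC e !inE eqxx ?orbT.
move: u; rewrite !inE !negb_or => /and4P[/and3P[_ n1 _] /andP[_ n2] _ _].
have ra := second_not_apex e1 e2 (contraNneq _ n1).
have {}ra : is_apex r = false by apply: ra => ->.
have E' : (q = vtx x /\ z = vtx y) \/ (q = vtx y /\ z = vtx x) := ends e1 e4 n2.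
have {}h3 : ladj A B z r by rewrite ladjC.
have [w [w' [ew ew' hw]]] : exists w w', [/\ q = vtx w, z = vtx w' & (w = x /\ w' = y) \/ (w = y /\ w' = x)].
  by case: E' => -[-> ->]; [exists x, y|exists y, x]; split; auto.
have nw : w != w' by case: hw => -[-> ->] //; rewrite eq_sym.
suff : A w w' || A w' w by case: hw => -[-> ->] //; rewrite orbC.
move: h2 h3; rewrite ew ew' /ladj; case: r ra {h1 h4 n1 e2 e} => [[b|v]|[[t a] b]] //= _.
rewrite !orbF; case: (val t) => [|[|n]].
- case/andP=> hA /orP[] /eqP e' /andP[_ /orP[]] /eqP e''; rewrite e' e'' ?hA ?orbT //;
  by rewrite e' e'' eqxx in nw.
- by case/andP=> _ /eqP e' /andP[_ /eqP e'']; rewrite e' e'' eqxx in nw.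
- by case/andP=> _ /eqP e' /andP[_ /eqP e'']; rewrite e' e'' eqxx in nw.
Qed.

Lemma path_B : #|S| = 5 -> B x y || B y x.
Proof.
move=> hS; have [c [hs _ /andP[hc u] e]] := rel_circuit_rot circS spx.
rewrite hS in hs; case: c hs hc u e => [|q [|r [|r' [|z [|? ?]]]]] //= _.
rewrite andbT => /and5P[h1 h2 h3 h4 h5] u e.
have {}e : S = [set [set apex b1; q]; [set q; r]; [set r; r']; [set r'; z]; [set z; apex b1]].
  by rewrite e; apply: cyc_edges5.
have e1 : [set apex b1; q] \in S by rewrite e !inE eqxx.
have e2 : [set q; r] \in S by rewrite e !inE eqxx ?orbT.
have e3 : [set z; r'] \in S by rewrite setUC e !inE eqxx ?orbT.
have e4 : [set apex b1; z] \in S by rewrite [[set apex b1; z]]setUC e !inE eqxx ?orbT.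
move: u; rewrite !inE !negb_or => /and5P[/and4P[_ n1 n1' _] /and3P[_ _ n2] _ _ _].
have ra : is_apex r = false by apply: (second_not_apex e1 e2); rewrite eq_sym.
have ra' : is_apex r' = false by apply: (second_not_apex e4 e3); rewrite eq_sym.
have E' : (q = vtx x /\ z = vtx y) \/ (q = vtx y /\ z = vtx x) := ends e1 e4 n2.
have {}h4 : ladj A B z r' by rewrite ladjC.
have [w [w' [ew ew' hw]]] : exists w w', [/\ q = vtx w, z = vtx w' & (w = x /\ w' = y) \/ (w = y /\ w' = x)].
  by case: E' => -[-> ->]; [exists x, y|exists y, x]; split; auto.
suff : B w w' || B w' w by case: hw => -[-> ->] //; rewrite orbC.
move: h2 h3 h4; rewrite ew ew' /ladj; case: r ra {h1 n1 e2 e3 e} => [[b|v]|[[t a] b]] //= _;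
  case: r' ra' {n1'} => [[b'|v']|[[t' a'] b']] //= _.
rewrite !orbF => h2 /orP[] /and5P[/eqP k1 /eqP k2 hB /eqP k3 /eqP k4]; move: h2;
  rewrite k1 k2 k3 k4 /=.
  by move=> /andP[_ /eqP ->] /andP[_ /eqP ->]; rewrite hB.
by move=> /andP[_ /eqP ->] /andP[_ /eqP ->]; rewrite hB orbT.
Qed.

End ShortPaths.
End One.

(** * A matroid isomorphism preserves links *)

Section Sound.
Variables A1 B1 A2 B2 : rel V.
Hypotheses (irr1 : irreflexive B1) (irr2 : irreflexive B2).
Notation E1 := (rel_edges (ladj A1 B1)).
Notation E2 := (rel_edges (ladj A2 B2)).
Variable F : {set lvert} -> {set lvert}.
Hypothesis Finj : {in E1 &, injective F}.
Hypothesis FE : forall s, s \in E1 -> F s \in E2.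
Hypothesis Fcirc : forall S, rel_circuit (ladj A1 B1) S -> rel_circuit (ladj A2 B2) (F @: S).
Hypothesis V2 : exists v v' : V, v != v'.

Lemma card_img S : rel_circuit (ladj A1 B1) S -> #|F @: S| = #|S|.
Proof.
move=> /rel_circuit_sub/subsetP h; apply: card_in_imset => s t hs ht.
by apply: Finj; apply: h.
Qed.

Let tri v : {set {set lvert}} := [set hub; spoke true v; spoke false v].

Lemma triE s v : s \in tri v -> s \in E1.
Proof. by rewrite !inE -orbA => /or3P[] /eqP ->; rewrite ?hub_edge ?spoke_edge. Qed.

Lemma card_tri v : #|tri v| = 3.
Proof.
rewrite /tri setUC cardsU1 cards2 !inE negb_or spoke_hub eq_sym [hub == _]eq_sym spoke_hub /=.
by case: eqP => // /spoke_inj[].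
Qed.

Lemma img_tri v : exists w, [/\ hub \in F @: tri v, spoke true w \in F @: tri v &
  spoke false w \in F @: tri v].
Proof.
have c := triangle A1 B1 v; apply: triangleP (Fcirc c) _ => //.
by rewrite (card_img c) -/(tri v) card_tri.
Qed.

(** The hub is the only edge that lies in two of the triangles; this is where two elements of [V]
    are needed. *)
Lemma F_hub : F hub = hub.
Proof.
have [v [v' vv']] := V2; have [w [/imsetP[s hs e] _ _]] := img_tri v.
have [w' [/imsetP[s' hs' e'] _ _]] := img_tri v'.
have es : s = s' by apply: Finj (triE hs) (triE hs') _; rewrite -e.
suff {1}-> : hub = s by rewrite -e.
move: hs hs'; rewrite -es !inE -!orbA => /or3P[/eqP -> //||] /eqP -> /or3P[/eqP -> //||] /eqP /spoke_inj[_ e1];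
  by rewrite e1 eqxx in vv'.
Qed.

(** With the hub fixed, the two spokes at [v] go to the two spokes at one [w]. Which apex goes to
    which may depend on [v]: this is the twist that the matroid does not see. *)
Lemma F_spoke v : exists w, forall b, exists b', F (spoke b v) = spoke b' w.
Proof.
have [w [_ /imsetP[s hs e] /imsetP[s' hs' e']]] := img_tri v; exists w.
have nh s0 b : spoke b w = F s0 -> s0 \in tri v -> exists c, s0 = spoke c v.
  move=> e0; rewrite !inE -orbA => /or3P[]/eqP h; last by exists false.
    by have := spoke_hub b w; rewrite e0 h F_hub eqxx.
  by exists true.
have [c ec] := nh _ _ e hs; have [c' ec'] := nh _ _ e' hs'.
have cc : c' = ~~ c.
  by case: c c' ec ec' => [] [] // h h'; move: e'; rewrite h' -h -e => /spoke_inj[].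
move=> b; case: (b =P c) => [->|/eqP nb]; first by exists true; rewrite -ec.
by exists false; rewrite e' ec' cc; case: b c nb {ec cc} => [] [].
Qed.

(** A link closes, with two spokes at one apex, to a circuit of 4 or 5 edges. Its image has as many
    edges and again only two spokes, so it exhibits a link of the same kind. *)
Theorem link_sound : exists phi : V -> V, [/\ injective phi,
    forall x y, x != y -> A1 x y -> A2 (phi x) (phi y) || A2 (phi y) (phi x) &
    forall x y, x != y -> B1 x y -> B2 (phi x) (phi y) || B2 (phi y) (phi x)].
Proof.
have [phi hphi] := fin_all_exists F_spoke.
have sp_all v c : exists b, F (spoke b v) = spoke c (phi v).
  have [b1 h1] := hphi v true; have [b2 h2] := hphi v false.
  have : b1 != b2.
    apply/eqP => e; move: h2; rewrite -e -h1 => /Finj.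
    by rewrite !spoke_edge => /(_ isT isT) /spoke_inj[].
  by case: b1 b2 c h1 h2 => [] [] [] h1 h2 //; [exists true|exists false|exists false|exists true].
have pinj : injective phi.
  move=> v v' e; have [b hb] := hphi v' true; have [b' hb'] := sp_all v b.
  have /Finj : F (spoke b' v) = F (spoke true v') by rewrite hb hb' e.
  by rewrite !spoke_edge => /(_ isT isT) /spoke_inj[].
(* An injection of the finite [V] into itself is onto, so hub and spokes are already images of hub
   and spokes, and no other edge can map to them. *)
have Fapex s : s \in E1 -> apex_edge (F s) -> apex_edge s.
  move=> hs /(apex_edgeP (FE hs)) [|[b [w e]]].
    rewrite -{1}F_hub => /Finj -> //; last exact: hub_edge.
    by apply/existsP; exists (apex true); rewrite !inE eqxx orbT.
  have [g _ gK] := injF_bij pinj; rewrite -(gK w) in e.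
  have [c hc] := sp_all (g w) b; move: e; rewrite -hc => /Finj ->; rewrite ?spoke_edge //.
  by apply/existsP; exists (apex c); rewrite !inE eqxx.
have vm v m : apex_edge [set vtx v; inr m] = false.
  by apply/existsP => -[z]; rewrite !inE => /andP[/orP[]/eqP->].
have main x y S : x != y -> rel_circuit (ladj A1 B1) S -> spoke true x \in S ->
    (forall s, s \in S -> apex_edge s -> s = spoke true x \/ s = spoke true y) ->
    exists b1 b2, spoke b1 (phi x) \in F @: S /\
      forall s, s \in F @: S -> apex_edge s -> s = spoke b1 (phi x) \/ s = spoke b2 (phi y).
  move=> xy hS hx hap; have [b1 h1] := hphi x true; have [b2 h2] := hphi y true.
  exists b1, b2; split; first by rewrite -h1 imset_f.
  move=> _ /imsetP[s hs ->] /(Fapex _ (subsetP (rel_circuit_sub hS) _ hs)) ha.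
  by case: (hap s hs ha) => ->; rewrite ?h1 ?h2; auto.
exists phi; split=> // x y xy hxy.
  pose m := mid ord0 x y; pose c := [:: apex true; vtx x; m; vtx y].
  have nv : vtx x != vtx y by apply: contraNneq xy => -[->].
  have uc : uniq c by rewrite /= !inE !negb_or /= nv.
  have hc : rel_circuit (ladj A1 B1) (cyc_edges c).
    exists c; split=> //; rewrite /ucycle uc andbT /= /ladj /= hxy !eqxx ?orbT //.
  have cE := cyc_edges4 uc.
  have [||b1 [b2 [g1 g2]]] := main x y _ xy hc.
  - by rewrite cE !inE eqxx.
  - move=> s; rewrite cE !inE -!orbA => /or4P[] /eqP ->; auto; rewrite ?vm //.
      by rewrite setUC vm.
    by rewrite setUC; auto.
  apply: (path_A (Fcirc hc) (b1 := b1) (b2 := b2)) => //; first by rewrite (inj_eq pinj).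
  by rewrite (card_img hc) card_cyc_edges.
pose m := mid (inord 1) x y; pose m' := mid (inord 2) x y.
pose c := [:: apex true; vtx x; m; m'; vtx y].
have nv : vtx x != vtx y by apply: contraNneq xy => -[->].
have nm : m != m' by apply/eqP => -[] /(congr1 val); rewrite /= !inordK.
have uc : uniq c by rewrite /= !inE !negb_or /= nv nm.
have hc : rel_circuit (ladj A1 B1) (cyc_edges c).
  by exists c; split=> //; rewrite /ucycle uc andbT /= /ladj /= !inordK //= hxy !eqxx ?orbT.
have cE := cyc_edges5 uc.
have [||b1 [b2 [g1 g2]]] := main x y _ xy hc.
- by rewrite cE !inE eqxx.
- move=> s; rewrite cE !inE -!orbA => /or4P[|||/orP[]] /eqP ->; auto; rewrite ?vm //.
  + by move/existsP=> [z]; rewrite !inE => /andP[/orP[]/eqP->].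
  + by rewrite setUC vm.
  by rewrite setUC; auto.
apply: (path_B (Fcirc hc) (b1 := b1) (b2 := b2)) => //; first by rewrite (inj_eq pinj).
by rewrite (card_img hc) card_cyc_edges.
Qed.

End Sound.
End LinkGraph.

Section Complete.
Variables (N : nat) (a1 a2 : rel 'I_N).
Variables (s1 : symmetric a1) (s2 : symmetric a2) (i1 : irreflexive a1) (i2 : irreflexive a2).
Let X1 := Graph s1 i1.
Let X2 := Graph s2 i2.

(** Both graphs are embedded by the same [m], so the vertices outside its image are isolated in both
    and can be left in place. *)
Lemma rep_iso_complete (T : finType) (e1 e2 : rel T) (m : T -> 'I_N) (Phi : T -> T) :
  @represents X1 T e1 m -> @represents X2 T e2 m -> bijective Phi ->
  (forall x y, e2 (Phi x) (Phi y) = e1 x y) ->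
  isomorphic (graphic_matroid X1) (graphic_matroid X2).
Proof.
case=> [mi /= ae1 d1] [_ /= ae2 d2] bP hP.
pose h (u : 'I_N) := if [pick x | m x == u] is Some x then m (Phi x) else u.
have hm x : h (m x) = m (Phi x).
  by rewrite /h; case: pickP => [y /eqP /mi -> //|/(_ x)]; rewrite eqxx.
have hn u : (forall x, u <> m x) -> h u = u.
  by move=> nu; rewrite /h; case: pickP => // x /eqP e; case: (nu x).
have im u : (exists x, u = m x) \/ (forall x, u <> m x).
  case: (pickP (fun x => m x == u)) => [x /eqP <-|nx]; first by left; exists x.
  by right=> x e; have := nx x; rewrite e eqxx.
have hi : injective h.
  move=> u v; case: (im u) => [[x ->]|nu]; case: (im v) => [[y ->]|nv]; rewrite ?hm.
  - by move=> /mi /(bij_inj bP) ->.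
  - by rewrite (hn v) // => e; case: (nv (Phi x)).
  - by rewrite (hn u) // => e; case: (nu (Phi y)).
  by rewrite !hn.
apply: (@graph_iso_matroid X1 X2 h); first exact: injF_bij.
move=> u v /=; case: (im u) => [[x ->]|nu]; case: (im v) => [[y ->]|nv]; rewrite ?hm.
- by rewrite ae1 ae2.
- rewrite (hn v) //; transitivity false; last apply/esym; apply/negbTE/negP => H;
    [move: H; rewrite s2 => /d2|move: H; rewrite s1 => /d1] => -[z]; exact: nv.
- rewrite (hn u) //; transitivity false; last apply/esym; apply/negbTE/negP => H;
    [move/d2: H|move/d1: H] => -[z]; exact: nu.
rewrite !hn //; transitivity false; last apply/esym; apply/negbTE/negP => H;
    [move/d2: H|move/d1: H] => -[z]; exact: nu.
Qed.

Lemma link_complete (V : finType) (A1 B1 A2 B2 : rel V) (m : lvert V -> 'I_N) (phi : V -> V) :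
  @represents X1 _ (ladj A1 B1) m -> @represents X2 _ (ladj A2 B2) m -> bijective phi ->
  (forall x y, A2 (phi x) (phi y) = A1 x y) ->
  (forall x y, B2 (phi x) (phi y) = B1 x y) ->
  isomorphic (graphic_matroid X1) (graphic_matroid X2).
Proof.
move=> r1 r2 bphi hA hB.
pose Phi (p : lvert V) : lvert V := match p with
  | inl (inl b) => inl (inl b)
  | inl (inr v) => inl (inr (phi v))
  | inr (t, x, y) => inr (t, phi x, phi y)
  end.
have pi := bij_inj bphi.
apply: (rep_iso_complete (Phi := Phi) r1 r2).
  apply: injF_bij => -[[b|v]|[[t x] y]] [[b'|v']|[[t' x'] y']] //= [].
    by move/pi ->.
  by move=> -> /pi -> /pi ->.
have hd p q : ldadj A2 B2 (Phi p) (Phi q) = ldadj A1 B1 p q.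
  case: p q => [[b|v]|[[t x] y]] [[b'|v']|[[t' x'] y']] //=;
  by rewrite ?hA ?hB !(inj_eq pi).
by move=> p q; rewrite /ladj !hd.
Qed.

End Complete.

(** * Rigid names for unary labels *)

Section Labelled.
Variables (U : finType) (Y : nat).
Hypothesis Y4 : 3 < Y.
Let V : finType := (U + 'I_Y)%type.

(* Unary labels become A-links to a line of Y names, whose consecutive names are
   B-linked; the A-link from name 0 to name 2 makes the line rigid. *)
Definition lab_A (un : U -> 'I_Y -> bool) (bin : rel U) : rel V := fun p q =>
  match p, q with
  | inl p, inl p' => bin p p'
  | inl p, inr w => un p w
  | inr w, inr w' => (val w == 0) && (val w' == 2)
  | _, _ => false
  end.

Definition lab_B : rel V := fun p q =>
  if p is inr w then if q is inr w' then val w' == (val w).+1 else false else false.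

Lemma lab_B_irr : irreflexive lab_B.
Proof. by case=> // w /=; rewrite -[X in X == _]addn0 -addn1 eqn_add2l. Qed.

Variables (un1 un2 : U -> 'I_Y -> bool) (bin1 bin2 : rel U).

(** An injective map that keeps neighbours on a line is determined by its first two values.
    Exchanging 0 and 2 would fix 1 and leave for 3 only the neighbour 1 of 0, already taken; this is
    where a fourth name is needed. *)
Lemma line_rigid (pi : nat -> nat) (n : nat) : 3 < n -> {in gtn n &, injective pi} ->
  (forall i, i.+1 < n -> pi i.+1 = (pi i).+1 \/ pi i = (pi i.+1).+1) ->
  (pi 0 = 0 /\ pi 2 = 2) \/ (pi 0 = 2 /\ pi 2 = 0) ->
  forall i, i < n -> pi i = i.
Proof.
move=> n4 inj hs h02.
have h0 := hs 0; have h1 := hs 1; have h2 := hs 2.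
have i13 : pi 1 = pi 3 -> False by move=> e; have := inj 1 3; rewrite -!topredE /=; lia.
have p0 : pi 0 = 0 by lia.
elim/ltn_ind => -[|[|i]] IH hi //; first by lia.
have e1 : pi i.+1 = i.+1 by apply: IH; lia.
have e0 : pi i = i by apply: IH; lia.
have e02 : pi i.+2 = pi i -> False by move=> e; have := inj i.+2 i; rewrite -!topredE /=; lia.
have := hs i.+1; lia.
Qed.

(** B-links join names only, so names go to names, each of them being on the line; rigidity fixes
    them, and injectivity leaves only elements of [U] for elements of [U]. *)
Lemma lab_sound (phi : V -> V) : injective phi ->
  (forall x y, x != y -> lab_A un1 bin1 x y ->
     lab_A un2 bin2 (phi x) (phi y) || lab_A un2 bin2 (phi y) (phi x)) ->
  (forall x y, x != y -> lab_B x y -> lab_B (phi x) (phi y) || lab_B (phi y) (phi x)) ->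
  exists psi : U -> U, [/\ injective psi,
    forall p w, un1 p w -> un2 (psi p) w &
    forall p q, p != q -> bin1 p q -> bin2 (psi p) (psi q) || bin2 (psi q) (psi p)].
Proof.
move=> pinj hA hB.
have hB' (i j : 'I_Y) : val j = (val i).+1 ->
    exists i' j', [/\ phi (inr i) = inr i', phi (inr j) = inr j' &
      (val j' = (val i').+1 \/ val i' = (val j').+1)].
  move=> e; have nij : inr i != inr j :> V.
    by move: e => /= e; apply/eqP => -[/(congr1 val) /=]; lia.
  have := hB (inr i) (inr j) nij; rewrite /= e eqxx => /(_ isT).
  case: (phi (inr i)) => [u|i']; case: (phi (inr j)) => [u'|j'] //= h.
  by exists i', j'; split=> //; case/orP: h => /eqP; auto.
have [Y' eY] : exists Y', Y = Y'.+1 by case: (Y) Y4 => // Y' _; exists Y'.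
have names (i : 'I_Y) : exists i', phi (inr i) = inr i'.
  case: (ltnP (val i).+1 Y) => hi.
    by have [i' [j' [-> _ _]]] := hB' i (Ordinal hi) erefl; exists i'.
  (* The last name has no successor; its link to its predecessor is used instead. *)
  have i0 : 0 < val i by move: hi => /=; lia.
  have hi' : (val i).-1 < Y by exact: leq_ltn_trans (leq_pred _) (ltn_ord i).
  have [|i' [j' [_ -> _]]] := hB' (Ordinal hi') i; first by rewrite /= prednK.
  by exists j'.
have [pi hpi] := fin_all_exists names.
have o k (h : k < Y) : {i : 'I_Y | val i = k} by exists (Ordinal h).
pose f k := if insub k is Some i then val (pi i) else k.
have fE (i : 'I_Y) : f (val i) = val (pi i) by rewrite /f valK.
have rig : forall i : 'I_Y, pi i = i.
  suff H k : k < Y -> f k = k by move=> i; apply: val_inj; rewrite -fE; exact: H (ltn_ord i).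
  apply: line_rigid => //.
  - move=> i j; rewrite -!topredE /= => /o[i' <-] /o[j' <-]; rewrite !fE => /val_inj e.
    by have /pinj [->] : phi (inr i') = phi (inr j') by rewrite !hpi e.
  - move=> i hi; have [j ej] := o _ hi; have [i' ei] := o _ (ltnW hi).
    rewrite -ej -ei !fE; have [|a [b []]] := hB' i' j; first by rewrite ej ei.
    by rewrite !hpi => -[->] [->] /= h; lia.
  have [i0 e0] := o 0 (@ltn_trans 3 0 Y isT Y4); have [i2 e2] := o 2 (@ltn_trans 3 2 Y isT Y4).
  have -> : f 0 = val (pi i0) by rewrite -fE e0.
  have -> : f 2 = val (pi i2) by rewrite -fE e2.
  have n02 : inr i0 != inr i2 :> V.
    by apply/eqP => -[/(congr1 val)]; rewrite e0 e2.
  have := hA _ _ n02; rewrite /= e0 e2 /= !hpi /= => /(_ isT).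
  by case/orP => /andP[/eqP -> /eqP ->]; auto.
have lab u : exists u', phi (inl u) = inl u'.
  case E: (phi (inl u)) => [u'|i]; first by exists u'.
  have : phi (inl u) = phi (inr i) by rewrite hpi rig.
  by move/pinj.
have [psi hpsi] := fin_all_exists lab.
exists psi; split.
- move=> u v e; have /pinj [->] : phi (inl u) = phi (inl v) by rewrite !hpsi e.
  by [].
- move=> p w h; have := hA (inl p) (inr w) isT h.
  by rewrite hpsi hpi rig /= orbF.
move=> p q npq h; have := hA (inl p) (inl q) _ h; rewrite !hpsi /=; apply.
by apply: contraNneq npq => -[->].
Qed.

Lemma lab_complete (psi : U -> U) : bijective psi ->
  (forall p w, un2 (psi p) w = un1 p w) ->
  (forall p q, bin2 (psi p) (psi q) = bin1 p q) ->
  exists phi : V -> V, [/\ bijective phi,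
    forall x y, lab_A un2 bin2 (phi x) (phi y) = lab_A un1 bin1 x y &
    forall x y, lab_B (phi x) (phi y) = lab_B x y].
Proof.
move=> bpsi hu hb; have pi := bij_inj bpsi.
exists (fun p => match p with inl u => inl (psi u) | inr w => inr w end); split.
- by apply: injF_bij => -[u|w] [u'|w'] // [] // /pi ->.
- by move=> [u|w] [u'|w'] /=.
by move=> [u|w] [u'|w'] /=.
Qed.

End Labelled.

(** * Counting walks with ladders *)

(* Leibniz triangle: the entries 1 / ((n + 1) C(n, k)) satisfy
   L(n, k + 1) = L(n - 1, k) - L(n, k), so all their denominators divide every
   common multiple of 1, ..., n + 1. *)
Lemma leibniz_dvd c n k : k <= n -> (forall d, 0 < d <= n.+1 -> d %| c) ->
  n.+1 * 'C(n, k) %| c.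
Proof.
elim: k n => [|k IH] n kn hc; first by rewrite bin0 muln1 hc // ltnS leqnn.
case: n kn hc => [//|n] kn hc.
have /dvdnP[x hx] : n.+1 * 'C(n, k) %| c.
  by apply: IH => // d /andP[d0 dn]; apply: hc; rewrite d0 ltnW.
have /dvdnP[y hy] : n.+2 * 'C(n.+1, k) %| c by apply: IH hc; rewrite ltnW.
have e1 : k.+1 * 'C(n.+1, k.+1) = n.+1 * 'C(n, k) by rewrite -mul_bin_diag.
have e2 : k.+1 * 'C(n.+1, k.+1) = (n.+1 - k) * 'C(n.+1, k) by rewrite -mul_bin_left.
have c0 : 0 < 'C(n.+1, k.+1) by rewrite bin_gt0.
apply/dvdnP; exists (x - y).
set B := 'C(n.+1, k.+1) in e1 e2 c0 *; set D := 'C(n.+1, k) in hy e2.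
have hx' : c = x * (k.+1 * B) by rewrite hx e1.
have kn' : k < n.+1 by [].
have hy' : (n.+1 - k) * c = y * (n.+2 * (k.+1 * B)) by rewrite hy e2; nia.
have hxy : (n.+1 - k) * x = y * n.+2.
  have K : 0 < k.+1 * B by rewrite muln_gt0.
  by apply/eqP; rewrite -(eqn_pmul2r K) -mulnA -hx' hy' mulnA.
rewrite hx' mulnBl; nia.
Qed.

(** All [(n + 1) C(n, k)] are at most [c], and over [k] they sum to [(n + 1) 2^n]; cancel
    [n + 1]. *)
Lemma common_multiple_ge c n : 0 < c -> (forall d, 0 < d <= n.+1 -> d %| c) -> 2 ^ n <= c.
Proof.
move=> c0 hc; rewrite -(leq_pmul2l (ltn0Sn n)).
rewrite -[2]/(1 + 1) expnDn (eq_bigr (fun i : 'I_n.+1 => 'C(n, i))); last first.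
  by move=> i _; rewrite !exp1n !muln1.
rewrite big_distrr /=.
have -> : n.+1 * c = \sum_(i < n.+1) c by rewrite sum_nat_const card_ord.
apply: leq_sum => i _; apply: dvdn_leq => //; apply: leibniz_dvd => //.
by rewrite -ltnS.
Qed.

Section Walks.
Variables (T : nat) (E : nat -> nat -> bool) (v0 : nat).

Fixpoint walks (t v : nat) : nat :=
  if t is t'.+1 then \sum_(0 <= u < T | E u v) walks t' u else (v == v0).

(** Adding the predecessors one at a time gives equations with three terms, so that a single
    solution fits into the fixed fields of a cell. *)
Definition psum (t v u : nat) : nat :=
  if t is t'.+1 then \sum_(0 <= u' < u.+1 | E u' v) walks t' u' else (v == v0).

Lemma psum_last t v : 0 < T -> psum t v T.-1 = walks t v.
Proof. by case: t => //= t T0; rewrite prednK. Qed.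

Lemma psum0 t v : psum t.+1 v 0 = if E 0 v then walks t 0 else 0.
Proof. by rewrite /= big_mkcond big_nat1. Qed.

Lemma psumS t v u : psum t.+1 v u.+1 = psum t.+1 v u + if E u.+1 v then walks t u.+1 else 0.
Proof. by rewrite /= big_mkcond big_nat_recr //= -big_mkcond. Qed.

Lemma walks_bound t v : walks t v <= T ^ t.
Proof.
elim: t v => [|t IH] v /=; first by rewrite expn0; case: (v == v0).
rewrite expnS big_mkcond /= (leq_trans (n := \sum_(0 <= u < T) T ^ t)) //.
  by apply: leq_sum => u _; case: (E u v).
by rewrite sum_nat_const_nat subn0.
Qed.

End Walks.

(* A cell with [tg] = 0 is the element [al] of the two-element fibre over rung
   [jj]. The other cells lie between the elements [al] and [ga] of the fibres over
   [jj] and [jj] + 1: with [tg] = 1, the value [ii] of the variable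
   [psum ti vv uu] modulo [mj jj] + 1, and with [tg] = 2, the solution ([ii], [kk])
   of psum t v u = psum t v (u - 1) + [E u v] walks (t - 1) u. *)
Record cell := Cell { tg : nat; al : nat; ga : nat; jj : nat; ti : nat; vv : nat;
  uu : nat; ii : nat; kk : nat }.

Section Ladder.
Variables (T J : nat) (mj rj : nat -> nat) (E : nat -> nat -> bool) (v0 acc : nat).

(** Fields that a kind of cell does not use are forced to 0. An element of a fibre is then one cell
    only, which lets injectivity act on the fibres in [ladder_fixed]. *)
Definition valid_cell (m : nat) (c : cell) : bool :=
  (al c < 2) &&
  match tg c with
  | 0 => [&& ga c == 0, ti c == 0, vv c == 0, uu c == 0, ii c == 0 & kk c == 0]
  | 1 => [&& ga c < 2, ii c <= m & kk c == 0]
  | 2 => [&& ga c < 2, ii c <= m, kk c <= m & 0 < ti c]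
  | _ => false
  end.

(** Names are cells too. The label of a cell records all coordinates but [al], [ga], [ii] and [kk],
    so these four are all that an isomorphism can change. *)
Definition name_lab (c w : cell) : bool :=
  [&& tg w == tg c, al w == 0, ga w == 0, jj w == jj c, ti w == ti c, vv w == vv c,
      uu w == uu c, ii w == 0 & kk w == 0].

(** The tags 3 and 4 belong to no valid cell, hence these names differ from those of [name_lab]. *)
Definition flat_lab (t i : nat) (w : cell) : bool :=
  [&& tg w == t, al w == 0, ga w == 0, jj w == 0, ti w == 0, vv w == 0,
      uu w == 0, ii w == i & kk w == 0].

(* The variable [psum 0 v0 _] is left free: shifting it by 1 shifts the output by
   the number of walks. *)
Definition zero_cond (c : cell) : bool :=
  ((tg c == 1) && (ti c == 0) && (vv c != v0)) || ((tg c == 2) && (uu c == 0)).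

(* The last fibre is marked at element [s]; the output marks only admit a twist
   shifting the output by [r] <> 0. *)
Definition mark_cond (r s : nat) (c : cell) : bool :=
  ((tg c == 0) && (((jj c == 0) && (al c == 0)) || ((jj c == J.-1) && (al c == s)))) ||
  [&& tg c == 1, ti c == T.-1, vv c == acc, uu c == T.-1 &
      if al c == ga c then ii c == 0 else (ii c == r) && (0 < r)].

Definition cell_un (m r s : nat) (c w : cell) : bool :=
  valid_cell m c && [|| name_lab c w, zero_cond c && flat_lab 3 (ii c) w |
                        mark_cond r s c && flat_lab 4 0 w].

Definition rung (c d : cell) : bool :=
  [&& 0 < tg c, tg d == 0 &
     ((jj d == jj c) && (al d == al c)) || ((jj d == jj c + 1) && (al d == ga c))].

(** The three cases link a solution to its first summand, to its second summand and to its sum;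
    without an edge only solutions with second summand 0 have a sum. For [uu c = 0] there is no
    first summand, and [zero_cond] pins the value instead. *)
Definition add_link (m : nat) (e : bool) (c d : cell) : bool :=
  [|| [&& ti d == ti c, vv d == vv c, uu c == uu d + 1 & ii d == ii c],
      [&& e, ti c == ti d + 1, vv d == uu c, uu d == T.-1 & ii d == kk c] |
      [&& ti d == ti c, vv d == vv c, uu d == uu c, e || (kk c == 0) &
          (ii c + kk c == ii d) || (ii c + kk c == ii d + m + 1)]].

Definition cell_bin (m m' : nat) (e : bool) (c d : cell) : bool :=
  [&& valid_cell m c, valid_cell m' d &
   rung c d || [&& tg c == 2, tg d == 1, jj d == jj c, al d == al c, ga d == ga c &
                 add_link m e c d]].

Definition un_ (s : nat) (c w : cell) := cell_un (mj (jj c)) (rj (jj c)) s c w.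
Definition bin_ (c d : cell) := cell_bin (mj (jj c)) (mj (jj d)) (E (uu c) (vv c)) c d.

Variables (R R0 R1 : nat).
Definition in_range (c : cell) : bool :=
  [&& tg c < R0, al c < R1, ga c < R1, jj c < J, ti c < T & [&& vv c < T, uu c < T, ii c < R & kk c < R]].

Hypotheses (R05 : 4 < R0) (R12 : 1 < R1) (J2 : 1 < J) (T0 : 0 < T) (v0T : v0 < T) (accT : acc < T).
Hypothesis mjR : forall j, mj j < R.
Hypothesis jsurj : forall m r, m.+1 < R -> r <= m -> exists j, [/\ j.+1 < J, mj j = m & rj j = r].

Variable (U : finType) (co : U -> cell) (mk : cell -> U).
Hypothesis co_range : forall p, in_range (co p).
Hypothesis mkK : forall c, in_range c -> co (mk c) = c.
Hypothesis coK : forall p, mk (co p) = p.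

Let un s (p w : U) := un_ s (co p) (co w).
Let bin (p q : U) := bin_ (co p) (co q).

(** * Count zero: the ladder admits no isomorphism *)

Section Sound.
Hypothesis unreach : walks T E v0 T.-1 acc = 0.
Variable psi : U -> U.
Hypothesis psi_inj : injective psi.
Hypothesis psi_un : forall p w, un 0 p w -> un 1 (psi p) w.
Hypothesis psi_bin : forall p q, p != q -> bin p q -> bin (psi p) (psi q) || bin (psi q) (psi p).

Let phi c := co (psi (mk c)).

Lemma phi_un c w : in_range c -> in_range w -> un_ 0 c w -> un_ 1 (phi c) w.
Proof. by move=> hc hw h; have := @psi_un (mk c) (mk w); rewrite /un !mkK // => /(_ h). Qed.

Lemma phi_name c : in_range c -> valid_cell (mj (jj c)) c ->
  [/\ valid_cell (mj (jj (phi c))) (phi c), tg (phi c) = tg c, jj (phi c) = jj c &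
     [/\ ti (phi c) = ti c, vv (phi c) = vv c & uu (phi c) = uu c]].
Proof.
move=> hc hv; pose w := Cell (tg c) 0 0 (jj c) (ti c) (vv c) (uu c) 0 0.
have hw : in_range w.
  move: hc; rewrite /in_range /w /= => /and5P[-> _ _ -> /and5P[-> -> -> hi hk]] /=.
  by rewrite (ltnW R12) (leq_ltn_trans _ hi).
have := phi_un hc hw; rewrite /un_ /cell_un hv /= {1}/name_lab /= !eqxx /= => /(_ isT).
have ht : tg c < 3 by move: hv; rewrite /valid_cell; case: (tg c) => [|[|[|]]] //; rewrite andbF.
rewrite /flat_lab /= => /andP[-> /or3P[]].
- by rewrite /name_lab /= => /and5P[/eqP-> /eqP-> /eqP-> /eqP-> /andP[/eqP-> _]].
- by move=> /and3P[_ /eqP e _]; rewrite e in ht.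
- by move=> /and3P[_ /eqP e _]; rewrite e in ht.
Qed.

Lemma flat_range t i : t < 5 -> i < R -> in_range (Cell t 0 0 0 0 0 0 i 0).
Proof. by move=> h hi; rewrite /in_range /= (leq_trans h) // (ltnW R12) (ltnW J2) T0 hi (leq_ltn_trans _ hi). Qed.

Lemma phi_flat c t i : in_range c -> valid_cell (mj (jj c)) c -> 2 < t < 5 -> i < R ->
  [|| zero_cond c && flat_lab 3 (ii c) (Cell t 0 0 0 0 0 0 i 0) |
      mark_cond (rj (jj c)) 0 c && flat_lab 4 0 (Cell t 0 0 0 0 0 0 i 0)] ->
  [|| zero_cond (phi c) && flat_lab 3 (ii (phi c)) (Cell t 0 0 0 0 0 0 i 0) |
      mark_cond (rj (jj c)) 1 (phi c) && flat_lab 4 0 (Cell t 0 0 0 0 0 0 i 0)].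
Proof.
move=> hc hv /andP[t3 t5] hi h; have [hv' e1 e2 _] := phi_name hc hv.
have := phi_un hc (flat_range t5 hi); rewrite /un_ /cell_un hv h orbT => /(_ isT).
rewrite hv' e2 /= {1}/name_lab /= e1; suff -> : (t == tg c) = false by [].
by move: hv; rewrite /valid_cell; case: (tg c) t3 => [|[|[|n]]]; rewrite ?andbF //; case: t {t5 h} => [|[|[]]].
Qed.

Lemma phi_zero c : in_range c -> valid_cell (mj (jj c)) c -> zero_cond c -> ii (phi c) = ii c.
Proof.
move=> hc hv hz; have hi : ii c < R by case/and5P: hc => _ _ _ _ /and5P[_ _ _].
have := @phi_flat c 3 (ii c) hc hv isT hi.
by rewrite hz /flat_lab /= !eqxx !andbF !orbF !andbT => /(_ isT) /andP[_ /eqP].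
Qed.

Lemma phi_mark c : in_range c -> valid_cell (mj (jj c)) c ->
  mark_cond (rj (jj c)) 0 c -> mark_cond (rj (jj c)) 1 (phi c).
Proof.
move=> hc hv hm; have R0' : 0 < R by case/and5P: hc => _ _ _ _ /and5P[_ _ _ _]; apply: leq_ltn_trans.
have := @phi_flat c 4 0 hc hv isT R0'.
by rewrite hm /flat_lab /= !andbF !andbT => /(_ isT).
Qed.

(** Links lead from a larger tag to a smaller one and [phi] keeps tags, so the reversed alternative
    cannot occur. *)
Lemma phi_bin c d : in_range c -> in_range d -> bin_ c d -> bin_ (phi c) (phi d).
Proof.
move=> hc hd h; have := h; rewrite /bin_ /cell_bin => /and3P[hvc hvd H].
have htg : tg d < tg c.
  by case/orP: H => [/and3P[h1 /eqP -> _]|/and5P[/eqP -> /eqP -> _]].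
have ne : mk c != mk d.
  apply: contraTneq htg => e; suff -> : c = d by rewrite ltnn.
  by rewrite -(mkK hc) e mkK.
have := psi_bin ne; rewrite /bin !mkK // => /(_ h) /orP[] //.
have [_ ec _ _] := phi_name hc hvc; have [_ ed _ _] := phi_name hd hvd.
rewrite /bin_ /cell_bin -/(phi c) -/(phi d) ec ed => /and3P[_ _].
rewrite /rung ed ec; case/orP => [/and3P[_ /eqP e _]|/and5P[/eqP e /eqP e' _ _ _]].
  by rewrite e in htg.
by rewrite e e' in htg.
Qed.

Let P j a := Cell 0 a 0 j 0 0 0 0 0.

Lemma P_range j a : j < J -> a < 2 -> in_range (P j a).
Proof.
move=> hj ha; rewrite /in_range /= hj T0 (leq_trans ha R12) (ltnW R12) (leq_ltn_trans _ R05) //.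
by rewrite (leq_ltn_trans _ (mjR 0)).
Qed.

Lemma P_valid m j a : a < 2 -> valid_cell m (P j a). Proof. by move=> h; rewrite /valid_cell /= h. Qed.

(** The rung links tie [al], and likewise [ga], of a cell to elements of the two neighbouring
    fibres, so cells move consistently with the fibres. *)
Lemma phi_al c : in_range c -> valid_cell (mj (jj c)) c -> 0 < tg c ->
  al (phi c) = al (phi (P (jj c) (al c))).
Proof.
move=> hc hv ht; have ha : al c < 2 by case/andP: hv.
have hP : in_range (P (jj c) (al c)) by apply: P_range => //; case/and5P: hc.
have hb : bin_ c (P (jj c) (al c)).
  by rewrite /bin_ /cell_bin hv P_valid //= /rung ht /= !eqxx.
have := phi_bin hc hP hb; have [_ ec jc _] := phi_name hc hv.
have [_ eP jP _] := phi_name hP (P_valid _ _ ha).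
rewrite /bin_ /cell_bin /rung ec eP jc jP /= => /and3P[_ _].
rewrite andbF orbF eqxx => /andP[_ /orP[/eqP -> //|/andP[/eqP]]]; lia.
Qed.

Lemma phi_ga c : in_range c -> valid_cell (mj (jj c)) c -> 0 < tg c -> (jj c).+1 < J ->
  ga (phi c) = al (phi (P (jj c).+1 (ga c))).
Proof.
move=> hc hv ht hj; have ha : ga c < 2.
  by move: hv; rewrite /valid_cell; case: (tg c) ht => [|[|[|n]]] //= _ /andP[_] => [/andP[]|/andP[]|].
have hP : in_range (P (jj c).+1 (ga c)) by apply: P_range.
have hb : bin_ c (P (jj c).+1 (ga c)).
  by rewrite /bin_ /cell_bin hv P_valid //= /rung ht /= addn1 !eqxx orbT.
have := phi_bin hc hP hb; have [_ ec jc _] := phi_name hc hv.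
have [_ eP jP _] := phi_name hP (P_valid _ _ ha).
rewrite /bin_ /cell_bin /rung ec eP jc jP /= => /and3P[_ _].
rewrite andbF orbF => /andP[_ /orP[/andP[/eqP]|/andP[_ /eqP -> //]]]; lia.
Qed.

Lemma Q_range j a g t v u i : j < J -> a < 2 -> g < 2 -> t < T -> v < T -> u < T -> i <= mj j ->
  in_range (Cell 1 a g j t v u i 0).
Proof.
move=> hj ha hg ht hv hu hi; rewrite /in_range /= hj ht hv hu !(leq_trans _ R12) //.
by rewrite (leq_ltn_trans _ R05) // (leq_ltn_trans hi) // (leq_ltn_trans _ (mjR 0)).
Qed.

Lemma G_range j a g t v u i : j < J -> a < 2 -> g < 2 -> t < T -> v < T -> u < T -> i <= mj j ->
  in_range (Cell 2 a g j t v u i 0).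
Proof.
move=> hj ha hg ht hv hu hi; rewrite /in_range /= hj ht hv hu !(leq_trans _ R12) //.
by rewrite (leq_ltn_trans _ R05) // (leq_ltn_trans hi) // (leq_ltn_trans _ (mjR 0)).
Qed.

(** Follows one link of an equation cell through [phi]. Solutions [(i, 0)] suffice: they connect the
    value [i] of one partial sum with the value [i] of the next. *)
Lemma link_phi j a g t v u i c : j < J -> a < 2 -> g < 2 -> t < T -> v < T -> u < T -> i <= mj j ->
  0 < t -> in_range c -> valid_cell (mj (jj c)) c -> tg c = 1 -> jj c = j -> al c = a -> ga c = g ->
  add_link (mj j) (E u v) (Cell 2 a g j t v u i 0) c ->
  let G := phi (Cell 2 a g j t v u i 0) in let d := phi c in
  [/\ ii G <= mj j, ii d <= mj j, ti d = ti c, vv d = vv c & uu d = uu c] /\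
  add_link (mj j) (E u v) (Cell 2 a g j t v u (ii G) (kk G)) d.
Proof.
move=> hj ha hg ht hv hu hi t0 hc hvc e1 e2 e3 e4 hl G d.
have hG := G_range hj ha hg ht hv hu hi.
have hvG : valid_cell (mj j) (Cell 2 a g j t v u i 0) by rewrite /valid_cell /= ha hg hi t0.
have hb : bin_ (Cell 2 a g j t v u i 0) c.
  by rewrite /bin_ /cell_bin hvG hvc /= e1 e2 e3 e4 !eqxx /= hl orbT.
have [vG tG jG [tiG vvG uuG]] := phi_name hG hvG.
have [vd td jd [tid vvd uud]] := phi_name hc hvc.
have := phi_bin hG hc hb; rewrite /bin_ /cell_bin -/G -/d => /and3P[_ _].
rewrite /rung td e1 andbF /= uuG vvG jG /= => /and5P[_ _ _ _ hl'].
move: vG vd; rewrite /valid_cell -/G -/d tG td e1 jd jG e2 /= => /and5P[_ _ -> _ _] /and4P[_ _ -> _].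
by split=> //; move: hl'; rewrite /add_link /= tiG vvG uuG.
Qed.

(** A vanishing sum has vanishing summands. Going up in [t] and [u], the solution [(i, 0)] has its
    first summand fixed by induction or, for [u = 0], by its label, and its second one by induction
    on [t] or by the missing edge; then its sum is fixed as well. *)
Lemma unreach_fixed j a g t v u i : j < J -> a < 2 -> g < 2 -> t < T -> v < T -> u < T -> i <= mj j ->
  psum T E v0 t v u = 0 -> ii (phi (Cell 1 a g j t v u i 0)) = i.
Proof.
move=> hj ha hg; elim: t v u i => [|t IHt] v u i ht hv hu hi.
  rewrite /psum => h; apply: (@phi_zero (Cell 1 a g j 0 v u i 0)).
  - exact: Q_range.
  - by rewrite /valid_cell /= ha hg hi.
  by rewrite /zero_cond /=; case: eqP h.
have lastT : T.-1 < T by rewrite prednK.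
have step u' : u' < T -> (E u' v -> walks T E v0 t u' = 0) ->
    (u' = 0 \/ exists2 u1, u' = u1.+1 & ii (phi (Cell 1 a g j t.+1 v u1 i 0)) = i) ->
    ii (phi (Cell 1 a g j t.+1 v u' i 0)) = i.
  move=> hu' hw ha'.
  have L := link_phi hj ha hg ht hv hu' hi (ltn0Sn t).
  have hcell t' v' u1 : t' < T -> v' < T -> u1 < T -> in_range (Cell 1 a g j t' v' u1 i 0).
    by move=> *; apply: Q_range.
  have hval t' v' u1 : valid_cell (mj j) (Cell 1 a g j t' v' u1 i 0).
    by rewrite /valid_cell /= ha hg hi.
  have hself : add_link (mj j) (E u' v) (Cell 2 a g j t.+1 v u' i 0) (Cell 1 a g j t.+1 v u' i 0).
    by rewrite /add_link /= !eqxx addn0 eqxx !orbT.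
  set G := phi (Cell 2 a g j t.+1 v u' i 0) in L.
  have iG : ii G = i.
    case: ha' => [e|[u1 e fx]].
      apply: (@phi_zero (Cell 2 a g j t.+1 v u' i 0)).
      - exact: G_range.
      - by rewrite /valid_cell /= ha hg hi.
      by rewrite /zero_cond /= e.
    have hu1 : u1 < T by rewrite -ltnS -e ltnW.
    have hl : add_link (mj j) (E u' v) (Cell 2 a g j t.+1 v u' i 0) (Cell 1 a g j t.+1 v u1 i 0).
      by rewrite /add_link /= !eqxx e addn1 eqxx.
    have [[_ _ e1 e2 e3]] := L _ (hcell t.+1 v u1 ht hv hu1) (hval _ _ _) erefl erefl erefl erefl hl.
    rewrite /add_link /= e1 e2 e3 fx e /=; case/or3P.
    - by case/and4P => _ _ _ /eqP.
    - by case/and5P => _ /eqP hh _ _ _; move: hh; clear; lia.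
    by case/and5P => _ _ /eqP hh _ _; move: hh; clear; lia.
  have kG : kk G = 0.
    case hE: (E u' v).
      have hi0 : 0 <= mj j by [].
      have t'T : t < T by apply: ltnW.
      have hl : add_link (mj j) (E u' v) (Cell 2 a g j t.+1 v u' i 0) (Cell 1 a g j t u' T.-1 0 0).
        by rewrite /add_link /= hE !addn1 !eqxx /= orbT.
      have hv0 : valid_cell (mj j) (Cell 1 a g j t u' T.-1 0 0) by rewrite /valid_cell /= ha hg.
      have [[_ _ e1 e2 e3]] := L _ (Q_range hj ha hg t'T hu' lastT hi0) hv0 erefl erefl erefl erefl hl.
      rewrite /add_link /= e1 e2 e3 (IHt u' T.-1 0) ?psum_last ?hw //=; case/or3P.
      - by case/and4P => /eqP hh _ _ _; move: hh; clear; lia.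
      - by case/and5P => _ _ _ _ /eqP.
      by case/and5P => /eqP hh _ _ _ _; move: hh; clear; lia.
    have [[_ _ e1 e2 e3]] := L _ (hcell t.+1 v u' ht hv hu') (hval _ _ _) erefl erefl erefl erefl hself.
    rewrite /add_link hE /= e1 e2 e3 /=; case/orP.
      by case/and4P => _ _ /eqP hh _; move: hh; clear; lia.
    by case/and5P => _ _ _ /eqP.
  have [[_ hd e1 e2 e3]] := L _ (hcell t.+1 v u' ht hv hu') (hval _ _ _) erefl erefl erefl erefl hself.
  rewrite /add_link /= e1 e2 e3 iG kG addn0 /=; case/or3P.
  - by case/and4P => _ _ /eqP hh _; move: hh; clear; lia.
  - by case/and5P => _ /eqP hh _ _ _; move: hh; clear; lia.
  (* Both values are at most [mj j], so the wrapped sum cannot occur. *)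
  by case/and5P => _ _ _ _ /orP[] /eqP hh; move: hh hd hi; clear; lia.
elim: u hu => [|u IHu] hu h; apply: step => //.
- by move=> hE; move: h; rewrite psum0 hE.
- by left.
- by move=> hE; move: h; rewrite psumS hE => /eqP; rewrite addn_eq0 => /andP[_ /eqP].
right; exists u => //; apply: IHu; first exact: ltnW.
by move: h; rewrite psumS => /eqP; rewrite addn_eq0 => /andP[/eqP].
Qed.

(** Rung by rung: the mark fixes the first fibre. Over the next rung the output cell of value 0
    between the elements 0 is marked and, by [unreach_fixed], keeps its value; were the upper fibre
    swapped, the image would carry a mark only at the value [r > 0]. *)
Lemma ladder_fixed j a : j < J -> a < 2 -> al (phi (P j a)) = a.
Proof.
have al2 j' a' : j' < J -> a' < 2 -> al (phi (P j' a')) < 2.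
  move=> hj ha; have [] := phi_name (P_range hj ha) (P_valid _ _ ha).
  by rewrite /valid_cell => /andP[].
(* Fixing element 0 fixes element 1, since their images are distinct cells of the same fibre. *)
have both j' : j' < J -> al (phi (P j' 0)) = 0 -> forall a', a' < 2 -> al (phi (P j' a')) = a'.
  move=> hj h0 [|[|//]] // _; have := al2 j' 1 hj isT.
  case e: (al (phi (P j' 1))) => [|[|//]] // _.
  have flat c : in_range c -> valid_cell (mj (jj c)) c -> tg c = 0 -> phi c = P (jj c) (al (phi c)).
    move=> hc hv ht; have [hv' e1 e2 [e3 e4 e5]] := phi_name hc hv.
    move: hv' e1 e2 e3 e4 e5; rewrite /valid_cell ht; case: (phi c) => tg0 al0 ga0 j0 t0 v0' u0 i0 k0 /=.
    move=> + E1; rewrite E1 => /and5P[_ /eqP-> /eqP-> /eqP-> /and3P[/eqP-> /eqP-> /eqP->]].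
    by move=> ->.
  have := flat _ (P_range hj (isT : 1 < 2)) (P_valid _ _ (isT : 1 < 2)) erefl.
  have := flat _ (P_range hj (isT : 0 < 2)) (P_valid _ _ (isT : 0 < 2)) erefl.
  rewrite e h0 /= => <- E'; move: (congr1 mk E'); rewrite /phi !coK => /psi_inj.
  by move/(congr1 co); rewrite !mkK // ?P_range.
elim: j a => [|j IH] a hj ha.
  apply: both => //; have := phi_mark (P_range hj (isT : 0 < 2)) (P_valid _ _ (isT : 0 < 2)).
  have [_ e1 e2 _] := phi_name (P_range hj (isT : 0 < 2)) (P_valid _ _ (isT : 0 < 2)).
  rewrite /mark_cond /= e1 e2 /= => /(_ isT); rewrite orbF => /orP[/eqP //|/andP[/eqP]]; lia.
apply: both => //; have lastT : T.-1 < T by rewrite prednK.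
have hj' := ltnW hj.
have hr : in_range (Cell 1 0 0 j T.-1 acc T.-1 0 0) by apply: Q_range.
have hv : valid_cell (mj j) (Cell 1 0 0 j T.-1 acc T.-1 0 0) by [].
have [_ e1 e2 [e3 e4 e5]] := phi_name hr hv.
have eal := phi_al hr hv isT; have ega := phi_ga hr hv isT hj.
rewrite /= (IH 0 hj' isT) in eal; rewrite /= in ega.
have fx := @unreach_fixed j 0 0 T.-1 acc T.-1 0 hj' isT isT lastT accT lastT isT.
rewrite psum_last // in fx; have {}fx := fx unreach.
have := phi_mark hr hv; rewrite /mark_cond /= !eqxx /= => /(_ isT).
rewrite e1 e2 e3 e4 e5 /= !eqxx /= eal fx -ega.
by case: eqP => [<-//|_ /andP[/eqP <-]].
Qed.

(** The two versions mark different elements of the last fibre, which is fixed. *)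
Lemma ladder_sound : False.
Proof.
have hj : J.-1 < J by rewrite prednK // ltnW.
have hr := P_range hj (isT : 0 < 2).
have hv : valid_cell (mj J.-1) (P J.-1 0) by exact: P_valid.
have hm : mark_cond (rj J.-1) 0 (P J.-1 0) by rewrite /mark_cond /= !eqxx orbT.
have [_ e1 e2 _] := phi_name hr hv.
have := phi_mark hr hv hm; rewrite /mark_cond e1 e2 (ladder_fixed hj) //= !andbT andbF !orbF => /eqP; lia.
Qed.

End Sound.

(** * Count positive: an explicit swap *)

Section Complete.
Hypothesis reach : 0 < walks T E v0 T.-1 acc.
Hypothesis R_big : T ^ T < 2 ^ R.-2.

(** Otherwise the count is divisible by every positive [d < R], hence at least [2^(R-2)], beyond the
    bound on the number of walks. The rung must not be the last one, as the swap starts above it. *)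
Lemma good_rung : exists j0, [/\ j0.+1 < J, 0 < rj j0, rj j0 <= mj j0 &
  rj j0 = walks T E v0 T.-1 acc %% (mj j0).+1].
Proof.
pose c := walks T E v0 T.-1 acc; have c0 : 0 < c by [].
rewrite -/c.
have hc : c < 2 ^ R.-2.
  apply: leq_ltn_trans R_big; apply: leq_trans (walks_bound T E v0 T.-1 acc) _.
  by rewrite leq_pexp2l // leq_pred.
have [/existsP[d hd]|/existsPn hd] := boolP [exists d : 'I_R, (0 < val d) && ~~ (val d %| c)].
  case/andP: hd => d0 hd; have hm : c %% val d <= (val d).-1.
    by have := ltn_pmod c d0; rewrite -{2}(prednK d0) ltnS.
  have [|//|j [h1 h2 h3]] := @jsurj (val d).-1 (c %% (val d)).
    by rewrite (prednK d0); exact: ltn_ord.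
  exists j; rewrite h2 h3 prednK //; split=> //.
  by rewrite lt0n; move: hd; rewrite /dvdn.
suff : 2 ^ R.-2 <= c by rewrite leqNgt hc.
apply: common_multiple_ge => // d /andP[d0 dR].
have dR' : d < R.
  by case: (R) dR {hc hd} R_big => [|[|r]] //= h; rewrite expn0 ltnS leqn0 expn_eq0; case: (T) T0.
by have := hd (Ordinal dR'); rewrite /= d0 /= negbK.
Qed.

(* Swapping the fibres above rung [j0] is an isomorphism, once the values over
   [j0] are shifted by a solution of the equations. *)
Section Involution.
Variable j0 : nat.
Hypotheses (j0J : j0.+1 < J) (r0 : 0 < rj j0) (rm : rj j0 <= mj j0).
Hypothesis rE : rj j0 = walks T E v0 T.-1 acc %% (mj j0).+1.
Let M := (mj j0).+1.

(** The direction [b] is opposite for straight and crossed cells, which makes the swap an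
    involution. Subtraction is done by adding the complement to [M], so nothing is truncated. *)
Definition shift (b : bool) (z i : nat) : nat :=
  (i + if b then z %% M else M - z %% M) %% M.

Lemma shiftK b z i : i < M -> shift (~~ b) z (shift b z i) = i.
Proof.
move=> hi; rewrite /shift modnDml -addnA.
have hz : z %% M <= M by rewrite ltnW // ltn_pmod.
by case: b => /=; rewrite ?subnKC ?subnK // modnDr modn_small.
Qed.

Lemma shift0 b i : i < M -> shift b 0 i = i.
Proof. by move=> hi; rewrite /shift mod0n; case: b; rewrite ?addn0 ?subn0 ?modnDr modn_small. Qed.

Lemma shift_lt b z i : shift b z i < M. Proof. exact: ltn_pmod. Qed.

Lemma shiftD b z z' i k : shift b (z + z') ((i + k) %% M) = (shift b z i + shift b z' k) %% M.
Proof.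
rewrite /shift modnDml modnDm; case: b.
  by rewrite modnDmr [in RHS]addnACA -[RHS]modnDmr modnDm modnDmr.
have hz x : x %% M + (M - x %% M) = M by rewrite subnKC // ltnW // ltn_pmod.
apply/eqP; rewrite -(eqn_modDr ((z + z') %% M)) -addnA [_ - _ + _]addnC hz -modnDm modnn addn0 modn_mod.
rewrite -(modnDm z z') modnDmr.
have -> : i + (M - z %% M) + (k + (M - z' %% M)) + (z %% M + z' %% M) =
  i + k + (z %% M + (M - z %% M)) + (z' %% M + (M - z' %% M)) by lia.
by rewrite !hz !modnDr.
Qed.

(** The solution with value 1 at the source consists of the walk counts themselves; [zi] and [zk]
    are its entries for the fields [ii] and [kk]. *)
Definition zi (c : cell) : nat :=
  if tg c == 1 then psum T E v0 (ti c) (vv c) (uu c)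
  else if uu c == 0 then 0 else psum T E v0 (ti c) (vv c) (uu c).-1.

Definition zk (c : cell) : nat :=
  if (tg c == 2) && E (uu c) (vv c) then walks T E v0 (ti c).-1 (uu c) else 0.

(** Over [j0] only [ga] and the values change. A cell with [al = ga] becomes crossed and its values
    move forward, those of a crossed cell move back; at the output this exchanges the marked values
    0 and [r]. *)
Definition flip_cell (c : cell) : cell :=
  if ~~ valid_cell (mj (jj c)) c then c else
  let: Cell t a g j x v u i k := c in
  if t == 0 then Cell t (if j0 < j then 1 - a else a) g j x v u i k
  else if j < j0 then c
  else if j0 < j then Cell t (1 - a) (1 - g) j x v u i k
  else Cell t a (1 - g) j x v u (shift (a == g) (zi c) i) (shift (a == g) (zk c) k).

Lemma flip_jj c : jj (flip_cell c) = jj c.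
Proof.
rewrite /flip_cell; case: ifP => // _; case: c => t a g j x v u i k.
by do 3![case: ifP => //].
Qed.

Lemma flip_valid c : valid_cell (mj (jj c)) c -> valid_cell (mj (jj c)) (flip_cell c).
Proof.
rewrite /flip_cell => h; rewrite h /=; case: c h => t a g j x v u i k /=.
rewrite /valid_cell /=; case: (t =P 0) => [->|nt] /=.
  by case/andP=> ha ->; case: ifP => _; rewrite ?ha ?andbT //; lia.
case: (ltngtP j j0) => [//|lj|ej] /=.
  have q y : 1 - y < 2 by rewrite ltnS leq_subr.
  by rewrite !q; case: t nt => [|[|[|t]]] //= _ /andP[_] => [/andP[_ ->]|/andP[_ ->]|].
rewrite ej => /andP[ha]; have q y : 1 - y < 2 by rewrite ltnS leq_subr.
have sl b z y : shift b z y <= mj j0 by rewrite -ltnS shift_lt.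
case: t nt => [|[|[|t]]] //= _ => [/and3P[hg hi /eqP ->]|/and4P[hg hi hk hx]].
  by rewrite sl /zk /= shift0 // ha q.
by rewrite !sl ha hx q.
Qed.

Lemma eq_flip a g : a < 2 -> g < 2 -> (a == 1 - g) = ~~ (a == g).
Proof. by case: a g => [|[|//]] [|[|//]]. Qed.

Lemma flipK c : flip_cell (flip_cell c) = c.
Proof.
rewrite {1}/flip_cell flip_jj; case hv: (valid_cell (mj (jj c)) c); last first.
  by rewrite /flip_cell hv /= hv.
rewrite (flip_valid hv) /= /flip_cell hv /=.
case: c hv => t a g j x v u i k /=; rewrite /valid_cell /= => /andP[ha].
case: (t =P 0) => [->|nt] /=.
  by case: ifP => h _; rewrite ?h // subKn // -ltnS.
case: (ltngtP j j0) => [lj _|lj h|ej h] /=.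
- by rewrite (negPf (introN eqP nt)) lj.
- have hg : g < 2 by case: t nt h => [|[|[|t]]] //= _ => [/andP[]|/andP[]].
  by rewrite (negPf (introN eqP nt)) ltnNge (ltnW lj) /= lj !subKn // -ltnS.
rewrite (negPf (introN eqP nt)) ej ltnn.
have hg : g < 2 by case: t nt h => [|[|[|t]]] //= _ => [/andP[]|/andP[]].
have sk : 1 - (1 - g) = g by rewrite subKn // -ltnS.
rewrite eq_flip // /zi /zk /= sk.
have [hi hk] : i < M /\ k < M.
  case: t nt h => [|[|[|t]]] //= _ => [/and3P[_ hi /eqP ->]|/and4P[_ hi hk _]];
    by rewrite /M -ej !ltnS.
by rewrite !shiftK.
Qed.

Lemma flip_range c : in_range c -> in_range (flip_cell c).
Proof.
rewrite /flip_cell; case: ifP => // _; case: c => t a g j x v u i k; rewrite /in_range /=.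
have h1 y : y < R1 -> 1 - y < R1 by move=> _; rewrite (leq_ltn_trans (leq_subr _ _)).
have sR b z y : shift b z y < R by exact: leq_trans (shift_lt _ _ _) (mjR _).
case/and5P=> h0 ha hg hj /and5P[hx hv hu hi hk].
by repeat (case: ifP => _ /=); rewrite h0 hj hx hv hu ?h1 ?sR ?ha ?hg ?hi ?hk.
Qed.

Lemma flip_coords c : let d := flip_cell c in
  [/\ tg d = tg c, ti d = ti c, vv d = vv c & uu d = uu c].
Proof.
rewrite /= /flip_cell; case: ifP => // _; case: c => t a g j x v u i k.
by do 3![case: ifP => //].
Qed.

(** Stated for both values of [s], so that the involution yields the converse. *)
Lemma flip_un s c w : s < 2 -> un_ s c w -> un_ (1 - s) (flip_cell c) w.
Proof.
move=> hs; rewrite /un_ /cell_un flip_jj => /andP[hv]; rewrite flip_valid //=.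
have [e1 e2 e3 e4] := flip_coords c.
have -> : name_lab (flip_cell c) w = name_lab c w by rewrite /name_lab flip_jj e1 e2 e3 e4.
case/or3P => [->//|/andP[hz hl]|/andP[hm ->]]; apply/orP; right; apply/orP.
  left; rewrite /zero_cond e1 e2 e3 e4 -/(zero_cond c) hz /=.
  suff -> : ii (flip_cell c) = ii c by [].
  rewrite /flip_cell hv /=; case: c hv hz {hl e1 e2 e3 e4} => t a g j x v u i k /=.
  rewrite /valid_cell /zero_cond /zi /= => /andP[ha hv hz].
  do 3![case: ifP => // ?].
  have hj : j = j0 by lia.
  case/orP: hz => [/andP[/andP[/eqP et /eqP ex] nv]|/andP[/eqP et /eqP eu]];
    rewrite et ?ex ?eu /= in hv *; rewrite ?(negPf nv).
    by rewrite shift0 //; case/and3P: hv; rewrite hj.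
  by rewrite shift0 //; case/and4P: hv; rewrite hj.
right; rewrite andbT; move: hm; rewrite /mark_cond e1 e2 e3 e4 flip_jj /flip_cell hv /=.
case: c hv {e1 e2 e3 e4} => t a g j x v u i k /=; rewrite /valid_cell /= => /andP[ha].
case: (t =P 0) => [-> /=|nt] /=.
  rewrite !orbF => _ /orP[/andP[/eqP -> /eqP ->]|/andP[/eqP -> /eqP ->]] //.
  have -> : j0 < J.-1 by lia.
  by rewrite !eqxx orbT.
move=> hv /and5P[/eqP et /eqP -> /eqP -> /eqP ->]; rewrite !eqxx et /=; move: hv; rewrite et /= => /and3P[hg hi _].
case: (ltngtP j j0) => [//|lj|ej] /=.
  suff -> : (1 - a == 1 - g) = (a == g) by [].
  by case: (a) (g) ha hg => [|[|//]] [|[|//]].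
rewrite eq_flip // /zi /= ej psum_last //; case: (a == g) => /=.
  by move/eqP ->; rewrite r0 andbT /shift add0n modn_mod rE.
by case/andP => /eqP -> _; rewrite /shift -rE subnKC ?modnn // ltnW // ltnS.
Qed.

Lemma flip_bin c d : bin_ c d -> bin_ (flip_cell c) (flip_cell d).
Proof.
rewrite /bin_ /cell_bin !flip_jj => /and3P[hvc hvd H]; rewrite !flip_valid //=.
have [_ _ -> ->] := flip_coords c.
case/orP: H => [H|/and5P[tc td ej ea /andP[eg hl]]]; apply/orP; [left|right].
  move: H; rewrite /rung !flip_jj; have [-> _ _ _] := flip_coords c; have [-> _ _ _] := flip_coords d.
  case/and3P=> tc td H; rewrite tc td /=.
  rewrite /flip_cell hvc hvd /=.
  case: c d hvc hvd tc td H => t a g j x v u i k [t' a' g' j' x' v' u' i' k'] /=.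
  move=> hvc _ t0 /eqP -> /=; rewrite eqn0Ngt t0 /=.
  by case/orP => /andP[/eqP -> /eqP ->]; case: (ltngtP j j0) => hj //=; rewrite ?eqxx ?orbT //;
    case: ltngtP => //=; rewrite ?eqxx ?orbT //; lia.
have [-> _ _ _] := flip_coords c; have [-> _ _ _] := flip_coords d.
rewrite tc td ej /= /flip_cell hvc hvd /=.
case: c d hvc hvd tc td ej ea eg hl => t a g j x v u i k [t' a' g' j' x' v' u' i' k'] /=.
move=> hvc hvd /eqP et /eqP et' /eqP ej /eqP ea /eqP eg; subst t t' j' a' g' => /=.
case: (ltngtP j j0) => /= [_|_|ej]; rewrite ?eqxx //=.
move: hvc hvd; rewrite /valid_cell /= ej => /andP[ha /and4P[hg hi hk hx]] /andP[_ /and3P[_ hi' /eqP ->]].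
rewrite /add_link /zi /zk /= => /or3P[].
- case/and4P=> /eqP -> /eqP -> /eqP -> /eqP ->.
  by rewrite !eqxx addn1 /= eqxx.
- case/and5P=> hE /eqP -> /eqP -> /eqP -> /eqP ->.
  by rewrite hE psum_last // addn1 /= !eqxx orbT.
case/and5P=> /eqP -> /eqP -> /eqP -> he hl; rewrite !eqxx /=; apply/orP; right; apply/orP; right.
(* The counts themselves solve the equation of the cell; the first summand is absent for [u = 0]. *)
have zE : psum T E v0 x v u = (if u == 0 then 0 else psum T E v0 x v u.-1) +
    (if E u v then walks T E v0 x.-1 u else 0).
  case: (x) hx => // x0 _; case: (u) => [|u0]; first by rewrite psum0 /= add0n.
  by rewrite psumS.
have he' : E u v || (shift (a == g) (if E u v then walks T E v0 x.-1 u else 0) k == 0).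
  case: (E u v) he => //= /eqP ->; rewrite shift0 //.
rewrite he' /=; set X := shift _ _ i; set Z := shift _ _ k; set W := shift _ _ i'.
have eW : W = (X + Z) %% M.
  rewrite /W /X /Z -shiftD zE; congr shift.
  case/orP: hl => /eqP ->; first by rewrite modn_small // ltnS.
  by rewrite -addnA addn1 modnDr modn_small // ltnS.
have hX : X < M by exact: shift_lt.
have hZ : Z < M by exact: shift_lt.
case: (ltnP (X + Z) M) => h; first by rewrite eW modn_small // eqxx.
have -> : W = X + Z - M.
  by rewrite eW -{1}(subnK h) modnDr modn_small // /M; lia.
apply/orP; right; apply/eqP; rewrite /M in h *; lia.
Qed.

End Involution.

Lemma ladder_complete : exists psi : U -> U, [/\ bijective psi,
  forall p w, un 1 (psi p) w = un 0 p w & forall p q, bin (psi p) (psi q) = bin p q].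
Proof.
have [j0 [j0J r0 rm rE]] := good_rung.
pose psi p := mk (flip_cell j0 (co p)).
have cpsi p : co (psi p) = flip_cell j0 (co p) by rewrite mkK // flip_range.
have psiK : involutive psi.
  by move=> p; rewrite /psi -/(psi p) cpsi flipK // coK.
exists psi; split; first exact: inv_bij.
  move=> p w; apply/idP/idP; rewrite /un cpsi.
    by move/(@flip_un _ j0J r0 rm rE 1 _ _ isT); rewrite flipK.
  exact: (@flip_un _ j0J r0 rm rE 0 _ _ isT).
move=> p q; apply/idP/idP; rewrite /bin !cpsi.
  by move/(flip_bin j0J r0 rm rE); rewrite !flipK.
exact: flip_bin.
Qed.

End Complete.
End Ladder.

(** * Configurations of a nondeterministic machine *)

Section WalksConnect.
Variables (T : nat) (E : nat -> nat -> bool) (v0 : 'I_T).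
Hypothesis Erefl : forall u, E u u.
Let e : rel 'I_T := fun u v => E u v.

Lemma walks_gt0 t v : 0 < walks T E v0 t.+1 v <-> exists2 u, u < T & E u v && (0 < walks T E v0 t u).
Proof.
rewrite lt0n /= big_mkord sum_nat_eq0 negb_forall; split.
  by case/existsP=> u; rewrite negb_imply -lt0n => h; exists u.
by case=> u hu h; apply/existsP; exists (Ordinal hu); rewrite negb_imply -lt0n.
Qed.

Lemma walks_connect t (v : 'I_T) : 0 < walks T E v0 t v -> connect e v0 v.
Proof.
elim: t v => [|t IH] v; first by rewrite /= lt0b => /eqP /val_inj ->.
case/walks_gt0=> u hu /andP[h1 h2].
by apply: connect_trans (IH (Ordinal hu) h2) _; apply: connect1.
Qed.

Lemma walks_path q : path e v0 q -> 0 < walks T E v0 (size q) (last v0 q).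
Proof.
elim/last_ind: q => [|q x IH]; first by rewrite /= eqxx.
rewrite rcons_path last_rcons size_rcons => /andP[hq hx]; apply/walks_gt0.
by exists (last v0 q) => //; rewrite (IH hq) andbT.
Qed.

Lemma walks_pad t k v : v < T -> 0 < walks T E v0 t v -> 0 < walks T E v0 (t + k) v.
Proof.
move=> hv h; elim: k => [|k IH]; first by rewrite addn0.
by rewrite addnS; apply/walks_gt0; exists v => //; rewrite Erefl.
Qed.

Lemma connect_walks (v : 'I_T) : connect e v0 v -> 0 < walks T E v0 T.-1 v.
Proof.
case/connectP=> p hp ->; case/shortenP: hp => q hq uq _.
have hs : size q <= T.-1.
  have := max_card (mem (v0 :: q)); rewrite (card_uniqP uq) card_ord /=.
  by have T0 := leq_ltn_trans (leq0n _) (ltn_ord v0); rewrite -[in X in _ -> X]ltnS prednK.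
by rewrite -(subnKC hs); apply: walks_pad => //; apply: walks_path.
Qed.

End WalksConnect.

Section Simulation.
Variables (M : ntm).

Let b := #|nsym M|.+1.
(** The blank is digit 0: unvisited cells then add nothing to the code, and [code_split] holds for
    the empty list too. *)
Definition sym_rank (s : nsym M) : nat := if s == nblank M then 0 else (enum_rank s).+1.

Lemma sym_rank_lt s : sym_rank s < b.
Proof. by rewrite /sym_rank; case: eqP => // _; rewrite ltnS. Qed.

Lemma sym_rank_inj : injective sym_rank.
Proof.
move=> s t; rewrite /sym_rank; case: eqP => [->|_]; case: eqP => [->|_] //.
by case=> /val_inj /enum_rank_inj.
Qed.

Definition code (l : seq (nsym M)) : nat := foldr (fun s a => sym_rank s + b * a) 0 l.

Lemma code_split l : code l = sym_rank (head (nblank M) l) + b * code (behead l).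
Proof. by case: l => //=; rewrite /sym_rank eqxx muln0. Qed.

Lemma code_lt l : code l < b ^ size l.
Proof.
elim: l => //= s l IH; have := sym_rank_lt s; rewrite expnS.
by move: (sym_rank s) IH; move: (code l) (b ^ size l) => x y r; nia.
Qed.

Lemma code_inj_split x y (s t : nsym M) : sym_rank s + b * x = sym_rank t + b * y -> s = t /\ x = y.
Proof.
move=> e; have hs := sym_rank_lt s; have ht := sym_rank_lt t.
have e1 := congr1 (modn^~ b) e; rewrite !(addnC (sym_rank _)) ![b * _]mulnC !modnMDl !modn_small // in e1.
have es := sym_rank_inj e1; split=> //; move: e; rewrite es => /eqP.
by rewrite eqn_add2l eqn_pmul2l // => /eqP.
Qed.

(** Starting at 1 keeps 0 for the accepting sink. *)
Definition state_rank (q : nstate M) (s : nsym M) : nat := (enum_rank (q, s)).+1.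

Lemma state_rank_inj q s q' s' : state_rank q s = state_rank q' s' -> q = q' /\ s = s'.
Proof. by case=> /val_inj /enum_rank_inj []. Qed.

Lemma state_rank_le q s : state_rank q s <= #|{: nstate M * nsym M}|.
Proof. exact: ltn_ord. Qed.

Definition sym_ok (n : nat) (x : bool) (p : nat) (a : insym) : bool :=
  match a with
  | LeftEnd => p == 0
  | Bit c => [&& 0 < p, p <= n & c == x]
  | RightEnd => n < p
  end.

Definition move_ok (n : nat) (d : move) (p p' : nat) : bool :=
  match d with
  | MoveLeft => (p == p' + 1) || ((p == 0) && (p' == 0))
  | Stay => p' == p
  | MoveRight => if p <= n then p' == p + 1 else p' == n + 1
  end.

(** Popping is written as pushing read backwards, with the symbol [h] that comes under the head as
    witness. All conditions are linear equations with constant coefficients, the form that automata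
    can check. *)
Definition tape_ok (d : move) (l r : nat) (s h : nsym M) (l' r' : nat) : bool :=
  match d with
  | MoveLeft => (l == b * l' + sym_rank h) && (r' == b * r + sym_rank s)
  | Stay => [&& h == s, l' == l & r' == r]
  | MoveRight => (r == b * r' + sym_rank h) && (l' == b * l + sym_rank s)
  end.

Definition moves := [:: MoveLeft; Stay; MoveRight].
Definition insyms := [:: LeftEnd; Bit true; Bit false; RightEnd].

Lemma has_moves (P : pred move) : reflect (exists d, P d) (has P moves).
Proof.
apply: (iffP idP) => [|[[] h]]; rewrite /= ?h ?orbT //.
by rewrite orbF => /or3P[] h; [exists MoveLeft|exists Stay|exists MoveRight].
Qed.

Lemma has_insyms (P : pred insym) : reflect (exists a, P a) (has P insyms).
Proof.
apply: (iffP idP) => [|[[|[]|] h]]; rewrite /= ?h ?orbT //.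
by rewrite orbF => /or4P[] h; [exists LeftEnd|exists (Bit true)|exists (Bit false)|exists RightEnd].
Qed.

(* State and scanned symbol, input position, and the two halves of the work tape
   read as numbers in base [b]; all fields are 0 in the accepting sink. *)
Record conf4 := Conf4 { cF : nat; cP : nat; cL : nat; cR : nat }.

(* Here [x] is the input bit under the head. *)
Definition step_rel (n : nat) (x : bool) (u v : conf4) : bool :=
  [exists q, [exists s, [exists q', [exists s', [exists h,
    has (fun a => has (fun d => has (fun e =>
      [&& cF u == state_rank q s, cF v == state_rank q' h, ndelta q a s q' s' d e,
          sym_ok n x (cP u) a, move_ok n d (cP u) (cP v) &
          tape_ok e (cL u) (cR u) s' h (cL v) (cR v)]) moves) moves) insyms]]]]].

Definition accept_rel (u v : conf4) : bool :=
  [exists q, [exists s, naccept q && (cF u == state_rank q s)]] &&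
  [&& cF v == 0, cP v == 0, cL v == 0 & cR v == 0].

(* Reflexive, so that walks can be padded to a fixed length. *)
Definition conf_rel n x (u v : conf4) : bool :=
  [|| [&& cF u == cF v, cP u == cP v, cL u == cL v & cR u == cR v],
      accept_rel u v | step_rel n x u v].

Section Correct.
Variables (T BF BP BL : nat) (enc : conf4 -> nat) (dec : nat -> conf4).
Definition conf_range (c : conf4) : bool := [&& cF c < BF, cP c < BP, cL c < BL & cR c < BL].
Hypothesis dec_range : forall u, u < T -> conf_range (dec u).
Hypothesis enc_lt : forall c, conf_range c -> enc c < T.
Hypothesis encK : forall c, conf_range c -> dec (enc c) = c.
Hypothesis decK : forall u, u < T -> enc (dec u) = u.

Variables (x : seq bool) (S : nat).
Hypothesis space : forall c : nconf M, nreach x c -> tape_size (nc_tape c) <= S.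
Hypotheses (hBF : #|{: nstate M * nsym M}| < BF) (hBP : (size x).+1 < BP) (hBL : b ^ S <= BL).

Definition conf_edge (u v : nat) : bool :=
  conf_rel (size x) (nth false x (cP (dec u)).-1) (dec u) (dec v).

Definition abs_conf (c : nconf M) : conf4 :=
  Conf4 (state_rank (nc_state c) (thead (nc_tape c))) (nc_pos c)
        (code (tleft (nc_tape c))) (code (tright (nc_tape c))).

Definition start4 := Conf4 (state_rank (nstart M) (nblank M)) 0 0 0.
Definition accept4 := Conf4 0 0 0 0.

Lemma read_pos (c : nconf M) : nreach x c -> nc_pos c <= (size x).+1.
Proof.
rewrite /nreach => /(@clos_rt_rtn1 _ _ _ _); elim=> //= {}c c' [q [s [d [e [_ ->]]]]] _ IH /=.
by case: d => //=; [exact: leq_trans (leq_pred _) IH | exact: geq_minr].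
Qed.

Lemma abs_range c : nreach x c -> conf_range (abs_conf c).
Proof.
move=> h; rewrite /conf_range /= (leq_ltn_trans (state_rank_le _ _) hBF).
rewrite (leq_ltn_trans (read_pos h) hBP) /=.
have := space h; rewrite /tape_size => hs.
have hc l : size l <= S -> code l < BL.
  move=> hl; apply: leq_trans (code_lt l) _; apply: leq_trans hBL.
  by rewrite leq_pexp2l.
by rewrite !hc //; move: hs; case: (nc_tape c) => /= l _ r; lia.
Qed.

Lemma start_range : conf_range start4.
Proof.
have h : nreach x (ninit M) by apply: rt_refl.
by have := abs_range h; rewrite /abs_conf /=.
Qed.

Lemma accept_range : conf_range accept4.
Proof.
have := start_range; rewrite /conf_range /= => /and4P[h1 h2 h3 _].
by rewrite h3 h2 (leq_ltn_trans _ h1).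
Qed.

Lemma sym_okP p a : p <= (size x).+1 ->
  sym_ok (size x) (nth false x p.-1) p a <-> a = read_input x p.
Proof.
case: p => [|p] hp /=; first by case: a => [|c|] //=; rewrite ?ltn0 //; split.
case: a => [|c|]; rewrite /= ?ltnS; case: ltnP => h //=.
by split=> [/eqP ->|[->]].
Qed.

Lemma move_okP d p p' : p <= (size x).+1 ->
  move_ok (size x) d p p' <-> p' = move_input x p d.
Proof.
move=> hp; case: d => /=; first by split; lia.
  by split=> [/eqP|->].
by case: (leqP p (size x)) => h; split; rewrite /minn; case: ifP; lia.
Qed.

Lemma tape_okP e (t : tape (nsym M)) s h l' r' :
  tape_ok e (code (tleft t)) (code (tright t)) s h l' r' <->
  let t' := tape_step (nblank M) t s e in
  [/\ h = thead t', l' = code (tleft t') & r' = code (tright t')].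
Proof.
case: t => l z r; case: e => /=.
- split.
    case/andP=> /eqP e1 /eqP ->; move: e1; rewrite (code_split l) [RHS]addnC.
    by case/code_inj_split=> <- <-; split=> //; rewrite addnC.
  by case=> -> -> ->; rewrite (code_split l) addnC eqxx /= addnC.
- by split=> [/and3P[/eqP-> /eqP-> /eqP->]|[-> -> ->]] //; rewrite !eqxx.
split.
  case/andP=> /eqP e1 /eqP ->; move: e1; rewrite (code_split r).
  by rewrite [RHS]addnC; case/code_inj_split=> <- <-; split=> //; rewrite addnC.
by case=> -> -> ->; rewrite (code_split r) addnC eqxx /= addnC.
Qed.

Lemma step_relP (c : nconf M) v : nreach x c ->
  step_rel (size x) (nth false x (cP (abs_conf c)).-1) (abs_conf c) v <->
  exists2 c', nstep x c c' & v = abs_conf c'.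
Proof.
move=> hr; have hp := read_pos hr; split.
  case/existsP=> q /existsP[s /existsP[q' /existsP[s' /existsP[h]]]].
  case/has_insyms=> a /has_moves[d /has_moves[e /and4P[/eqP]]].
  case/state_rank_inj => <- <- /eqP eF hd /and3P[/(sym_okP _ hp) ea /(move_okP _ _ hp) ep].
  case/tape_okP=> eh el er.
  exists (NConf q' (move_input x (nc_pos c) d) (tape_step (nblank M) (nc_tape c) s' e)).
    by exists q', s', d, e; rewrite -ea.
  by case: v eF ep el er => f p l r /= -> -> -> ->; rewrite /abs_conf /= eh.
case=> c' [q' [s' [d [e [hd ->]]]]] ->.
apply/existsP; exists (nc_state c); apply/existsP; exists (thead (nc_tape c)).
apply/existsP; exists q'; apply/existsP; exists s'; apply/existsP.
exists (thead (tape_step (nblank M) (nc_tape c) s' e)).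
apply/has_insyms; exists (read_input x (nc_pos c)).
apply/has_moves; exists d; apply/has_moves; exists e.
rewrite !eqxx hd; apply/and5P; split=> //; first exact/sym_okP.
by apply/andP; split; [apply/move_okP|apply/tape_okP].
Qed.

Lemma accept_relP (c : nconf M) v : accept_rel (abs_conf c) v <->
  naccept (nc_state c) /\ v = accept4.
Proof.
split.
  case/andP=> /existsP[q /existsP[s /andP[hq /eqP /state_rank_inj[-> _]]]].
  by case: v => f p l r /and4P[/eqP /= -> /eqP -> /eqP -> /eqP ->].
case=> h ->; rewrite /accept_rel /= andbT; apply/existsP; exists (nc_state c).
by apply/existsP; exists (thead (nc_tape c)); rewrite h eqxx.
Qed.

Lemma conf4_eq u v : [&& cF u == cF v, cP u == cP v, cL u == cL v & cR u == cR v] -> u = v.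
Proof. by case: u v => f p l r [f' p' l' r'] /and4P[/eqP /= -> /eqP -> /eqP -> /eqP ->]. Qed.

Lemma conf_edge_refl u : conf_edge u u.
Proof. by rewrite /conf_edge /conf_rel !eqxx. Qed.

Lemma accept_stuck v : conf_rel (size x) (nth false x (cP accept4).-1) accept4 v -> v = accept4.
Proof.
case/or3P.
- by move/conf4_eq.
- by case/andP=> /existsP[q /existsP[s /andP[]]].
by case/existsP=> q /existsP[s /existsP[q' /existsP[s' /existsP[h
   /has_insyms[a /has_moves[d /has_moves[e /andP[]]]]]]]].
Qed.

Theorem simulation : 0 < walks T conf_edge (enc start4) T.-1 (enc accept4) <-> naccepts M x.
Proof.
pose o c (h : conf_range c) := Ordinal (enc_lt h).
have W := @walks_connect T conf_edge (o _ start_range).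
have W' := @connect_walks T conf_edge (o _ start_range) conf_edge_refl.
split.
  move/(W _ (o _ accept_range)); set R := connect _ => hR.
  (* Along a walk the vertices stand for reachable configurations until the sink is entered, from an
     accepting one. Reachability is part of the invariant because steps are known to be faithful
     only at head positions in range. *)
  have key (v : 'I_T) : R (o _ start_range) v ->
      (exists2 c, nreach x c & dec v = abs_conf c) \/ (dec v = accept4 /\ naccepts M x).
    case/connectP=> p hp ->; elim/last_ind: p hp => [_|p w IH].
      left; exists (ninit M); first exact: rt_refl.
      by rewrite /= encK ?start_range.
    rewrite rcons_path last_rcons => /andP[/IH h hw]; move: h hw.
    set u := last _ p; rewrite /conf_edge => -[[c hc ->]|[-> hacc]]; last first.
      by move/accept_stuck; right.
    rewrite /conf_rel; case/or3P.
    - by move/conf4_eq => <-; left; exists c.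
    - by move/accept_relP=> [ha ->]; right; split=> //; exists c.
    case/(step_relP _ hc) => c' hc' ->; left; exists c' => //.
    by apply: rt_trans hc _; apply: rt_step.
  case: (key _ hR) => [[c _]|[_ //]].
  by rewrite /= encK ?accept_range.
case=> c hc ha; apply: (W' (o _ accept_range)).
have hreach : connect (fun u v : 'I_T => conf_edge u v) (o _ start_range) (o _ (abs_range hc)).
  have : clos_refl_trans_n1 _ (@nstep M x) (ninit M) c by apply: clos_rt_rtn1.
  move=> h; move: (hc) => hc'; elim: h hc' => [|c1 c2 h12 h1 IH] hc'.
    by rewrite (_ : o _ _ = o _ start_range) //; apply: val_inj.
  have hc1 : nreach x c1 by apply: clos_rtn1_rt.
  apply: connect_trans (IH hc1) _; apply: connect1.
  rewrite /conf_edge /= !encK ?abs_range // /conf_rel; apply/or3P; apply: Or33.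
  by apply/(step_relP _ hc1); exists c2.
apply: connect_trans hreach _; apply: connect1.
rewrite /conf_edge /= !encK ?abs_range ?accept_range // /conf_rel; apply/or3P; apply: Or32.
by apply/accept_relP.
Qed.

End Correct.
End Simulation.

(** * Packing numbers bitwise *)

Section Digits.
Variable b : nat.
Hypothesis b0 : 0 < b.

Definition from_digits (L : nat) (d : nat -> nat) : nat := \sum_(i < L) b ^ i * d i.

Lemma from_digitsS L d : from_digits L.+1 d = d 0 + b * from_digits L (fun i => d i.+1).
Proof.
rewrite /from_digits big_ord_recl expn0 mul1n big_distrr; congr (_ + _).
by apply: eq_bigr => i _; rewrite lift0 expnS -mulnA.
Qed.

Lemma from_digits_lt L d : (forall i, i < L -> d i < b) -> from_digits L d < b ^ L.
Proof.
elim: L d => [|L IH] d h; first by rewrite /from_digits big_ord0.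
have h0 := h 0 isT; have := IH (fun i => d i.+1) (fun i hi => h i.+1 hi).
rewrite from_digitsS expnS; move: (from_digits _ _) (b ^ L) (d 0) h0 => x y z; nia.
Qed.

Lemma digit_from_digits L d i : (forall i, i < L -> d i < b) -> i < L ->
  from_digits L d %/ b ^ i %% b = d i.
Proof.
elim: L d i => // L IH d [|i] h hi.
  by rewrite from_digitsS expn0 divn1 mulnC addnC modnMDl modn_small // h.
rewrite from_digitsS expnS divnMA addnC [b * from_digits _ _]mulnC divnMDl // (divn_small (h 0 isT)) addn0.
by rewrite (IH (fun i => d i.+1)) // => k hk; apply: h.
Qed.

Lemma from_digitsK L y : y < b ^ L -> from_digits L (fun i => y %/ b ^ i %% b) = y.
Proof.
elim: L y => [|L IH] y hy; first by move: hy; rewrite /from_digits big_ord0; case: y.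
rewrite from_digitsS expn0 divn1.
have e : forall i, y %/ b ^ i.+1 = y %/ b %/ b ^ i by move=> i; rewrite expnS divnMA.
rewrite (_ : from_digits L _ = y %/ b); last first.
  rewrite -[RHS]IH ?ltn_divLR // -?expnSr //.
  by apply: eq_bigr => i _; rewrite e.
by rewrite [in RHS](divn_eq y b) addnC mulnC.
Qed.

End Digits.

Lemma exp2_gt0 w : 0 < 2 ^ w. Proof. by rewrite expn_gt0. Qed.

Lemma modn_exp2S x w : x %% 2 ^ w.+1 = odd x + 2 * (x %/ 2 %% 2 ^ w).
Proof.
rewrite {1}(divn_eq x 2) modn2 {1}(divn_eq (x %/ 2) (2 ^ w)) mulnDl -mulnA -expnSr -addnA modnMDl.
rewrite modn_small; first by rewrite mulnC addnC.
have := ltn_pmod (x %/ 2) (expn_gt0 2 w : 0 < 2 ^ w); rewrite expnS; case: (odd x); lia.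
Qed.

Lemma modn_bits x w : x %% 2 ^ w = \sum_(j < w) 2 ^ j * odd (x %/ 2 ^ j).
Proof.
elim: w x => [|w IH] x; first by rewrite modn1 big_ord0.
rewrite modn_exp2S IH big_ord_recl expn0 mul1n divn1 big_distrr; congr (_ + _).
by apply: eq_bigr => i _; rewrite lift0 expnS -mulnA divnMA.
Qed.

Section Slices.
Variable L : nat.

(* The [w] bits at offset [o] of each of the [L] blocks of [K] bits of [y]. *)
Definition slice (K o w y : nat) : nat :=
  from_digits (2 ^ w) L (fun i => y %/ 2 ^ (K * i + o) %% 2 ^ w).

Lemma slice_lt K o w y : slice K o w y < 2 ^ (w * L).
Proof. by rewrite expnM; apply: (from_digits_lt (exp2_gt0 _)) => *; exact: ltn_pmod (exp2_gt0 _). Qed.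

Lemma slice_digit K o w y i : i < L ->
  slice K o w y %/ 2 ^ (w * i) %% 2 ^ w = y %/ 2 ^ (K * i + o) %% 2 ^ w.
Proof.
move=> hi; rewrite expnM digit_from_digits ?expn_gt0 // => *.
exact: ltn_pmod (exp2_gt0 _).
Qed.

Lemma mod_div_mod x a c w : a + c <= w -> x %% 2 ^ w %/ 2 ^ a %% 2 ^ c = x %/ 2 ^ a %% 2 ^ c.
Proof.
move=> h; rewrite [in RHS](divn_eq x (2 ^ w)).
have -> : 2 ^ w = 2 ^ (w - a - c) * 2 ^ c * 2 ^ a by rewrite -!expnD; congr (2 ^ _); lia.
by rewrite mulnA divnMDl ?expn_gt0 // mulnA modnMDl.
Qed.

(** A field within a field is again a slice of the whole number, so all nested fields of a vertex
    sit at fixed offsets of its blocks. *)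
Lemma slice_slice K o w o' w' y : o' + w' <= w ->
  slice w o' w' (slice K o w y) = slice K (o + o') w' y.
Proof.
move=> h; apply: eq_bigr => i _; congr (_ * _).
rewrite expnD divnMA -(mod_div_mod _ h) slice_digit // mod_div_mod //.
by rewrite -divnMA -expnD addnA.
Qed.

Lemma slice_full w y : y < 2 ^ (w * L) -> slice w 0 w y = y.
Proof.
move=> h; rewrite expnM in h; rewrite -[RHS](from_digitsK (expn_gt0 2 w) h).
by apply: eq_bigr => i _; rewrite addn0 expnM.
Qed.

(** Blockwise concatenation: digits of equal rank of both numbers share a block, so that automata
    can compare and add them. *)
Definition join (w1 w2 y1 y2 : nat) : nat :=
  from_digits (2 ^ (w1 + w2)) L
    (fun i => y1 %/ 2 ^ (w1 * i) %% 2 ^ w1 + 2 ^ w1 * (y2 %/ 2 ^ (w2 * i) %% 2 ^ w2)).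

Lemma join_digit_lt w1 w2 x y : x %% 2 ^ w1 + 2 ^ w1 * (y %% 2 ^ w2) < 2 ^ (w1 + w2).
Proof.
rewrite expnD.
have hx := ltn_pmod x (exp2_gt0 w1); have hy := ltn_pmod y (exp2_gt0 w2); nia.
Qed.

Lemma join_lt w1 w2 y1 y2 : join w1 w2 y1 y2 < 2 ^ ((w1 + w2) * L).
Proof. by rewrite expnM; apply: (from_digits_lt (exp2_gt0 _)) => *; apply: join_digit_lt. Qed.

Lemma join_digit w1 w2 y1 y2 i : i < L -> join w1 w2 y1 y2 %/ 2 ^ ((w1 + w2) * i) %% 2 ^ (w1 + w2) =
  y1 %/ 2 ^ (w1 * i) %% 2 ^ w1 + 2 ^ w1 * (y2 %/ 2 ^ (w2 * i) %% 2 ^ w2).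
Proof.
move=> hi; rewrite expnM digit_from_digits ?expn_gt0 // => *; exact: join_digit_lt.
Qed.

Lemma join00 w1 w2 : join w1 w2 0 0 = 0.
Proof. by rewrite /join /from_digits big1 // => i _; rewrite !div0n !mod0n muln0 addn0 muln0. Qed.

(** A number within one block is not changed by packing it lowest beside 0. Hence the number of the
    start configuration does not depend on the input length. *)
Lemma join_small w1 w2 y : 0 < L -> y < 2 ^ w1 -> join w1 w2 y 0 = y.
Proof.
rewrite /join => L0 hy; rewrite -(prednK L0) from_digitsS muln0 expn0 divn1 div0n mod0n muln0 modn_small //.
rewrite /from_digits big1 ?muln0 ?addn0 // => i _.
rewrite div0n mod0n muln0 addn0 divn_small ?mod0n ?muln0 //.
by rewrite (leq_trans hy) // leq_exp2l // leq_pmulr.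
Qed.

Lemma slice_joinl w1 w2 y1 y2 : y1 < 2 ^ (w1 * L) ->
  slice (w1 + w2) 0 w1 (join w1 w2 y1 y2) = y1.
Proof.
move=> h; rewrite -[RHS](slice_full h); apply: eq_bigr => i _; congr (_ * _).
have h1 : 0 + w1 <= w1 + w2 by rewrite leq_addr.
have := mod_div_mod (join w1 w2 y1 y2 %/ 2 ^ ((w1 + w2) * i)) h1.
by rewrite !addn0 expn0 !divn1 => <-; rewrite join_digit // addnC mulnC modnMDl modn_mod.
Qed.

Lemma slice_joinr w1 w2 y1 y2 : y2 < 2 ^ (w2 * L) ->
  slice (w1 + w2) w1 w2 (join w1 w2 y1 y2) = y2.
Proof.
move=> h; rewrite -[RHS](slice_full h); apply: eq_bigr => i _; congr (_ * _).
rewrite expnD divnMA -(mod_div_mod _ (leqnn (w1 + w2))) join_digit // addn0.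
rewrite addnC mulnC divnMDl ?expn_gt0 // (divn_small (ltn_pmod _ (exp2_gt0 _))) addn0.
by rewrite modn_mod.
Qed.

Lemma join_slices w1 w2 y : y < 2 ^ ((w1 + w2) * L) ->
  join w1 w2 (slice (w1 + w2) 0 w1 y) (slice (w1 + w2) w1 w2 y) = y.
Proof.
move=> h; rewrite -[RHS](slice_full h); apply: eq_bigr => i _; congr (_ * _).
rewrite !slice_digit // !addn0 [in RHS]expnD.
set x := y %/ _; have -> : y %/ 2 ^ ((w1 + w2) * i + w1) = x %/ 2 ^ w1 by rewrite /x expnD divnMA.
have p1 := expn_gt0 2 w1; have p2 := expn_gt0 2 w2.
rewrite [in RHS](divn_eq x (2 ^ w1)) [in RHS](divn_eq (x %/ 2 ^ w1) (2 ^ w2)).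
rewrite mulnDl -mulnA [2 ^ w2 * 2 ^ w1]mulnC -addnA modnMDl [RHS]modn_small.
  by rewrite addnC mulnC.
have := join_digit_lt w1 w2 x (x %/ 2 ^ w1); rewrite expnD; lia.
Qed.

Fixpoint pack (ws vs : seq nat) : nat :=
  if ws is w :: ws' then join w (sumn ws') (head 0 vs) (pack ws' (behead vs)) else 0.

Lemma pack_lt ws vs : pack ws vs < 2 ^ (sumn ws * L).
Proof. by case: ws => //= w ws; apply: join_lt. Qed.

Definition field (ws : seq nat) (k y : nat) : nat :=
  slice (sumn ws) (sumn (take k ws)) (nth 0 ws k) y.

Lemma field_lt ws k y : field ws k y < 2 ^ (nth 0 ws k * L).
Proof. exact: slice_lt. Qed.

Lemma field_cons w ws k y : k < size ws ->
  field (w :: ws) k.+1 y = field ws k (slice (w + sumn ws) w (sumn ws) y).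
Proof.
move=> hk; rewrite /field /= slice_slice //.
by rewrite -{3}(cat_take_drop k ws) sumn_cat (drop_nth 0) //= addnA leq_addr.
Qed.

Lemma field_pack ws vs k : k < size ws ->
  (forall k, k < size ws -> nth 0 vs k < 2 ^ (nth 0 ws k * L)) ->
  field ws k (pack ws vs) = nth 0 vs k.
Proof.
elim: ws vs k => // w ws IH vs [|k] hk h.
  by rewrite /field /= slice_joinl ?nth0 // -nth0; apply: (h 0).
rewrite field_cons //= slice_joinr ?pack_lt // IH ?nth_behead // => k' hk'.
by rewrite nth_behead; apply: (h k'.+1).
Qed.

Lemma pack_field ws y : y < 2 ^ (sumn ws * L) ->
  pack ws (mkseq (fun k => field ws k y) (size ws)) = y.
Proof.
elim: ws y => [|w ws IH] y /= hy; first by move: hy; rewrite mul0n; case: y.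
rewrite -[RHS](join_slices hy) /field /=; congr join.
rewrite -[RHS]IH ?slice_lt //; congr pack.
apply: (@eq_from_nth _ 0); rewrite ?size_behead ?size_map ?size_iota // => k hk.
rewrite nth_mkseq //; rewrite (nth_map 0) ?size_iota // nth_iota // add1n.
exact: field_cons.
Qed.

End Slices.

(** * The reduction on numbers *)

(* The vertex of a link graph of kind [kd]: 0, 1 for the apexes, 2 for (xi, xu) and
   3 + t for mid t of (xi, xu) and (yi, yu), where (1, w) is the name [w]. *)
Record xvert := XVert { kd : nat; xi : nat; xu : nat; yi : nat; yu : nat }.

Definition same_x (z z' : xvert) := (xi z == xi z') && (xu z == xu z').
Definition x_is_y (z z' : xvert) := (xi z == yi z') && (xu z == yu z').
Definition no_x (z : xvert) := (xi z == 0) && (xu z == 0).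
Definition no_y (z : xvert) := (yi z == 0) && (yu z == 0).

(* [a] and [b] say whether the pair of vertices stored in [z'] is A- resp.
   B-linked. *)
Definition xadj1 (a b : bool) (z z' : xvert) : bool :=
  [|| [&& kd z < 2, no_x z, no_y z, kd z' < 2, no_x z', no_y z' & kd z != kd z'],
      [&& kd z < 2, no_x z, no_y z, kd z' == 2, no_y z' & xi z' < 2],
      [&& kd z == 2, no_y z, kd z' == 3, a & same_x z z' || x_is_y z z'],
      [&& kd z == 2, no_y z, kd z' == 4, b & same_x z z'],
      [&& kd z == 2, no_y z, kd z' == 5, b & x_is_y z z'] |
      [&& kd z == 4, kd z' == 5, b, same_x z z' & (yi z == yi z') && (yu z == yu z')]].

Lemma xadj1_irr a b z : xadj1 a b z z = false.
Proof.
by rewrite /xadj1 eqxx !andbF; case: (kd z) => [|[|[|[|[|[|d]]]]]]; rewrite /= ?andbF.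
Qed.

Definition xB (z : xvert) : bool := [&& xi z == 1, yi z == 1 & yu z == xu z + 1].
Definition xA (un bin : bool) (z : xvert) : bool :=
  if xi z == 0 then (if yi z == 1 then un else (yi z == 0) && bin)
  else [&& xi z == 1, yi z == 1, xu z == 0 & yu z == 2].

Section Embedding.
Variables (Y : nat) (un : 'I_Y -> 'I_Y -> bool) (bin : rel 'I_Y).
Variables (unN binN : nat -> nat -> bool).
Hypothesis unE : forall p w : 'I_Y, unN p w = un p w.
Hypothesis binE : forall p w : 'I_Y, binN p w = bin p w.
Let V : finType := ('I_Y + 'I_Y)%type.

Definition side (v : V) : nat := if v is inl _ then 0 else 1.
Definition num (v : V) : nat := match v with inl p => p | inr w => w end.

Definition xrec (p : lvert V) : xvert :=
  match p with
  | inl (inl b) => XVert b 0 0 0 0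
  | inl (inr v) => XVert 2 (side v) (num v) 0 0
  | inr (t, x, y) => XVert (3 + t) (side x) (num x) (side y) (num y)
  end.

Lemma side_num v v' : (side v == side v') && (num v == num v') = (v == v').
Proof. by case: v v' => p [] q //=. Qed.

Lemma xrec_inj : injective xrec.
Proof.
have sn v v' : side v = side v' -> num v = num v' -> v = v'.
  by move=> h1 h2; apply/eqP; rewrite -side_num h1 h2 !eqxx.
case=> [[b|v]|[[t x] y]] [[b'|v']|[[t' x'] y']] //=; try by [case: b|case: b'].
- by case; case: b b' => [] [].
- by case=> /sn h /h ->.
case=> /addnI /val_inj -> /sn h1 /h1 -> /sn h2 /h2 -> //.
Qed.

Definition xlink (z : xvert) : bool := xA (unN (xu z) (yu z)) (binN (xu z) (yu z)) z.

Lemma xA_rec (t : 'I_3) x y : xlink (xrec (inr (t, x, y))) = lab_A un bin x y.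
Proof. by rewrite /xlink /xA; case: x y => p [] q /=; rewrite ?unE ?binE. Qed.

Lemma xB_rec (t : 'I_3) x y : xB (xrec (inr (t, x, y))) = lab_B x y.
Proof. by rewrite /xB; case: x y => p [] q //=; rewrite addn1. Qed.

Lemma xadj1_rec p q :
  xadj1 (xlink (xrec q)) (xB (xrec q)) (xrec p) (xrec q) = ldadj (lab_A un bin) (@lab_B _ Y) p q.
Proof.
case: q => [[b|v]|[[t x] y]]; rewrite ?xA_rec ?xB_rec.
- by case: b; case: p => [[[]|v']|[[t' x'] y']]; rewrite /xadj1 /no_x /no_y /= ?andbF ?orbF.
- by case: v => v; case: p => [[[]|v']|[[t' x'] y']]; rewrite /xadj1 /no_x /no_y /= ?andbF ?orbF.
case: p => [[b'|v']|[[t' x'] y']]; rewrite /xadj1 /no_x /no_y /same_x /x_is_y /=.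
- by case: b'; case: t => [[|[|[|t]]] ht]; rewrite /= ?andbF ?orbF.
- by rewrite !side_num; case: t => [[|[|[|t]]] ht] //=; rewrite ?orbF ?andbF.
rewrite !side_num; case: t => [[|[|[|t]]] ht] //=; case: t' => [[|[|[|t']]] ht'] //=.
by apply/and3P/and3P => -[h /eqP e1 /eqP e2]; move: h; rewrite e1 e2.
Qed.

(** A number whose fields describe no vertex of the link graph is isolated: the clauses of [xadj1]
    force the absent ends to 0, and the links force the sides to be 0 or 1. *)
Lemma xrec_onto z z' : xu z < Y -> yu z < Y -> xu z' < Y -> yu z' < Y ->
  xadj1 (xlink z') (xB z') z z' -> (exists p, z = xrec p) /\ (exists p, z' = xrec p).
Proof.
move=> hx hy hx' hy'.
have vtxP w : kd w = 2 -> no_y w -> xi w < 2 -> xu w < Y -> exists p, w = xrec p.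
  case: w => k i u i' u' /= -> /andP[/eqP /= -> /eqP /= ->] hi hu.
  case: i hi => [|[|//]] _; first by exists (inl (inr (inl (Ordinal hu)))).
  by exists (inl (inr (inr (Ordinal hu)))).
have apexP w : kd w < 2 -> no_x w -> no_y w -> exists p, w = xrec p.
  case: w => k i u i' u' /= hk /andP[/eqP /= -> /eqP /= ->] /andP[/eqP /= -> /eqP /= ->].
  by case: k hk => [|[|//]] _; [exists (inl (inl false))|exists (inl (inl true))].
have midP w : 2 < kd w < 6 -> xi w < 2 -> yi w < 2 -> xu w < Y -> yu w < Y -> exists p, w = xrec p.
  case: w => k i u i' u' /= hk hi hi' hu hu'.
  have ht : k - 3 < 3 by lia.
  have ek : k = 3 + (k - 3) by lia.
  case: i hi => [|[|//]] _; case: i' hi' => [|[|//]] _;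
  [exists (inr (Ordinal ht, inl (Ordinal hu), inl (Ordinal hu')))
  |exists (inr (Ordinal ht, inl (Ordinal hu), inr (Ordinal hu')))
  |exists (inr (Ordinal ht, inr (Ordinal hu), inl (Ordinal hu')))
  |exists (inr (Ordinal ht, inr (Ordinal hu), inr (Ordinal hu')))]; by rewrite /= {1}ek.
have A2 w : xlink w -> xi w < 2 /\ yi w < 2.
  rewrite /xlink /xA; case: eqP => [->|_]; last by case/and4P=> /eqP -> /eqP ->.
  by case: eqP => [->//|_] /andP[/eqP ->].
have B2 w : xB w -> xi w < 2 /\ yi w < 2 by case/and3P=> /eqP -> /eqP ->.
case/or4P => [||| /orP[|/orP[]]].
- by case/and4P => h1 h2 h3 /and4P[h4 h5 h6 _]; split; apply: apexP.
- case/and4P => h1 h2 h3 /and3P[/eqP h4 h5 h6]; split; [exact: apexP|exact: vtxP].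
- case/and4P => /eqP h1 h2 /eqP h3 /andP[ha h]; have [i1 i2] := A2 _ ha; split.
    by apply: vtxP => //; case/orP: h => /andP[/eqP -> _].
  by apply: midP; rewrite ?h3.
- case/and4P => /eqP h1 h2 /eqP h3 /andP[ha h]; have [i1 i2] := B2 _ ha; split.
    by apply: vtxP => //; case/andP: h => /eqP ->.
  by apply: midP; rewrite ?h3.
- case/and4P => /eqP h1 h2 /eqP h3 /andP[ha h]; have [i1 i2] := B2 _ ha; split.
    by apply: vtxP => //; case/andP: h => /eqP ->.
  by apply: midP; rewrite ?h3.
case/and4P => /eqP h1 /eqP h2 ha /andP[/andP[/eqP e1 /eqP e2] /andP[/eqP e3 /eqP e4]].
have [i1 i2] := B2 _ ha; split; apply: midP; rewrite ?h1 ?h2 ?e1 ?e3 //.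
Qed.

End Embedding.

(** Widths are bits per block, with about [log n] blocks: one bit per block covers the head
    positions, [be] bits a half tape of logarithmic length. *)
Definition conf_widths (be : nat) : seq nat := [:: be; 1; be; be].
Definition conf_width (be : nat) : nat := sumn (conf_widths be).
(** The moduli need a range [R] with [T^T < 2^(R-2)]. For [T = 2^(conf_width be * L)] this width
    gives [R = T * T * 2^L]. *)
Definition mod_width (be : nat) : nat := (conf_width be).*2.+1.
(* The third field doubles every rung, so that no modulus lives only on the
   last one. *)
Definition rung_widths (be : nat) : seq nat := [:: mod_width be; mod_width be; 1].
Definition cell_widths (be : nat) : seq nat :=
  [:: 3; 1; 1; sumn (rung_widths be); conf_width be; conf_width be; conf_width be;
      mod_width be; mod_width be].
Definition cell_width (be : nat) : nat := sumn (cell_widths be).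
Definition vert_widths (be : nat) : seq nat := [:: 3; 1; cell_width be; 1; cell_width be].
Definition vert_width (be : nat) : nat := sumn (vert_widths be).

Definition unpack_conf (L be u : nat) : conf4 :=
  let f k := field L (conf_widths be) k u in Conf4 (f 0) (f 1) (f 2) (f 3).
Definition pack_conf (L be : nat) (c : conf4) : nat :=
  pack L (conf_widths be) [:: cF c; cP c; cL c; cR c].

Definition unpack_cell (L be u : nat) : cell :=
  let f k := field L (cell_widths be) k u in
  Cell (f 0) (f 1) (f 2) (f 3) (f 4) (f 5) (f 6) (f 7) (f 8).
Definition pack_cell (L be : nat) (c : cell) : nat :=
  pack L (cell_widths be) [:: tg c; al c; ga c; jj c; ti c; vv c; uu c; ii c; kk c].

Definition unpack_vert (L be u : nat) : xvert :=
  let f k := field L (vert_widths be) k u in XVert (f 0) (f 1) (f 2) (f 3) (f 4).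
Definition pack_vert (L be : nat) (z : xvert) : nat :=
  pack L (vert_widths be) [:: kd z; xi z; xu z; yi z; yu z].

Definition rung_mod (L be j : nat) : nat := field L (rung_widths be) 0 j.
Definition rung_res (L be j : nat) : nat := field L (rung_widths be) 1 j.

Section Packing.
Variables (L be : nat).

Lemma pack_confK c : conf_range (2 ^ (be * L)) (2 ^ (1 * L)) (2 ^ (be * L)) c ->
  unpack_conf L be (pack_conf L be c) = c.
Proof.
case: c => f p l r /and4P[/= h1 h2 h3 h4]; rewrite /unpack_conf /pack_conf.
by rewrite !field_pack // => -[|[|[|[|k]]]].
Qed.

Lemma pack_conf_lt c : pack_conf L be c < 2 ^ (conf_width be * L).
Proof. exact: pack_lt. Qed.

Lemma unpack_cellK u : u < 2 ^ (cell_width be * L) -> pack_cell L be (unpack_cell L be u) = u.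
Proof. exact: pack_field. Qed.

Lemma pack_cell_lt c : pack_cell L be c < 2 ^ (cell_width be * L).
Proof. exact: pack_lt. Qed.

Definition small_cell (c : cell) : bool :=
  in_range (2 ^ (conf_width be * L)) (2 ^ (sumn (rung_widths be) * L))
    (2 ^ (mod_width be * L)) (2 ^ (3 * L)) (2 ^ (1 * L)) c.

Lemma unpack_cell_range u : small_cell (unpack_cell L be u).
Proof. by apply/and5P; split; try apply: field_lt; apply/and5P; split; apply: field_lt. Qed.

Lemma pack_cellK c : small_cell c -> unpack_cell L be (pack_cell L be c) = c.
Proof.
case: c => t a g j x v u i k /and5P[/= h0 h1 h2 h3 /and5P[h4 h5 h6 h7 h8]].
rewrite /unpack_cell /pack_cell.
by rewrite !field_pack // => -[|[|[|[|[|[|[|[|[|]]]]]]]]].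
Qed.

Lemma unpack_vertK u : u < 2 ^ (vert_width be * L) -> pack_vert L be (unpack_vert L be u) = u.
Proof. exact: pack_field. Qed.

Lemma pack_vert_lt z : pack_vert L be z < 2 ^ (vert_width be * L).
Proof. exact: pack_lt. Qed.

Lemma pack_vertK z : kd z < 2 ^ (3 * L) -> xi z < 2 ^ (1 * L) -> yi z < 2 ^ (1 * L) ->
  xu z < 2 ^ (cell_width be * L) -> yu z < 2 ^ (cell_width be * L) ->
  unpack_vert L be (pack_vert L be z) = z.
Proof.
case: z => k i u i' u' /= h1 h2 h3 h4 h5; rewrite /unpack_vert /pack_vert.
by rewrite !field_pack // => -[|[|[|[|[|]]]]].
Qed.

(** If one of the two rungs carrying [(m, r)] is the last, the other is not. *)
Lemma rung_onto m r : 0 < L -> m < 2 ^ (mod_width be * L) -> r < 2 ^ (mod_width be * L) ->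
  exists j, [/\ j.+1 < 2 ^ (sumn (rung_widths be) * L), rung_mod L be j = m & rung_res L be j = r].
Proof.
move=> L0 hm hr; pose J := 2 ^ (sumn (rung_widths be) * L).
pose f b := pack L (rung_widths be) [:: m; r; b].
have b2 : 1 < 2 ^ (1 * L) by rewrite mul1n -{1}(expn0 2) ltn_exp2l.
have fE b k : b < 2 -> k < 3 -> field L (rung_widths be) k (f b) = nth 0 [:: m; r; b] k.
  move=> hb hk; rewrite field_pack // => -[|[|[|k']]] //= _.
  exact: leq_trans hb b2.
have hJ b : f b < J by exact: pack_lt.
have f01 : f 0 <> f 1 by move=> e; have := fE 0 2 isT isT; rewrite e fE.
have [h|h] := ltnP (f 0).+1 J; first by exists (f 0); rewrite /rung_mod /rung_res !fE.
exists (f 1); rewrite /rung_mod /rung_res !fE //; split=> //.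
by have := hJ 0; have := hJ 1; rewrite /J in h *; lia.
Qed.

End Packing.

(** One block more than [n] has bits: head positions up to [n + 1] fit, and a machine reading one
    bit of [n] per block meets a blank in the last one. *)
Definition blocks (n : nat) : nat := (size (binary n)).+1.

Lemma blocks_gt n : n.+1 < 2 ^ blocks n.
Proof.
rewrite /blocks size_mkseq expnS.
have : n.+1 <= 2 ^ up_log 2 n.+1 by apply: up_logP.
have := exp2_gt0 (up_log 2 n.+1); lia.
Qed.

(** * The ladder of a machine and an input *)

Section Instance.
Variables (M : ntm) (k be : nat).
Hypothesis be_states : #|{: nstate M * nsym M}| < 2 ^ be.
Hypothesis be_space : #|nsym M|.+1 ^ k <= 2 ^ be.
Hypothesis space : forall (x : seq bool) (c : nconf M), nreach x c ->
  tape_size (nc_tape c) <= k * (trunc_log 2 (size x)).+1.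

Definition ncells n := 2 ^ (cell_width be * blocks n).
Definition nverts n := 2 ^ (vert_width be * blocks n).
Definition nconfs n := 2 ^ (conf_width be * blocks n).
Definition nrungs n := 2 ^ (sumn (rung_widths be) * blocks n).

Definition start_num (n : nat) := pack_conf (blocks n) be (start4 M).

Section FixedSize.
Variable n : nat.
Let L := blocks n.
Notation cellN := (unpack_cell L be).
Notation vertN := (unpack_vert L be).

Definition un_num (s : nat) (p w : nat) : bool :=
  un_ (nconfs n) (nrungs n) (rung_mod L be) (rung_res L be) (start_num n) 0 s (cellN p) (cellN w).

(* The bit under the input head, for the configuration that is the [uu] field
   of the cell [xu z]. *)
Definition edge_bit (b : bool) (z : xvert) : bool :=
  let c := cellN (xu z) in
  conf_rel M n b (unpack_conf L be (uu c)) (unpack_conf L be (vv c)).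

Definition bin_num (e : bool) (p q : nat) : bool :=
  let c := cellN p in let d := cellN q in
  cell_bin (nconfs n) (rung_mod L be (jj c)) (rung_mod L be (jj d)) e c d.

Definition link_num (s : nat) (e : bool) (z : xvert) : bool :=
  xA (un_num s (xu z) (yu z)) (bin_num e (xu z) (yu z)) z.

Definition adj_num (s : nat) (e : xvert -> bool) (u v : nat) : bool :=
  let z := vertN u in let z' := vertN v in
  xadj1 (link_num s (e z') z') (xB z') z z' || xadj1 (link_num s (e z) z) (xB z) z' z.

Lemma adj_num_sym s e : symmetric (adj_num s e).
Proof. by move=> u v; rewrite /adj_num orbC. Qed.

Lemma adj_num_irr s e : irreflexive (adj_num s e).
Proof.
by move=> u; rewrite /adj_num /= xadj1_irr.
Qed.

Section Graph.
Variable e : xvert -> bool.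

Definition adj_ord (s : nat) : rel 'I_(nverts n) := fun u v => adj_num s e u v.

Lemma adj_ord_sym s : symmetric (adj_ord s). Proof. by move=> u v; apply: adj_num_sym. Qed.
Lemma adj_ord_irr s : irreflexive (adj_ord s). Proof. by move=> u; apply: adj_num_irr. Qed.

Definition gadget_graph (s : nat) : graph := Graph (adj_ord_sym s) (adj_ord_irr s).
End Graph.

End FixedSize.

Section Input.
Variable x : seq bool.
Let n := size x.
Let L := blocks n.

Definition input_edge (z : xvert) : bool :=
  let c := unpack_conf L be (uu (unpack_cell L be (xu z))) in edge_bit n (nth false x (cP c).-1) z.

Let E := conf_edge M (unpack_conf L be) x.

Let bin_in (p q : nat) : bool :=
  bin_ (nconfs n) (rung_mod L be) E (unpack_cell L be p) (unpack_cell L be q).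

Let unO s (p w : 'I_(ncells n)) := un_num n s p w.
Let binO (p w : 'I_(ncells n)) := bin_in p w.
Let V : finType := ('I_(ncells n) + 'I_(ncells n))%type.
Let emb (p : lvert V) : 'I_(nverts n) := Ordinal (pack_vert_lt L be (xrec p)).

Lemma L_gt0 : 0 < L. Proof. by []. Qed.

Lemma xrec_unpack (p : lvert V) : unpack_vert L be (pack_vert L be (xrec p)) = xrec p.
Proof.
have p3 : 7 < 2 ^ (3 * L) by rewrite -[7.+1]/(2 ^ 3) leq_exp2l // leq_pmulr // L_gt0.
have p1 : 1 < 2 ^ (1 * L) by rewrite -[2]/(2 ^ 1) leq_exp2l // mul1n L_gt0.
have s1 (v : V) : side v < 2 ^ (1 * L) by case: v => v; rewrite ?(leq_trans _ p1).
have n1 (v : V) : num v < 2 ^ (cell_width be * L) by case: v => v; apply: ltn_ord.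
apply: pack_vertK.
- case: p => [[b|v]|[[t y] z]] /=; apply: leq_trans p3; rewrite ?ltnS //.
    by case: b.
  by have := ltn_ord t; lia.
- by case: p => [[b|v]|[[t y] z]] //=; rewrite exp2_gt0.
- by case: p => [[b|v]|[[t y] z]] //=; rewrite exp2_gt0.
- by case: p => [[b|v]|[[t y] z]] //=; rewrite exp2_gt0.
by case: p => [[b|v]|[[t y] z]] //=; rewrite exp2_gt0.
Qed.

Lemma gadget_represents s :
  @represents (gadget_graph n input_edge s) _ (ladj (lab_A (unO s) binO) (@lab_B _ _)) emb.
Proof.
have aE p q u v : unpack_vert L be u = xrec p -> unpack_vert L be v = xrec q ->
    adj_num n s input_edge u v = ladj (lab_A (unO s) binO) (@lab_B _ _) p q.
  move=> hu hv; rewrite /adj_num; cbv zeta; rewrite hu hv /ladj.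
  rewrite -(@xadj1_rec _ (unO s) binO (un_num n s) bin_in (fun _ _ => erefl) (fun _ _ => erefl) p q).
  rewrite -(@xadj1_rec _ (unO s) binO (un_num n s) bin_in (fun _ _ => erefl) (fun _ _ => erefl) q p).
  by move: (xrec p) (xrec q) => z z'.
split=> [p q e|p q|u v].
- have : pack_vert L be (xrec p) = pack_vert L be (xrec q) by case: e.
  move/(congr1 (unpack_vert L be)) => e'; apply: (@xrec_inj _).
  exact: (etrans (esym (xrec_unpack p)) (etrans e' (xrec_unpack q))).
- exact: aE (xrec_unpack p) (xrec_unpack q).
rewrite -[adj u v]/(adj_num n s input_edge u v) => h.
have hv (w : 'I_(nverts n)) : (exists p : lvert V, unpack_vert L be w = xrec p) ->
    exists p, w = emb p.
  by case=> p e; exists p; apply: val_inj; rewrite /= -e unpack_vertK.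
apply: hv; have f2 (w : 'I_(nverts n)) : xu (unpack_vert L be w) < ncells n by exact: field_lt.
have f4 (w : 'I_(nverts n)) : yu (unpack_vert L be w) < ncells n by exact: field_lt.
case/orP: h => h.
  exact: (proj1 (@xrec_onto _ (un_num n s) bin_in _ _ (f2 u) (f4 u) (f2 v) (f4 v) h)).
exact: (proj2 (@xrec_onto _ (un_num n s) bin_in _ _ (f2 v) (f4 v) (f2 u) (f4 u) h)).
Qed.

Let simul : 0 < walks (nconfs n) E (start_num n) (nconfs n).-1 (pack_conf L be accept4) <-> naccepts M x.
Proof.
apply: (@simulation M (nconfs n) (2 ^ (be * L)) (2 ^ (1 * L)) (2 ^ (be * L))
  (pack_conf L be) (unpack_conf L be) _ _ x (k * (trunc_log 2 (size x)).+1)).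
- by move=> c _; apply: pack_conf_lt.
- exact: pack_confK.
- exact: space.
- by rewrite (leq_trans be_states) // leq_exp2l // leq_pmulr.
- by rewrite mul1n; exact: blocks_gt.
(* The hypothesis [be_space] is raised to the power [log n + 1], which is at most the number of
   blocks. *)
rewrite expnM; apply: leq_trans (_ : (2 ^ be) ^ (trunc_log 2 (size x)).+1 <= _).
  by rewrite leq_exp2r.
rewrite [2 ^ (be * L)]expnM leq_pexp2l ?exp2_gt0 // /L /blocks ltnS size_mkseq.
case: (posnP (size x)) => [->//|x0]; rewrite ltnW // -(ltn_exp2l _ _ (ltnSn 1)).
exact: leq_ltn_trans (trunc_logP (ltnSn 1) x0) (up_logP _ (ltnSn 1)).
Qed.

Lemma nconfs_gt0 : 0 < nconfs n. Proof. exact: exp2_gt0. Qed.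

Lemma pack_accept : pack_conf L be accept4 = 0.
Proof.
by rewrite /pack_conf /= !join00.
Qed.

Lemma mod_width_big : nconfs n ^ nconfs n < 2 ^ (2 ^ (mod_width be * L)).-2.
Proof.
rewrite {1}/nconfs -expnM ltn_exp2l // -/(nconfs n).
have hT : conf_width be * L < nconfs n by rewrite /nconfs ltn_expl.
have T2 : 1 < nconfs n by apply: leq_ltn_trans hT; rewrite muln_gt0 addn_gt0 orbT.
have -> : 2 ^ (mod_width be * L) = nconfs n * nconfs n * 2 ^ L.
  by rewrite /nconfs -!expnD; congr (2 ^ _); rewrite /mod_width; lia.
have : 2 <= 2 ^ L by rewrite -{1}(expn1 2) leq_exp2l.
move: (2 ^ L) (nconfs n) (_ * L) hT T2 => a T w hw T2 ha; nia.
Qed.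

Theorem gadget_iso :
  isomorphic (graphic_matroid (gadget_graph n input_edge 0))
             (graphic_matroid (gadget_graph n input_edge 1)) <-> naccepts M x.
Proof.
rewrite -simul pack_accept.
have R05 : 4 < 2 ^ (3 * L) by rewrite (@leq_trans (2 ^ 3)) // leq_exp2l // leq_pmulr.
have R12 : 1 < 2 ^ (1 * L) by rewrite -{1}(expn0 2) ltn_exp2l // mul1n.
have J2 : 1 < nrungs n.
  by rewrite -{1}(expn0 2) ltn_exp2l // muln_gt0 /= addn_gt0.
have v0T : start_num n < nconfs n by exact: pack_conf_lt.
have mjR j : rung_mod L be j < 2 ^ (mod_width be * L) by exact: field_lt.
pose co (p : 'I_(ncells n)) := unpack_cell L be p.
pose mk c : 'I_(ncells n) := Ordinal (pack_cell_lt L be c).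
have cor p : small_cell L be (co p) by exact: unpack_cell_range.
have mkK c : small_cell L be c -> co (mk c) = c by exact: pack_cellK.
have coK p : mk (co p) = p by apply: val_inj; exact: unpack_cellK.
have Y4 : 3 < ncells n.
  by rewrite (@leq_trans (2 ^ 3)) // leq_exp2l // (@leq_trans (3 * L)) ?leq_pmulr // leq_mul2r leq_addr orbT.
split.
  move=> iso; case: posnP => // w0; exfalso.
  have [F [F1 F2 F3]] := rep_iso (gadget_represents 0) (gadget_represents 1) iso.
  have V2 : exists v v' : V, v != v'.
    have Y0 : 0 < ncells n by apply: leq_trans Y4.
    by exists (inl (Ordinal Y0)), (inr (Ordinal Y0)).
  have [phi [p1 p2 p3]] := link_sound (@lab_B_irr _ _) F1 F2 F3 V2.
  have [psi [q1 q2 q3]] := lab_sound Y4 p1 p2 p3.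
  apply: (@ladder_sound (nconfs n) (nrungs n) (rung_mod L be) (rung_res L be) E (start_num n) 0
    (2 ^ (mod_width be * L)) (2 ^ (3 * L)) (2 ^ (1 * L)) R05 R12 J2 nconfs_gt0 v0T nconfs_gt0 mjR _ co mk mkK coK w0 psi q1 q2 q3).
move=> w0; have rung m r : m.+1 < 2 ^ (mod_width be * L) -> r <= m -> exists j,
    [/\ j.+1 < nrungs n, rung_mod L be j = m & rung_res L be j = r].
  move=> hm hr; apply: rung_onto => //; first exact: ltnW.
  exact: leq_ltn_trans hr (ltnW hm).
have [psi [q1 q2 q3]] := @ladder_complete (nconfs n) (nrungs n) (rung_mod L be) (rung_res L be)
  E (start_num n) 0 (2 ^ (mod_width be * L)) (2 ^ (3 * L)) (2 ^ (1 * L)) R05 R12 J2 nconfs_gt0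
  v0T nconfs_gt0 mjR rung _ co mk cor mkK coK w0 mod_width_big.
have [phi [r1 r2 r3]] := @lab_complete _ (ncells n) (unO 0) (unO 1) binO binO psi q1 q2 q3.
exact: link_complete (gadget_represents 0) (gadget_represents 1) r1 r2 r3.
Qed.

End Input.
End Instance.

(** * The projection circuit *)

Section ProjectionCircuit.
Variables (N n : nat).
(* The value of output (s, u, v) is [A1 s u v] if input bit [(pos u v).-1] is
   set and [A0 s u v] otherwise; input gate [p] has number [spread p]. *)
Variables (A0 A1 : bool -> nat -> nat -> bool) (pos : nat -> nat -> nat).
Variables (isin : nat -> bool) (inp spread : nat -> nat).
Hypothesis N2 : 1 < N.
Hypothesis posP : forall s u v, A0 s u v != A1 s u v -> 0 < pos u v <= n.
Hypothesis spreadP : forall p, p < n -> [/\ spread p < N, isin (spread p) & inp (spread p) = p].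
Hypothesis inpK : forall a, a < N -> isin a -> inp a < n -> spread (inp a) = a.

(* Gates below N are inputs, N and N + 1 are the constants true and false, and
   ((s + 1) N + u) N + v computes the output (s, u, v). *)
Definition hi (a : nat) := a %/ N.
Definition lo (a : nat) := a %% N.
Definition ngates := 3 * N * N.

Definition is_matrix (a : nat) := N <= hi a.
Definition gate_bit (A : bool -> nat -> nat -> bool) (a : nat) := A (2 * N <= hi a) (hi a %% N) (lo a).
Definition is_input (a : nat) := [&& hi a == 0, isin a & inp a < n].
(** As [A0] and [A1] are both true, both false, false and true, or true and false, an entry is
    constant true, constant false, the input bit or its negation: an empty [And], an empty [Or], an
    [Or] of one wire, a [Not]. *)
Definition is_and (a : nat) := (a == N) || [&& is_matrix a, gate_bit A0 a & gate_bit A1 a].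
Definition is_not (a : nat) := [&& is_matrix a, gate_bit A0 a & ~~ gate_bit A1 a].
Definition wires (a b : nat) :=
  [&& is_matrix a, gate_bit A0 a != gate_bit A1 a, hi b == 0, isin b &
      inp b + 1 == pos (hi a %% N) (lo a)].

Lemma N0 : 0 < N. Proof. exact: ltnW. Qed.

Lemma matrix_not_input a : is_matrix a -> is_input a = false.
Proof. by rewrite /is_matrix /is_input => h; have := N0; case: (hi a) h => //; lia. Qed.

(** The left side is what an automaton can test on [b]; the right side shows the unique target,
    whence fan-in one and depth one. *)
Lemma wiresE a b : wires a b =
  [&& is_matrix a, gate_bit A0 a != gate_bit A1 a & b == spread (pos (hi a %% N) (lo a)).-1].
Proof.
rewrite /wires; case: (is_matrix a) => //=; case: (boolP (_ != _)) => //= /posP /andP[p0 pn].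
have hp : (pos (hi a %% N) (lo a)).-1 < n by rewrite prednK.
have [h1 h2 h3] := spreadP hp; apply/and3P/eqP => [[/eqP hb ib /eqP ip]|->]; last first.
  by rewrite /hi divn_small // h2 h3 addn1 prednK.
have bN : b < N by move: hb; rewrite /hi => /eqP; rewrite -leqn0 leqNgt divn_gt0 ?N0 // -ltnNge.
by rewrite -ip addn1 /= inpK // -addn1 ip.
Qed.

Lemma spread_not_matrix p : p < n -> is_matrix (spread p) = false.
Proof.
case/spreadP=> h _ _; apply/negbTE; rewrite /is_matrix /hi divn_small // -ltnNge; exact: N0.
Qed.

Lemma spread_input p : p < n -> is_input (spread p).
Proof. by move=> pn; have [h1 h2 h3] := spreadP pn; rewrite /is_input /hi divn_small // h2 h3. Qed.

Definition gate_kind (g : 'I_ngates) : gate n :=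
  if is_input g then (if insub (inp g) is Some i then Input i else Or)
  else if is_and g then And else if is_not g then Not else Or.

Definition gate_wire : rel 'I_ngates := fun g h => wires g h.

Lemma lt_ngates a : a < N -> a < ngates.
Proof. by move=> h; apply: leq_trans h _; rewrite /ngates leq_pmull // muln_gt0 N0. Qed.

Lemma gate_arity g : arity_ok (gate_kind g) #|gate_wire g|.
Proof.
rewrite /gate_kind; case: ifP => hin.
  case: insubP => [i _ _|]; last by case/and3P: hin => _ _ ->.
  apply/eqP/eq_card0 => h; rewrite -topredE /= /gate_wire /wires.
  by apply/negbTE; apply: contraL hin => /andP[/matrix_not_input ->].
case: ifP => //= _; case: ifP => //= /and3P[hm h0 h1].
have ne : gate_bit A0 g != gate_bit A1 g by rewrite h0 (negPf h1).
have /andP[p0 pn] := posP ne.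
have hp : (pos (hi g %% N) (lo g)).-1 < n by rewrite prednK.
have [hs _ _] := spreadP hp.
apply/eqP/(@eq_card1 _ (Ordinal (lt_ngates hs))) => h.
by rewrite -!topredE /= /gate_wire wiresE hm ne /= -val_eqE.
Qed.

Lemma wire_target g h : gate_wire g h -> is_matrix g /\ exists2 p, p < n & val h = spread p.
Proof.
rewrite /gate_wire wiresE => /and3P[hm ne /eqP e]; split=> //.
have /andP[p0 pn] := posP ne; exists (pos (hi g %% N) (lo g)).-1 => //.
by rewrite prednK.
Qed.

Lemma wire_sink g h k : gate_wire g h -> gate_wire h k = false.
Proof.
case/wire_target=> _ [p pn e]; apply/negbTE/negP => /wire_target[].
by rewrite e spread_not_matrix.
Qed.

Lemma gate_acyclic g h : gate_wire g h -> ~~ connect gate_wire h g.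
Proof.
move=> w; apply/negP => /connectP[[|k p] /=].
  by move=> _ e; subst h; move: (w); rewrite (wire_sink g w).
by rewrite (wire_sink k w).
Qed.

Lemma gate_N_lt : N < ngates.
Proof. by rewrite /ngates; have := N2; nia. Qed.
Lemma gate_N1_lt : N.+1 < ngates.
Proof. by rewrite /ngates; have := N2; nia. Qed.

Lemma gate_mx_lt (s : bool) (u v : 'I_N) : (s.+1 * N + u) * N + v < ngates.
Proof.
rewrite /ngates; have := ltn_ord u; have := ltn_ord v; move: (u : nat) (v : nat) => a b hb ha.
have h : s.+1 * N + a < 3 * N by case: s; lia.
apply: leq_trans (_ : (s.+1 * N + a).+1 * N <= _); last by rewrite leq_mul2r h orbT.
by rewrite mulSn addnC ltn_add2r.
Qed.

Definition gate_true := Ordinal gate_N_lt.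
Definition gate_false := Ordinal gate_N1_lt.
Definition gate_mx s u v := Ordinal (gate_mx_lt s u v).

Definition graph_gates (s : bool) : seq 'I_ngates :=
  nseq N gate_true ++ gate_false :: [seq gate_mx s u v | u : 'I_N <- enum 'I_N, v : 'I_N <- enum 'I_N].

Definition projection_circuit : circuit n :=
  Circuit (graph_gates false ++ graph_gates true) gate_arity gate_acyclic.

Lemma projection_depth : depth_le projection_circuit 1.
Proof.
move=> g [|h [|k p]] //= /and3P[w1 w2 _]; move: w2.
by rewrite (wire_sink k w1).
Qed.

Lemma size_graph_gates s : size (graph_gates s) = N + 1 + N * N.
Proof.
rewrite size_cat size_nseq /= size_allpairs size_enum_ord; lia.
Qed.

Lemma projection_size : circuit_size projection_circuit = 3 * N * N + 2 * (N + 1 + N * N).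
Proof. by rewrite /circuit_size /= size_cat !size_graph_gates; congr (_ + _); lia. Qed.

Section Value.
Variable x : n.-tuple bool.

Lemma gate_valueE k (g : 'I_ngates) : @gate_value _ projection_circuit x k.+1 g =
  match gate_kind g with
  | Input i => tnth x i
  | Not => ~~ [exists h, gate_wire g h && @gate_value _ projection_circuit x k h]
  | And => [forall h, gate_wire g h ==> @gate_value _ projection_circuit x k h]
  | Or => [exists h, gate_wire g h && @gate_value _ projection_circuit x k h]
  end.
Proof. by []. Qed.

Lemma value_input k p (g : 'I_ngates) : p < n -> val g = spread p ->
  @gate_value _ projection_circuit x k.+1 g = nth false x p.
Proof.
move=> pn e /=; have hin := spread_input pn; rewrite /gate_kind e hin.
have [_ _ ->] := spreadP pn; rewrite insubT /=.
by rewrite (tnth_nth false).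
Qed.

Lemma value_true k : @gate_value _ projection_circuit x k.+1 gate_true.
Proof.
rewrite /= /gate_kind; have -> : is_input gate_true = false.
  by rewrite /is_input /= /hi divnn N0.
rewrite /is_and eqxx /=; apply/forallP => h; rewrite /gate_wire /wires /is_matrix /hi /= divnn N0.
by rewrite leqNgt N2.
Qed.

Lemma value_false k : @gate_value _ projection_circuit x k.+1 gate_false = false.
Proof.
have h1 : hi N.+1 = 1 by rewrite /hi -addn1 divnDl ?dvdnn // divnn N0 divn_small.
have hm : is_matrix N.+1 = false by rewrite /is_matrix h1 leqNgt N2.
rewrite /= /gate_kind /is_input h1 /is_and /is_not hm /= -[_ == N]/(_ == _).
have -> : (N.+1 == N) = false by apply/eqP; lia.
by apply/existsP => -[h]; rewrite /gate_wire /wires /= hm.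
Qed.

Lemma hi_mx (s : bool) (u v : 'I_N) : hi (gate_mx s u v) = s.+1 * N + u.
Proof. by rewrite /hi /= divnMDl ?N0 // divn_small // addn0. Qed.
Lemma lo_mx (s : bool) (u v : 'I_N) : lo (gate_mx s u v) = v.
Proof. by rewrite /lo /= modnMDl modn_small. Qed.

Lemma gate_bit_mx A s (u v : 'I_N) : gate_bit A (gate_mx s u v) = A s u v.
Proof.
rewrite /gate_bit hi_mx lo_mx modnMDl modn_small //; congr A.
by have := ltn_ord u; case: s => /=; lia.
Qed.

Lemma value_mx k s (u v : 'I_N) : @gate_value _ projection_circuit x k.+2 (gate_mx s u v) =
  if nth false x (pos u v).-1 then A1 s u v else A0 s u v.
Proof.
have hm : is_matrix (gate_mx s u v) by rewrite /is_matrix hi_mx mulSn; lia.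
have hN : ((s.+1 * N + u) * N + v == N) = false.
  apply/negbTE/eqP => e; have := hi_mx s u v; rewrite /hi /= e divnn N0.
  have := N2; nia.
have hw (h : 'I_ngates) : gate_wire (gate_mx s u v) h =
    (A0 s u v != A1 s u v) && (val h == spread (pos u v).-1).
  by rewrite /gate_wire wiresE hm !gate_bit_mx hi_mx lo_mx modnMDl modn_small.
rewrite gate_valueE /gate_kind matrix_not_input // /is_and /is_not hm !gate_bit_mx hN.
case e0: (A0 s u v); case e1: (A1 s u v); cbn [andb orb negb]; rewrite ?if_same.
- by apply/forallP => h; rewrite hw e0 e1.
- have ne : A0 s u v != A1 s u v by rewrite e0 e1.
  have /andP[p0 pn] := posP ne; have hp : (pos u v).-1 < n by rewrite prednK.
  have [hs _ _] := spreadP hp.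
  rewrite -[if _ then _ else _]negbK; congr (~~ _).
  transitivity (nth false x (pos u v).-1); last by case: (nth _ _ _).
  apply/existsP/idP => [[h /andP[]]|hx].
    by rewrite hw => /andP[_ /eqP e]; rewrite (value_input k hp e).
  exists (Ordinal (lt_ngates hs)); rewrite hw ne eqxx andTb.
  by rewrite (value_input k hp).
- have ne : A0 s u v != A1 s u v by rewrite e0 e1.
  have /andP[p0 pn] := posP ne; have hp : (pos u v).-1 < n by rewrite prednK.
  have [hs _ _] := spreadP hp.
  transitivity (nth false x (pos u v).-1); last by case: (nth _ _ _).
  apply/existsP/idP => [[h /andP[]]|hx].
    by rewrite hw => /andP[_ /eqP e]; rewrite (value_input k hp e).
  exists (Ordinal (lt_ngates hs)); rewrite hw ne eqxx andTb.
  by rewrite (value_input k hp).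
by apply/existsP => -[h]; rewrite hw e0 e1.
Qed.

Definition output_bits (s : bool) : seq bool := nseq N true ++ false ::
  [seq if nth false x (pos u v).-1 then A1 s u v else A0 s u v | u : 'I_N <- enum 'I_N, v : 'I_N <- enum 'I_N].

Lemma projection_eval : circuit_eval projection_circuit x = output_bits false ++ output_bits true.
Proof.
have part m s : 1 < m ->
    [seq @gate_value _ projection_circuit x m g | g <- graph_gates s] = output_bits s.
  case: m => [|[|m]] // _; rewrite /graph_gates map_cat map_nseq map_cons (value_true m.+1) (value_false m.+1).
  congr (_ ++ _ :: _); rewrite map_allpairs.
  by apply: eq_allpairs => u v; apply: (value_mx m).
have h : 1 < ngates by rewrite /ngates; have := N2; nia.
by rewrite /circuit_eval map_cat; congr (_ ++ _); apply: part h.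
Qed.

End Value.

Lemma connection_gate (P : 'I_ngates -> bool) (Q : nat -> bool) a :
  (forall g, P g = Q (val g)) -> [exists g : 'I_ngates, (val g == a) && P g] = (a < ngates) && Q a.
Proof.
move=> h; apply/existsP/andP => [[g /andP[/eqP <-]]|[ha hq]]; first by rewrite h ltn_ord.
by exists (Ordinal ha); rewrite h eqxx.
Qed.

Lemma input_lt a : is_input a -> a < N.
Proof.
case/andP=> h _; move: h; rewrite /hi -leqn0 leqNgt divn_gt0 ?N0 // -ltnNge.
by [].
Qed.

Lemma and_not_input a : is_and a -> is_input a = false.
Proof.
case/orP=> [/eqP ->|/and3P[h _ _]]; last exact: matrix_not_input.
by rewrite /is_input /hi divnn N0.
Qed.

Lemma connection_QInput a b : connection projection_circuit QInput a b = is_input a && (inp a == b).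
Proof.
rewrite /connection (@connection_gate _ (fun a => is_input a && (inp a == b))).
  case h: (is_input a); last by rewrite andbF.
  by rewrite (lt_ngates (input_lt h)).
move=> g /=; rewrite /gate_kind; case: ifP => h /=; last by case: ifP => //; case: ifP.
by case: insubP => [i _ <-//|]; case/and3P: h => _ _ ->.
Qed.

Lemma connection_QNot a b : connection projection_circuit QNot a b = (a < ngates) && is_not a.
Proof.
apply: connection_gate => g /=; rewrite /gate_kind; case: ifP => h.
  rewrite /is_not; case: insubP => [i _ _|_]; by case: (boolP (is_matrix g)) => // /matrix_not_input; rewrite h.
case: ifP => h'; last by case: (is_not g).
case/orP: h' => [/eqP ->|/and3P[_ h0 h1]]; last by rewrite /is_not h1 !andbF.
by rewrite /is_not /is_matrix /hi divnn N0 leqNgt N2.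
Qed.

Lemma connection_QAnd a b : connection projection_circuit QAnd a b = (a < ngates) && is_and a.
Proof.
apply: connection_gate => g /=; rewrite /gate_kind; case: ifP => h.
  case h': (is_and g); first by rewrite (and_not_input h') in h.
  by case: insubP.
by case: (is_and g) => //; case: ifP.
Qed.

Lemma connection_QOr a b : connection projection_circuit QOr a b =
  (a < ngates) && [&& ~~ is_input a, ~~ is_and a & ~~ is_not a].
Proof.
apply: (@connection_gate _ (fun a => [&& ~~ is_input a, ~~ is_and a & ~~ is_not a])) => g /=.
rewrite /gate_kind; case: ifP => h /=.
  by case: insubP => // /negP[]; case/and3P: h.
by case: (is_and g) => //; case: (is_not g).
Qed.

Lemma connection_QWire a b : connection projection_circuit QWire a b = (a < ngates) && wires a b.
Proof.
apply: (@connection_gate _ (fun a => wires a b)) => g /=.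
apply/existsP/idP => [[h /andP[/eqP <-]] //|w].
have bN : b < N.
  move: w; case/and5P => _ _ h _ _; move: h; rewrite /hi -leqn0 leqNgt divn_gt0 ?N0 // -ltnNge.
  by [].
by exists (Ordinal (lt_ngates bN)); rewrite eqxx.
Qed.

Hypothesis N3 : 2 < N.

(** A graph code has [N + 1 + N^2] bits, so the matrix bit of index [b] belongs to the gate [a] with
    [b + N^2 = a + N + 1] in the first code and [b + N^2 = a + 2 N + 2] in the second. This is
    written in the digits base [N], with the carries spelled out. *)
Definition output_ok (a b : nat) : bool :=
  [|| [&& hi a == 1, lo a == 0 &
        [|| hi b == 0, (hi b == N + 1) && (0 < lo b) | (hi b == N + 2) && (lo b == 0)]],
      [&& hi a == 1, lo a == 1 & ((hi b == 1) && (lo b == 0)) || ((hi b == N + 2) && (lo b == 1))],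
      [&& N <= hi a, hi a < 2 * N &
        ((lo b == lo a + 1) && (hi b + N == hi a + 1)) ||
        [&& lo a + 1 == N, lo b == 0 & hi b + N == hi a + 2]] |
      [&& 2 * N <= hi a, hi a < 3 * N &
        ((lo b == lo a + 2) && (hi b + N == hi a + 2)) ||
        ((lo b + N == lo a + 2) && (hi b + N == hi a + 3))]].

(** Moves comparisons to the digits, where products with [N] disappear and linear arithmetic
    decides. *)
Lemma lex_eq x y x' y' : y < N -> y' < N -> (x * N + y == x' * N + y') = (x == x') && (y == y').
Proof.
move=> hy hy'; apply/eqP/andP => [e|[/eqP -> /eqP ->]] //.
have := congr1 (divn^~ N) e; have := congr1 (modn^~ N) e.
by rewrite !divnMDl ?N0 // !modnMDl !modn_small // !divn_small // !addn0 => -> ->.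
Qed.

Lemma lex_lt x y x' y' : y < N -> y' < N ->
  (x * N + y < x' * N + y') = (x < x') || ((x == x') && (y < y')).
Proof.
move=> hy hy'; case: (ltngtP x x') => [h|h|->] /=; last by rewrite ltn_add2l.
  have : x.+1 * N <= x' * N by rewrite leq_mul2r h orbT.
  by rewrite mulSn; lia.
have : x'.+1 * N <= x * N by rewrite leq_mul2r h orbT.
by rewrite mulSn; lia.
Qed.

Lemma allpairs_iota c m : [seq (c * N + u) * N + v | u <- iota 0 m, v <- iota 0 N] =
  iota (c * N * N) (m * N).
Proof.
elim: m => [|m IH]; first by rewrite mul0n.
rewrite -addn1 iotaD allpairs_cat IH allpairs1l add0n [(m + 1) * N]mulnDl mul1n iotaD.
by rewrite mulnDl -[in RHS](addn0 (_ + _)) iotaDl.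
Qed.

Lemma val_graph_gates s : [seq val g | g <- graph_gates s] =
  nseq N N ++ N.+1 :: iota (s.+1 * N * N) (N * N).
Proof.
rewrite map_cat map_nseq /= -allpairs_iota; congr (_ ++ _ :: _).
by rewrite map_allpairs -val_enum_ord allpairs_mapl allpairs_mapr.
Qed.

Lemma nth_part c i : i < N + 1 + N * N ->
  nth 0 (nseq N N ++ N.+1 :: iota (c * N * N) (N * N)) i =
  if i < N then N else if i == N then N.+1 else c * N * N + (i - N.+1).
Proof.
move=> hi; rewrite nth_cat size_nseq nth_nseq; case: ltnP => // h.
case: eqP => [->|ne]; first by rewrite subnn.
have -> : i - N = (i - N.+1).+1 by lia.
by rewrite /= nth_iota //; lia.
Qed.

Ltac output_case c :=
  move=> *; apply/idP/idP => [?|/or4P[] ?]; [ apply/or4P; apply c; lia | lia.. ].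

Lemma connection_QOutput a b : connection projection_circuit QOutput a b = output_ok a b.
Proof.
pose G := N + 1 + N * N.
pose out := if b < G then nth 0 (nseq N N ++ N.+1 :: iota (1 * N * N) (N * N)) b
            else nth 0 (nseq N N ++ N.+1 :: iota (2 * N * N) (N * N)) (b - G).
transitivity ((a < ngates) && ((b < 2 * G) && (out == a))).
  apply: (@connection_gate _ (fun a => (b < 2 * G) && (out == a))) => g /=.
  rewrite size_cat !size_graph_gates -/G (_ : G + G = 2 * G); last by lia.
  case: ltnP => //= hb; rewrite -val_eqE /= -(nth_map g 0 val); last first.
    by rewrite size_cat !size_graph_gates -/G; lia.
  rewrite map_cat !val_graph_gates nth_cat size_cat size_nseq /= size_iota.
  by rewrite /out (_ : N + (N * N).+1 = G) // /G; lia.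
have ea := divn_eq a N; have eb := divn_eq b N.
have la := ltn_pmod a N0; have lb := ltn_pmod b N0.
rewrite /output_ok /hi /lo.
move: (a %/ N) (a %% N) (b %/ N) (b %% N) ea eb la lb => ha xa hb xb ea eb la lb.
have L0 : 0 < N by exact: N0.
have L1 : 1 < N by [].
have cA : (a < ngates) = (ha < 3 * N).
  by rewrite ea -[ngates]addn0 lex_lt // ltn0 andbF orbF.
have cG : (b < G) = (hb < N + 1) || ((hb == N + 1) && (xb < 1)).
  by rewrite eb -lex_lt // /G mulnDl mul1n; congr (_ < _); lia.
have c2G : (b < 2 * G) = (hb < 2 * N + 2) || ((hb == 2 * N + 2) && (xb < 2)).
  by rewrite eb -lex_lt // /G; congr (_ < _); lia.
have aN : (N == a) = (ha == 1) && (xa == 0) by rewrite eq_sym ea -lex_eq // mul1n addn0.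
have aN1 : (N.+1 == a) = (ha == 1) && (xa == 1) by rewrite eq_sym ea -lex_eq // mul1n addn1.
have bN : (b < N) = (hb < 1) by rewrite eb -[RHS]orbF -[false](andbF (hb == 1)) -(ltn0 xb) -lex_lt // mul1n addn0.
have bE : (b == N) = (hb == 1) && (xb == 0) by rewrite eb -lex_eq // mul1n addn0.
have aeq c d : xa + d < N -> (ha + c) * N + (xa + d) = a + c * N + d by move=> _; rewrite ea mulnDl; lia.
have beq c : (hb + c) * N + xb = b + c * N by rewrite eb mulnDl; lia.
rewrite cA c2G /out; case: ifP => hG.
  rewrite nth_part //; rewrite bN bE; case: ifP => hb0.
    by rewrite aN; move: hG hb0; rewrite cG; clear -la lb L1 N3; output_case (Or41).
  case: ifP => hb1.
    by rewrite aN1; move: hG hb1; rewrite cG; clear -la lb L1 N3; output_case (Or42).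
  have -> : (1 * N * N + (b - N.+1) == a) = ((hb + N) * N + xb == a + N + 1).
    by rewrite beq; move: hb0; rewrite -bN; move: hb1; rewrite -bE; clear; lia.
  case: (ltnP (xa + 1) N) => hx.
    have -> : a + N + 1 = (ha + 1) * N + (xa + 1) by rewrite aeq //; lia.
    by rewrite lex_eq //; move: hG hb0 hb1; rewrite cG; clear -la lb L1 N3 hx; output_case (Or43).
  have -> : a + N + 1 = (ha + 2) * N + 0 by rewrite ea mulnDl; lia.
  by rewrite lex_eq //; move: hG hb0 hb1; rewrite cG; clear -la lb L1 N3 hx; output_case (Or43).
case hb2G : (b < 2 * G); last first.
  rewrite -c2G hb2G andbF; move: hb2G; rewrite c2G; clear -la lb L1 N3; move=> h; apply/esym/negbTE/negP => /or4P[] h'; lia.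
have hGb : G <= b by rewrite leqNgt hG.
rewrite nth_part; last by move: hb2G hGb; rewrite /G; clear; lia.
have -> : (b - G < N) = (hb < N + 2) || ((hb == N + 2) && (xb < 1)).
  by rewrite -lex_lt // -eb; move: hGb; rewrite /G mulnDl; clear; move=> *; apply/idP/idP => *; lia.
have -> : (b - G == N) = (hb == N + 2) && (xb == 1).
  by rewrite -lex_eq // -eb; move: hGb; rewrite /G mulnDl; clear; move=> *; apply/idP/idP => *; lia.
rewrite -c2G hb2G; case: ifP => hb0.
  by rewrite aN; move: hG hb0; rewrite cG; clear -la lb L1 N3; output_case (Or41).
case: ifP => hb1.
  by rewrite aN1; move: hG hb1; rewrite cG; clear -la lb L1 N3; output_case (Or42).
have hb2 : N + 2 < hb \/ (hb = N + 2 /\ 1 < xb) by move: hb0 hb1; clear; lia.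
have hbig : G + N.+1 <= b.
  have : (N + 2) * N + 2 <= b.
    rewrite leqNgt eb lex_lt //; move: hb2; clear; lia.
  by rewrite /G mulnDl; lia.
have -> : (2 * N * N + (b - G - N.+1) == a) = ((hb + N) * N + xb == a + 2 * N + 2).
  by rewrite beq; move: hbig; rewrite /G; clear; lia.
case: (ltnP (xa + 2) N) => hx.
  have -> : a + 2 * N + 2 = (ha + 2) * N + (xa + 2) by rewrite aeq //; lia.
  by rewrite lex_eq //; move: hG hb0 hb1; rewrite cG; clear -la lb L1 N3 hx; output_case (Or44).
have -> : a + 2 * N + 2 = (ha + 3) * N + (xa + 2 - N) by rewrite ea mulnDl; clear -hx; lia.
rewrite lex_eq //; last by clear -la N3; lia.
by move: hG hb0 hb1 hb2G; rewrite cG c2G; clear -la lb L1 N3 hx; output_case (Or44).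
Qed.

End ProjectionCircuit.

(** [xadj1] consults the A-link of its second record only if that has kind 3, and then the first has
    kind 2. So at most one of the two records contributes, and [z] does so only if it has kind 3. *)
Lemma xadj1_sel (l l' : xvert -> bool) b b' z z' :
  (if kd z == 3 then l z = l' z else l z' = l' z') ->
  xadj1 (l z') b' z z' || xadj1 (l z) b z' z = xadj1 (l' z') b' z z' || xadj1 (l' z) b z' z.
Proof.
have ind a a' c y y' : (kd y' == 3) = false -> xadj1 a c y y' = xadj1 a' c y y'.
  by move=> h; rewrite /xadj1 h /= !andbF.
case: eqP => [h e|/eqP/negPf h e].
  rewrite e; congr (_ || _); case: (boolP (kd z' == 3)) => h'; last exact: ind (negPf h').
  by rewrite /xadj1 h (eqP h').
by rewrite e; congr (_ || _); apply: ind.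
Qed.

Lemma conf_rel_bit M n b b' u v : ~~ (0 < cP u <= n) -> conf_rel M n b u v = conf_rel M n b' u v.
Proof.
move=> h; have hs a : sym_ok n b (cP u) a = sym_ok n b' (cP u) a.
  by case: a => [|c|] //=; rewrite !andbA (negPf h).
suff e : step_rel M n b u v = step_rel M n b' u v by rewrite /conf_rel e.
by rewrite /step_rel; do 5![apply: eq_existsb => ?]; apply: eq_has => a; rewrite hs.
Qed.

Section Spread.
Variables (L w n : nat).
Hypotheses (L0 : 0 < L) (nL : n < 2 ^ L).
Let K := 1 + w.
(** Bit [i] of an input index becomes the lowest bit of block [i], in step with the one position bit
    per block of a vertex, so that automata can compare the two. *)
Definition spread p := join L 1 w p 0.
Definition is_spread a := slice L K 1 w a == 0.
Definition unspread a := slice L K 0 1 a.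

Lemma spreadP p : p < n -> [/\ spread p < 2 ^ (K * L), is_spread (spread p) & unspread (spread p) = p].
Proof.
move=> hp; split; first exact: join_lt.
  by rewrite /is_spread slice_joinr // exp2_gt0.
by rewrite /unspread slice_joinl // mul1n (ltn_trans hp).
Qed.

Lemma spreadK a : a < 2 ^ (K * L) -> is_spread a -> spread (unspread a) = a.
Proof. move=> ha /eqP h; have := join_slices ha; rewrite -/K h; exact. Qed.

End Spread.

(** * The circuit of the reduction *)

Section Instance.
Variables (M : ntm) (be : nat).

Section Size.
Variable n : nat.
Let L := blocks n.
Let K := vert_width be.

(** The input enters only through the A-link stored in a middle vertex of kind 3, as B-links join
    names only. So a single head position decides an entry. *)
Definition sel_vert (u v : nat) : xvert :=
  let z := unpack_vert L be u in if kd z == 3 then z else unpack_vert L be v.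
Definition head_pos (u v : nat) : nat :=
  cP (unpack_conf L be (uu (unpack_cell L be (xu (sel_vert u v))))).

Lemma adj_num_sel s e e' u v : e (sel_vert u v) = e' (sel_vert u v) ->
  adj_num M be n s e u v = adj_num M be n s e' u v.
Proof.
rewrite /adj_num /sel_vert; cbv zeta.
move: (unpack_vert _ _ u) (unpack_vert _ _ v) => z z' h.
apply: (@xadj1_sel (fun z => link_num M be n s (e z) z) (fun z => link_num M be n s (e' z) z)).
by case: ifP h => _ ->.
Qed.

Definition adj_bit (b s : bool) (u v : nat) : bool := adj_num M be n s (edge_bit M be n b) u v.

Lemma adj_bit_pos s u v : adj_bit false s u v != adj_bit true s u v -> 0 < head_pos u v <= n.
Proof.
apply: contraR => h; apply/eqP; apply: adj_num_sel.
exact: conf_rel_bit.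
Qed.

Lemma nverts_gt2 : 2 < nverts be n.
Proof.
rewrite (@leq_trans (2 ^ 2)) // leq_exp2l // (@leq_trans (2 * 1)) // leq_mul //.
Qed.

Lemma n_lt : n < 2 ^ L.
Proof. exact: ltnW (blocks_gt n). Qed.

Let N := nverts be n.
Definition reduction_circuit : circuit n :=
  @projection_circuit N n (adj_bit false) (adj_bit true) head_pos
    (is_spread L K.-1) (unspread L K.-1) (spread L K.-1) (ltnW nverts_gt2)
    adj_bit_pos (@spreadP L K.-1 n n_lt) (fun a ha h _ => @spreadK L K.-1 a ha h).

End Size.

Section Eval.
Variable x : seq bool.
Let n := size x.
Let X s := gadget_graph M be n (input_edge M be x) s.

Lemma adj_input s u v : adj_num M be n (nat_of_bool s) (input_edge M be x) u v =
  if nth false x (head_pos n u v).-1 then adj_bit n true s u v else adj_bit n false s u v.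
Proof.
have e : input_edge M be x (sel_vert n u v) =
    edge_bit M be n (nth false x (head_pos n u v).-1) (sel_vert n u v) by [].
case: ifP e => _ e; exact: adj_num_sel e.
Qed.

Lemma reduction_eval : circuit_eval (reduction_circuit n) (in_tuple x) =
  encode_graph (X 0) ++ encode_graph (X 1).
Proof.
rewrite projection_eval.
have part (s : bool) : output_bits (nverts be n) (adj_bit n false) (adj_bit n true) (head_pos n) (in_tuple x) s =
    encode_graph (X s).
  congr (_ ++ _); congr (_ :: _); apply: eq_allpairs => u v; symmetry.
  exact: adj_input.
by rewrite (part false) (part true).
Qed.

End Eval.
End Instance.

(** The unary prefix gives the order and with it the length of the matrix, so the code can be cut
    off in one way only. *)
Lemma encode_graph_inj (X Y : graph) w w' : encode_graph X ++ w = encode_graph Y ++ w' ->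
  exists2 h : 'I_(order X) -> 'I_(order Y), bijective h &
    (forall u v, adj (h u) (h v) = adj u v) /\ w = w'.
Proof.
have lead m m' (r r' : seq bool) : nseq m true ++ false :: r = nseq m' true ++ false :: r' ->
    m = m' /\ r = r'.
  elim: m m' => [|m IH] [|m'] //= h; case: h => // h.
  by have [-> ->] := IH _ h.
rewrite /encode_graph -!catA !cat_cons => /lead[].
case: X Y => m a sa ia [m' a' sa' ia'] /= e; move: a sa ia; rewrite e => a sa ia {m e} E.
have [e1 e2] : [seq a u v | u <- enum 'I_m', v <- enum 'I_m'] =
    [seq a' u v | u <- enum 'I_m', v <- enum 'I_m'] /\ w = w'.
  have /eqP := E; rewrite eqseq_cat ?size_allpairs // => /andP[/eqP h /eqP h'].
  by split.
exists id; first by exists id.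
split=> // u v.
have e3 : [seq [seq a u v | v <- enum 'I_m'] | u <- enum 'I_m'] =
    [seq [seq a' u v | v <- enum 'I_m'] | u <- enum 'I_m'].
  apply: eq_from_flatten_shape; first exact: e1.
  rewrite /shape -!map_comp.
  by apply: eq_map => u' /=; rewrite !size_map.
by move/eq_in_map: e3 => /(_ u (mem_enum _ u)) /eq_in_map /(_ v (mem_enum _ v)) ->.
Qed.

(** * Regular languages and linear time *)

Section Regular.
Variable A : Type.

Definition regular (P : seq A -> bool) : Prop :=
  exists (Q : finType) (d : Q -> A -> Q) (q0 : Q) (F : pred Q),
    forall w, P w = F (foldl d q0 w).

Lemma regular_ext P P' : P =1 P' -> regular P -> regular P'.
Proof.
move=> e [Q [d [q0 [F h]]]]; exists Q, d, q0, F => w; by rewrite -e h.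
Qed.

Lemma regular_not P : regular P -> regular (fun w => ~~ P w).
Proof.
case=> Q [d [q0 [F h]]]; exists Q, d, q0, (predC F) => w /=; by rewrite h.
Qed.

Lemma regular_and P P' : regular P -> regular P' -> regular (fun w => P w && P' w).
Proof.
case=> Q [d [q0 [F h]]] [Q' [d' [q0' [F' h']]]].
exists (Q * Q')%type, (fun q a => (d q.1 a, d' q.2 a)), (q0, q0'),
  (fun q => F q.1 && F' q.2) => w.
rewrite h h'; suff -> : foldl (fun q a => (d q.1 a, d' q.2 a)) (q0, q0') w =
  (foldl d q0 w, foldl d' q0' w) by [].
by elim: w (q0) (q0') => //= a w IH p p'; rewrite IH.
Qed.

Lemma regular_or P P' : regular P -> regular P' -> regular (fun w => P w || P' w).
Proof.
move=> h h'; apply: (@regular_ext (fun w => ~~ (~~ P w && ~~ P' w))).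
  by move=> w; rewrite negb_and !negbK.
by apply/regular_not/regular_and; apply: regular_not.
Qed.

Lemma regular_const b : regular (fun _ => b).
Proof. by exists unit, (fun _ _ => tt), tt, (fun _ => b). Qed.

Lemma regular_if P P1 P2 : regular P -> regular P1 -> regular P2 ->
  regular (fun w => if P w then P1 w else P2 w).
Proof.
move=> h h1 h2; apply: (@regular_ext (fun w => P w && P1 w || ~~ P w && P2 w)).
  by move=> w; case: (P w); rewrite ?orbF.
by apply: regular_or; apply: regular_and => //; apply: regular_not.
Qed.

Lemma regular_eqb P P' : regular P -> regular P' -> regular (fun w => P w == P' w).
Proof.
move=> h h'; apply: (@regular_ext (fun w => if P w then P' w else ~~ P' w)).
  by move=> w; case: (P w); case: (P' w).
by apply: regular_if => //; apply: regular_not.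
Qed.

Lemma regular_has (I : Type) (s : seq I) (P : I -> seq A -> bool) :
  (forall i, regular (P i)) -> regular (fun w => has (fun i => P i w) s).
Proof.
move=> h; elim: s => [|i s IH] /=; first exact: regular_const.
exact: regular_or.
Qed.

Lemma regular_exists (I : finType) (P : I -> seq A -> bool) :
  (forall i, regular (P i)) -> regular (fun w => [exists i, P i w]).
Proof.
move=> h; apply: (@regular_ext (fun w => has (fun i => P i w) (enum I))).
  move=> w; apply/hasP/existsP => [[i _ Pi]|[i Pi]]; first by exists i.
  by exists i; rewrite ?mem_enum.
exact: regular_has.
Qed.

Definition track_val (b : nat) (f : A -> nat) (w : seq A) : nat :=
  foldr (fun a v => f a + b * v) 0 w.

(** The digits may exceed the base, which closes tracks under sums and constant multiples, but are
    bounded, which keeps the carries in [regular_leq] finite. *)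
Definition track (b : nat) (f : seq A -> nat) : Prop :=
  exists t : A -> nat, (exists c, forall a, t a <= c) /\ forall w, f w = track_val b t w.

Lemma trackD b f g : track b f -> track b g -> track b (fun w => f w + g w).
Proof.
case=> t [[c hc] h] [t' [[c' hc'] h']]; exists (fun a => t a + t' a); split.
  by exists (c + c') => a; apply: leq_add.
by move=> w; rewrite h h'; elim: w => //= a w <-; rewrite mulnDr; lia.
Qed.

Lemma trackM b f k : track b f -> track b (fun w => k * f w).
Proof.
case=> t [[c hc] h]; exists (fun a => k * t a); split.
  by exists (k * c) => a; rewrite leq_mul2l hc orbT.
by move=> w; rewrite h; elim: w => [|a w IH] /=; rewrite ?muln0 // -IH; nia.
Qed.

Lemma track0 b : track b (fun _ => 0).
Proof.
exists (fun _ => 0); split; first by exists 0.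
by elim=> //= a w <-; rewrite muln0.
Qed.

Lemma leq_mul_ceil (b x y : nat) : 0 < b -> (x <= b * y) = ((x + b.-1) %/ b <= y).
Proof.
move=> b0; rewrite -[RHS]ltnS ltn_divLR //; apply/idP/idP; nia.
Qed.

(* The state [s] stands for the goal [s + f w <= M + g w] on the remaining
   word; the carry stays in [0, 2M]. *)
Lemma regular_leq b f g c d : 1 < b -> track b f -> track b g ->
  regular (fun w => f w + c <= g w + d).
Proof.
move=> b1 [t [[cf hcf] hf]] [t' [[cg hcg] hg]].
pose M := (cf + cg + c + d).+1.
pose st (s : nat) (a : A) := ((s + t a + b * M - (M + t' a)) + b.-1) %/ b.
have bd s a : s <= M.*2 -> st s a <= M.*2.
  move=> hs; rewrite -leq_mul_ceil ?(ltnW b1) //.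
  have := hcf a; have := hcg a; rewrite /M; nia.
have key s w : s <= M.*2 ->
  (s + track_val b t w <= M + track_val b t' w) = (foldl st s w <= M).
  elim: w s => [|a w IH] s hs /=; first by rewrite !addn0.
  rewrite -IH; last exact: bd.
  rewrite /st addnC.
  have := hcf a; have := hcg a => h1 h2.
  set v := track_val b t w; set v' := track_val b t' w.
  set e := (_ + b * M - _).
  have he : e + (M + t' a) = s + t a + b * M by rewrite subnK // /M; nia.
  case: (leqP v (M + v')) => hv.
    have -> : ((e + b.-1) %/ b + v <= M + v') = ((e + b.-1) %/ b <= M + v' - v) by lia.
    rewrite -leq_mul_ceil ?(ltnW b1) // mulnBr.
    have hbv : b * v <= b * (M + v') by rewrite leq_mul2l hv orbT.
    rewrite mulnDr in hbv *; lia.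
  have -> : ((e + b.-1) %/ b + v <= M + v') = false.
    by apply/negbTE; rewrite -ltnNge (leq_trans hv) // leq_addl.
  have hbv : b * (M + v').+1 <= b * v by rewrite leq_mul2l hv orbT.
  rewrite mulnS mulnDr in hbv.
  suff : M + t' a < b * M + b by lia.
  rewrite /M; nia.
have hs0 : M + c - d <= M.*2 by rewrite /M; lia.
exists 'I_(M.*2.+1), (fun (s : 'I_(M.*2.+1)) a => inord (st s a)), (inord (M + c - d)),
  (fun s : 'I_(M.*2.+1) => s <= M) => w.
have -> : (f w + c <= g w + d) = (M + c - d + f w <= M + g w) by rewrite /M; lia.
rewrite hf hg key //.
have fE s w' : s <= M.*2 ->
    foldl (fun (s0 : 'I_(M.*2.+1)) a => inord (st s0 a)) (inord s) w' =
    foldl st s w' :> nat.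
  elim: w' s => [|a w' IH] s hs /=; first by rewrite inordK.
  by rewrite inordK // IH // bd.
by rewrite fE.
Qed.

Lemma regular_eqn b f g c d : 1 < b -> track b f -> track b g ->
  regular (fun w => f w + c == g w + d).
Proof.
move=> b1 hf hg; apply: (@regular_ext (fun w => (f w + c <= g w + d) && (g w + d <= f w + c))).
  by move=> w; rewrite eqn_leq.
by apply: regular_and; apply: (regular_leq _ _ b1).
Qed.

End Regular.

(** * A linear time machine running automata on blocks *)

Section BlockMachine.
Variables (K' : nat) (sl : bool).
Let K := K'.+1.

(* A tick shows the next high bits of a and b and, as long as they last, their
   next low bits and the current bit of n; the low part of a has K bits for every
   bit of n, that of b as well unless [sl], when it has one. *)
Definition low_bits : Type := (bool * bool * option bool)%type.
Definition tick : Type := (bool * bool * option low_bits)%type.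

Section Run.
Variables (Q : finType) (d : Q -> tick -> Q) (q0 : Q) (V : Q -> option bool).

Definition bm_sym : finType := option (bool + (bool * bool * option bool)).
Definition bm_state : finType := (('I_K + bool) + (Q + bool))%type.

Definition st_copy (c : 'I_K) : bm_state := inl (inl c).
(** The flag marks the first step, taken on the blank right of the copy; afterwards a blank on tape
    3 means its left end. *)
Definition st_rewind (first : bool) : bm_state := inl (inr first).
Definition st_run (q : Q) : bm_state := inr (inl q).
Definition st_halt (b : bool) : bm_state := inr (inr b).

Definition sym_bit (s : bm_sym) : bool := if s is Some (inl b) then b else false.
Definition sym_obit (s : bm_sym) : option bool := if s is Some (inl b) then Some b else None.
Definition sym_low (s : bm_sym) : option low_bits := if s is Some (inr z) then Some z else None.

Definition act4 (l : seq (bm_sym * move)) (i : 'I_4) : bm_sym * move :=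
  nth (None, Stay) l i.

(* First the low bits are copied to tape 3, while tape 0 (and tape 2 if [sl]) moves
   every K steps only; then tape 3 is rewound, and the automaton [d] reads it along
   with the remaining bits of tapes 1 and 2. *)
Definition bm_delta (q : bm_state) (h : {ffun 'I_4 -> bm_sym}) :
    bm_state * ('I_4 -> bm_sym * move) :=
  let s0 := h (inord 0) in let s1 := h (inord 1) in
  let s2 := h (inord 2) in let s3 := h (inord 3) in
  match q with
  | inl (inl c) =>
      (if c == ord_max then
         if s0 is None then st_rewind true else st_copy ord0
       else st_copy (inord c.+1),
       act4 [:: (s0, if c == ord_max then MoveRight else Stay); (s1, MoveRight);
                (s2, if sl && (c != ord_max) then Stay else MoveRight);
                (Some (inr (sym_bit s1, sym_bit s2, sym_obit s0)), MoveRight)])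
  | inl (inr true) =>
      (st_rewind false, act4 [:: (s0, Stay); (s1, Stay); (s2, Stay); (s3, MoveLeft)])
  | inl (inr false) =>
      if s3 is None then
        (st_run q0, act4 [:: (s0, Stay); (s1, Stay); (s2, Stay); (s3, MoveRight)])
      else
        (st_rewind false, act4 [:: (s0, Stay); (s1, Stay); (s2, Stay); (s3, MoveLeft)])
  | inr (inl q) =>
      let go := (st_run (d q (sym_bit s1, sym_bit s2, sym_low s3)),
        act4 [:: (s0, Stay); (s1, MoveRight); (s2, MoveRight); (s3, MoveRight)]) in
      if [&& s1 == None, s2 == None & s3 == None] then
        if V q is Some b then
          (st_halt b, act4 [:: (s0, Stay); (s1, Stay); (s2, Stay); (s3, Stay)])
        else go
      else go
  | inr (inr b) => (st_halt b, act4 [:: (s0, Stay); (s1, Stay); (s2, Stay); (s3, Stay)])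
  end.

Definition block_machine : dtm :=
  @DTM 4 bm_state bm_sym None (fun b => Some (inl b)) (st_copy ord0)
    (fun q => if q is inr (inr b) then Some b else None) bm_delta.

Notation M := block_machine.
Notation step := (@dstep M).

Definition fwd (t : tape bm_sym) (j : nat) : bm_sym := nth None (thead t :: tright t) j.

Lemma fwd_right t s j : fwd (tape_step None t s MoveRight) j = fwd t j.+1.
Proof. by case: t => l h [|x r]; case: j => [|j]; rewrite /fwd //= nth_nil. Qed.

Lemma fwd0 t : thead t = fwd t 0. Proof. by []. Qed.

Definition T4 (c : dconf M) (i : nat) : tape bm_sym := dc_tape c (inord i : 'I_4).

Lemma step_state (c : dconf M) : dverdict (dc_state c) = None ->
  dc_state (step c) = (bm_delta (dc_state c) [ffun i => thead (dc_tape c i)]).1.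
Proof. by move=> h; rewrite /dstep h. Qed.

Lemma step_tape (c : dconf M) i : dverdict (dc_state c) = None ->
  T4 (step c) i = let r := (bm_delta (dc_state c) [ffun i => thead (dc_tape c i)]).2 (inord i : 'I_4) in
    tape_step None (T4 c i) r.1 r.2.
Proof. by move=> h; rewrite /T4 /dstep h. Qed.

Lemma step_copy (c : dconf M) (k : 'I_K) : dc_state c = st_copy k ->
  let s0 := thead (T4 c 0) in let s1 := thead (T4 c 1) in let s2 := thead (T4 c 2) in
  [/\ dc_state (step c) = (if k == ord_max then
         if s0 is None then st_rewind true else st_copy ord0
       else st_copy (inord k.+1)),
    T4 (step c) 0 = tape_step None (T4 c 0) s0 (if k == ord_max then MoveRight else Stay),
    T4 (step c) 1 = tape_step None (T4 c 1) s1 MoveRight,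
    T4 (step c) 2 = tape_step None (T4 c 2) s2
      (if sl && (k != ord_max) then Stay else MoveRight) &
    T4 (step c) 3 = tape_step None (T4 c 3)
      (Some (inr (sym_bit s1, sym_bit s2, sym_obit s0))) MoveRight].
Proof.
move=> h /=; have hv : dverdict (dc_state c) = None by rewrite h.
by rewrite (step_state hv) !(step_tape _ hv) h /= !ffunE /act4 !inordK.
Qed.

Lemma step_rew (c : dconf M) b : dc_state c = st_rewind b ->
  let go := b || (thead (T4 c 3) != None) in
  [/\ dc_state (step c) = (if go then st_rewind false else st_run q0),
    forall i, i < 3 -> T4 (step c) i = T4 c i &
    T4 (step c) 3 = tape_step None (T4 c 3) (thead (T4 c 3))
      (if go then MoveLeft else MoveRight)].
Proof.
move=> h /=; have hv : dverdict (dc_state c) = None by rewrite h.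
rewrite (step_state hv) (step_tape _ hv) h /=.
have S i : i < 3 -> forall m, tape_step None (T4 c i) (act4 [::
  ([ffun i0 => thead (dc_tape c i0)] (inord 0 : 'I_4), Stay);
  ([ffun i0 => thead (dc_tape c i0)] (inord 1 : 'I_4), Stay);
  ([ffun i0 => thead (dc_tape c i0)] (inord 2 : 'I_4), Stay); m] (inord i)).1
   (act4 [::
  ([ffun i0 => thead (dc_tape c i0)] (inord 0 : 'I_4), Stay);
  ([ffun i0 => thead (dc_tape c i0)] (inord 1 : 'I_4), Stay);
  ([ffun i0 => thead (dc_tape c i0)] (inord 2 : 'I_4), Stay); m] (inord i)).2 = T4 c i.
  by case: i => [|[|[|//]]] _ m; rewrite /act4 inordK //= ffunE -/(T4 c _); case: (T4 c _).
rewrite !ffunE -/(T4 c 3); case: b h => h /=.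
  split=> // [i hi|]; last by rewrite /act4 inordK.
  by rewrite (step_tape _ hv) h /= S.
case e: (thead (T4 c 3)) => [x|] /=; split=> //; rewrite /act4 ?inordK //=.
  by move=> i hi; rewrite (step_tape _ hv) h /= ffunE -/(T4 c 3) e /= S.
by move=> i hi; rewrite (step_tape _ hv) h /= ffunE -/(T4 c 3) e /= S.
Qed.

Lemma step_run (c : dconf M) q : dc_state c = st_run q ->
  let s1 := thead (T4 c 1) in let s2 := thead (T4 c 2) in let s3 := thead (T4 c 3) in
  if [&& s1 == None, s2 == None & s3 == None] && (V q != None)
  then forall b, V q = Some b -> dc_state (step c) = st_halt b
  else dc_state (step c) = st_run (d q (sym_bit s1, sym_bit s2, sym_low s3)) /\
    forall i, 0 < i < 4 -> T4 (step c) i = tape_step None (T4 c i) (thead (T4 c i)) MoveRight.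
Proof.
move=> h /=; have hv : dverdict (dc_state c) = None by rewrite h.
have G i : 0 < i < 4 -> T4 (step c) i = let r := (bm_delta (dc_state c) [ffun i => thead (dc_tape c i)]).2 (inord i : 'I_4) in
    tape_step None (T4 c i) r.1 r.2 by move=> _; exact: step_tape.
rewrite (step_state hv); move: G; rewrite h /= !ffunE -/(T4 c _) -/(T4 c 2) -/(T4 c 3) -/(T4 c 1).
case: ifP => /= _ G.
  case e: (V q) G => [b|] G /=; first by move=> b' [->].
  split=> // i hi; rewrite G //.
  by case: i hi {G} => [|[|[|[|//]]]] //= _; rewrite /act4 inordK.
split=> // i hi; rewrite G //.
by case: i hi {G} => [|[|[|[|//]]]] //= _; rewrite /act4 inordK.
Qed.

Lemma iter_halt (c : dconf M) b m : dc_state c = st_halt b -> dc_state (iter m step c) = st_halt b.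
Proof.
move=> h; elim: m => [|m IH] //=; by rewrite /dstep IH /= IH.
Qed.

Lemma rewind_spec l (c : dconf M) x r : dc_state c = st_rewind false ->
  T4 c 3 = Tape l (Some x) r -> all (fun s => s != None) l ->
  let c' := iter (size l).+2 step c in
  [/\ dc_state c' = st_run q0, forall i, i < 3 -> T4 c' i = T4 c i &
    forall j, fwd (T4 c' 3) j = nth None (rev l ++ Some x :: r) j].
Proof.
elim: l c x r => [|y l IH] c x r hs ht hl /=.
  have [h1 h2 h3] := step_rew hs; move: h1 h3; rewrite ht /= => h1 h3.
  have [h1' h2' h3'] := step_rew h1; move: h1' h3'; rewrite h3 /= => h1' h3'.
  split=> // [i hi|j]; first by rewrite h2' // h2.
  by rewrite h3'.
have [h1 h2 h3] := step_rew hs; move: h1 h3; rewrite ht /= => h1 h3.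
case: y hl h3 ht => [y|//] /= hl h3 _.
have [] := IH _ _ _ h1 h3 hl; rewrite -!iterSr => e1 e2 e3; split=> // [i hi|j].
  by rewrite e2 // h2.
by rewrite e3 rev_cons cat_rcons.
Qed.

Section Input.
Variables n a b : nat.
Let L := size (binary n).
Let bits (x : nat) : seq bm_sym := [seq Some (inl y) | y <- binary x].

Definition low_at (t : nat) : low_bits :=
  (nth false (binary a) t, nth false (binary b) (if sl then t %/ K else t),
   onth (binary n) (t %/ K)).

Definition tick_at (t : nat) : tick :=
  (nth false (binary a) (K * L.+1 + t),
   nth false (binary b) ((if sl then L.+1 else K * L.+1) + t),
   if t < K * L.+1 then Some (low_at t) else None).

Let c0 := dinit M [:: binary n; binary a; binary b].

Lemma sym_bits x j : sym_bit (nth None (bits x) j) = nth false (binary x) j.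
Proof.
case: (ltnP j (size (binary x))) => h; first by rewrite (nth_map false).
by rewrite !nth_default // size_map.
Qed.

Lemma sym_obits x j : sym_obit (nth None (bits x) j) = onth (binary x) j.
Proof.
rewrite onthE; case: (ltnP j (size (binary x))) => h; last by rewrite !nth_default // size_map.
by rewrite !(nth_map false).
Qed.

Lemma bits_None x j : (nth None (bits x) j == None) = (size (binary x) <= j).
Proof.
case: (ltnP j (size (binary x))) => h; first by rewrite (nth_map false).
by rewrite nth_default // size_map.
Qed.

Let copied t := [seq Some (inr (low_at s)) : bm_sym | s <- iota 0 t].

Lemma copied_rcons t : copied t.+1 = rcons (copied t) (Some (inr (low_at t))).
Proof. by rewrite /copied -addn1 iotaD map_cat cats1. Qed.

Let copy_inv t (c : dconf M) :=
  [/\ forall j, fwd (T4 c 0) j = nth None (bits n) (t %/ K + j),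
      forall j, fwd (T4 c 1) j = nth None (bits a) (t + j),
      forall j, fwd (T4 c 2) j = nth None (bits b) ((if sl then t %/ K else t) + j) &
      T4 c 3 = Tape (rev (copied t)) None [::]].

Lemma fwd_tape_of w j : fwd (tape_of None w) j = nth None w j.
Proof. by case: w => [|x w]; case: j => [|j] //=; rewrite /fwd /= nth_nil. Qed.

Lemma divnS_mod t : t %% K = K' -> (t.+1 %/ K = (t %/ K).+1) * (t.+1 %% K = 0).
Proof.
move=> h; have e : t.+1 = (t %/ K).+1 * K by rewrite {1}(divn_eq t K) h mulSn addnC addSn.
by split; rewrite e ?mulnK ?modnMl.
Qed.

Lemma divnS_mod_neq t : t %% K != K' -> (t.+1 %/ K = t %/ K) * (t.+1 %% K = (t %% K).+1).
Proof.
move=> h; have hm := ltn_pmod t (ltn0Sn K' : 0 < K).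
have h1 : (t %% K).+1 < K by move: hm; rewrite /K !ltnS leq_eqVlt (negPf h).
have e : t.+1 = t %/ K * K + (t %% K).+1 by rewrite addnS -divn_eq.
split; first by rewrite e divnMDl // (divn_small h1) addn0.
by rewrite e modnMDl (modn_small h1).
Qed.

Lemma ord_max_mod t : ((inord (t %% K) : 'I_K) == ord_max) = (t %% K == K').
Proof. by rewrite -val_eqE /= inordK ?ltn_pmod. Qed.

Lemma copy_step t (c : dconf M) : dc_state c = st_copy (inord (t %% K)) -> copy_inv t c ->
  dc_state (step c) = (if t %% K == K' then
     if nth None (bits n) (t %/ K) is None then st_rewind true else st_copy ord0
     else st_copy (inord (t %% K).+1)) /\ copy_inv t.+1 (step c).
Proof.
move=> hs [i0 i1 i2 i3]; have [] := step_copy hs; rewrite ord_max_mod.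
rewrite !fwd0 i0 i1 i2 !addn0 => e0 f0 f1 f2 f3; split.
  by rewrite e0 inordK ?ltn_pmod.
split=> [j|j|j|].
- rewrite f0; case: ifP => hk.
    by rewrite fwd_right i0 divnS_mod ?(eqP hk) // addnS addSn.
  rewrite divnS_mod_neq ?hk //; case: (T4 c 0) i0 {f0} => l x r /= i0.
  by rewrite -i0 -(addn0 (_ %/ _)) -i0.
- by rewrite f1 fwd_right i1 addnS addSn.
- rewrite f2; case: (sl) i2 => /= i2; last by rewrite fwd_right i2 addnS addSn.
  case: ifP => hk.
    rewrite divnS_mod_neq //; case: (T4 c 2) i2 {f2} => l x r /= i2.
    by rewrite -i2 -(addn0 (_ %/ _)) -i2.
  by rewrite fwd_right i2 divnS_mod ?(eqP (negbFE hk)) // addnS addSn.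
by rewrite f3 i3 /= copied_rcons rev_rcons !sym_bits sym_obits.
Qed.

Lemma copy_phase t : t < K * L.+1 ->
  dc_state (iter t step c0) = st_copy (inord (t %% K)) /\ copy_inv t (iter t step c0).
Proof.
elim: t => [|t IH] ht.
  rewrite mod0n /=; split; first by congr (inl (inl _)); apply: val_inj; rewrite /= inordK.
  by split=> [j|j|j|]; rewrite ?if_same ?div0n /T4 /= inordK // fwd_tape_of.
have [hs [i0 i1 i2 i3]] := IH (ltnW ht).

rewrite iterS; move: (iter t step c0) hs i0 i1 i2 i3 => c hs i0 i1 i2 i3.
have [e1 e2] := copy_step hs (And4 i0 i1 i2 i3).
split=> //; rewrite e1; case: ifP => [/eqP hk|/negbT hk].
  have h1 : (t %/ K).+1 < L.+1 by rewrite -(divnS_mod hk).1 ltn_divLR // mulnC.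
  case: (nth None (bits n) (t %/ K)) (bits_None n (t %/ K)) => [x _|].
    by rewrite (divnS_mod hk).2; congr (inl (inl _)); apply: val_inj; rewrite /= inordK.
  by rewrite eqxx => /esym; rewrite leqNgt -/L -ltnS h1.
by rewrite (divnS_mod_neq hk).2.
Qed.

Lemma copied_all t : all (fun s => s != None) (rev (copied t)).
Proof. by rewrite all_rev; apply/allP => x /mapP[y _ ->]. Qed.

Let N := K * L.+1.

Lemma rewound : exists2 c : dconf M, c = iter (N.*2 + 2) step c0 &
  [/\ dc_state c = st_run q0,
      forall j, fwd (T4 c 1) j = nth None (bits a) (N + j),
      forall j, fwd (T4 c 2) j = nth None (bits b) ((if sl then L.+1 else N) + j) &
      forall j, fwd (T4 c 3) j = nth None (copied N) j].
Proof.
have N0 : 0 < N by rewrite muln_gt0.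
have hN : N.-1 < K * L.+1 by rewrite prednK.
have [hs hi] := copy_phase hN; have [] := copy_step hs hi.
have hNm : N.-1 %% K = K'.
  have -> : N.-1 = L * K + K' by rewrite /N /K; lia.
  by rewrite modnMDl modn_small.
have hNd : N.-1 %/ K = L.
  have -> : N.-1 = L * K + K' by rewrite /N /K; lia.
  by rewrite divnMDl // divn_small // addn0.
(* The cell after the last bit of [n] is blank, which ends the copying exactly at the end of a
   block. *)
have /eqP hb : nth None (bits n) L == None by rewrite bits_None leqnn.
rewrite hNm hNd eqxx prednK // hb => e1.
rewrite /copy_inv mulKn // => -[_ i1 i2 i3].
have [s1 s2 s3] := step_rew e1; rewrite orTb in s1 s3.
have e : rev (copied N) = Some (inr (low_at N.-1)) :: rev (copied N.-1).
  by rewrite -{1}(prednK N0) copied_rcons rev_rcons.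
rewrite i3 e /= in s3.
have [r1 r2 r3] := rewind_spec s1 s3 (copied_all _).
exists (iter (size (rev (copied N.-1))).+2 step (iter 2 step (iter N.-1 step c0))).
  have -> : N.*2 + 2 = (size (rev (copied N.-1))).+2 + (2 + N.-1).
    by rewrite size_rev size_map size_iota; lia.
  by rewrite 2!iterD.
split=> // [j|j|j].
- by rewrite r2 // s2.
- by rewrite r2 // s2.
have er : rev (rev (copied N.-1)) ++ [:: Some (inr (low_at N.-1)), None & [::]] = rcons (copied N) None.
  by rewrite revK -{2}(prednK N0) copied_rcons -!cats1 -catA.
rewrite r3 er nth_rcons; case: ltnP => // h.
by rewrite [RHS]nth_default // if_same.
Qed.

Definition ticks t := [seq tick_at s | s <- iota 0 t].

Lemma ticksS t : ticks t.+1 = rcons (ticks t) (tick_at t).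
Proof. by rewrite /ticks -addn1 iotaD map_cat cats1. Qed.

Definition blank_at t := [&& size (binary a) <= N + t,
  size (binary b) <= (if sl then L.+1 else N) + t & N <= t].

Lemma nth_copied t : nth None (copied N) t = if t < N then Some (inr (low_at t)) else None.
Proof.
case: ltnP => h; last by rewrite nth_default // size_map size_iota.
by rewrite (nth_map 0) ?size_iota // nth_iota.
Qed.

Lemma run_spec (c : dconf M) T v : dc_state c = st_run q0 ->
  (forall j, fwd (T4 c 1) j = nth None (bits a) (N + j)) ->
  (forall j, fwd (T4 c 2) j = nth None (bits b) ((if sl then L.+1 else N) + j)) ->
  (forall j, fwd (T4 c 3) j = nth None (copied N) j) ->
  (forall t, t < T -> blank_at t -> V (foldl d q0 (ticks t)) = None) ->
  blank_at T -> V (foldl d q0 (ticks T)) = Some v ->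
  dc_state (iter T.+1 step c) = st_halt v.
Proof.
move=> hs i1 i2 i3 hT bT vT.
have key t : t <= T ->
  [/\ dc_state (iter t step c) = st_run (foldl d q0 (ticks t)),
    forall j, fwd (T4 (iter t step c) 1) j = nth None (bits a) (N + t + j),
    forall j, fwd (T4 (iter t step c) 2) j = nth None (bits b) ((if sl then L.+1 else N) + t + j) &
    forall j, fwd (T4 (iter t step c) 3) j = nth None (copied N) (t + j)].
  elim: t => [_|t IH ht]; first by split=> // j; rewrite addn0.
  have [e j1 j2 j3] := IH (ltnW ht); have := step_run e; cbv zeta.
  rewrite !fwd0 j1 j2 j3 !addn0 !bits_None !sym_bits.
  have -> : (nth None (copied N) t == None) = (N <= t).
    by rewrite nth_copied; case: ltnP.
  rewrite -/(blank_at t).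
  case: ifP => [/andP[bt]|_ [e1 e2]]; first by rewrite hT.
  split=> [|j|j|j].
  - rewrite iterS e1 ticksS foldl_rcons; congr (st_run (d _ _)).
    by rewrite /tick_at nth_copied -/N; case: ltnP.
  - by rewrite iterS e2 // fwd_right j1; congr (nth None _ _); lia.
  - by rewrite iterS e2 // fwd_right j2; congr (nth None _ _); lia.
  - by rewrite iterS e2 // fwd_right j3; congr (nth None _ _); lia.
have [e j1 j2 j3] := key T (leqnn T); have := step_run e; cbv zeta.
rewrite !fwd0 j1 j2 j3 !addn0 !bits_None.
have -> : (nth None (copied N) T == None) = (N <= T).
  by rewrite nth_copied; case: ltnP.
by rewrite -/(blank_at T) bT vT /=; apply.
Qed.

Lemma halts T v : (forall t, t < T -> blank_at t -> V (foldl d q0 (ticks t)) = None) ->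
  blank_at T -> V (foldl d q0 (ticks T)) = Some v ->
  forall m, N.*2 + 3 + T <= m -> dverdict (dc_state (iter m step c0)) = Some v.
Proof.
move=> hT bT vT m hm; have [c hc [e i1 i2 i3]] := rewound.
have e' := run_spec e i1 i2 i3 hT bT vT.
have -> : m = m - (N.*2 + 3 + T) + (T.+1 + (N.*2 + 2)) by lia.
by rewrite iterD [iter (T.+1 + _) _ _]iterD -hc (iter_halt _ e').
Qed.

End Input.
End Run.

Definition block_at n a b i : seq tick := mkseq (fun j => tick_at n a b (K * i + j)) K.
Definition input_word n a b m : seq (seq tick) := mkseq (block_at n a b) m.

Section Blocks.
Variables (Q : finType) (d : Q -> seq tick -> Q) (q0 : Q) (F : pred Q).

Definition buffer : finType := (Q * K'.-bseq tick)%type.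

Definition buf_step (q : buffer) (x : tick) : buffer :=
  if size q.2 == K' then (d q.1 (rcons q.2 x), [bseq])
  else (q.1, insub_bseq K' (rcons q.2 x)).

(** Answering only between blocks makes the machine complete the last block, whose missing bits read
    as false. *)
Definition buf_out (q : buffer) : option bool :=
  if size q.2 == 0 then Some (F q.1) else None.

Lemma buf_run n a b t : let q := foldl buf_step (q0, [bseq]) (ticks n a b t) in
  q.1 = foldl d q0 (input_word n a b (t %/ K)) /\
  q.2 = mkseq (fun j => tick_at n a b (K * (t %/ K) + j)) (t %% K) :> seq tick.
Proof.
elim: t => [|t]; first by rewrite div0n mod0n.
cbv zeta.
rewrite ticksS foldl_rcons.
case: (foldl _ _ _) => q u /= [h1 h2].
have hm := ltn_pmod t (ltn0Sn K' : 0 < K).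
rewrite /buf_step /= h2 size_mkseq.
have e : rcons (mkseq (fun j => tick_at n a b (K * (t %/ K) + j)) (t %% K)) (tick_at n a b t) =
    mkseq (fun j => tick_at n a b (K * (t %/ K) + j)) (t %% K).+1.
  rewrite [in RHS]/mkseq -addn1 iotaD map_cat cats1 /= add0n; congr rcons.
  by congr tick_at; rewrite mulnC -divn_eq.
case: eqP => [hk|/eqP hk] /=.
  rewrite !(divnS_mod hk) e hk; split=> //.
  rewrite /input_word /mkseq -[in RHS]addn1 iotaD map_cat foldl_cat /= add0n -h1.
  by [].
rewrite !(divnS_mod_neq hk) e; split=> //.
rewrite /insub_bseq insubdK // unfold_in size_mkseq.
by move: hm; rewrite /K ltnS leq_eqVlt (negPf hk).
Qed.

End Blocks.

(** The machine stops after the least number of blocks that exhausts its tapes; therefore [P] has to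
    be right for every sufficiently large [m]. *)
Theorem linear_time_regular (P : seq (seq tick) -> bool) (R : nat -> nat -> nat -> bool) :
  regular P ->
  (forall n a b m, (size (binary n)).+1 <= m ->
    size (binary a) <= K * (size (binary n)).+1 + K * m ->
    size (binary b) <= (if sl then 1 else K) * (size (binary n)).+1 + K * m ->
    P (input_word n a b m) = R n a b) ->
  linear_time R.
Proof.
case=> Q [d [q0 [F hP]]] hR.
(* With [L] blocks, copying, rewinding and the run take [2 K L + 3 + K m] steps in all, where [m] is
   at most [L] plus the sizes of [a] and [b]. *)
exists (@block_machine (buffer Q) (buf_step d) (q0, [bseq]) (buf_out F)), (4 * K + 4) => n a b ws t.
pose L := (size (binary n)).+1.
have ex : exists m, blank_at n a b (K * m).
  exists (L + size (binary a) + size (binary b)).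
  by rewrite /blank_at -/L; case: (sl); rewrite /K; apply/and3P; split; nia.
case: (ex_minnP ex) => m hm min.
have := hm; rewrite /blank_at => /and3P[hma hmb]; rewrite leq_pmul2l // => hml.
have hout s : buf_out F (foldl (buf_step d) (q0, [bseq]) (ticks n a b s)) =
    if s %% K == 0 then Some (P (input_word n a b (s %/ K))) else None.
  have [h1 h2] := buf_run d q0 n a b s.
  by rewrite /buf_out h2 size_mkseq h1 hP.
have mb : m <= L + size (binary a) + size (binary b).
  apply: min; rewrite /blank_at -/L; case: (sl); rewrite /K; apply/and3P; split; nia.
apply: (@halts _ _ _ _ n a b (K * m)) => //.
- move=> s hs bs; rewrite hout; case: eqP => // /eqP; rewrite -/(dvdn _ _) => /dvdnP[c hc].
  have : m <= c by apply: min; rewrite mulnC -hc.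
  by move: hs; rewrite hc mulnC ltn_pmul2l // ltnNge => /negbTE ->.
- rewrite hout modnMr eqxx mulKn // hR //.
  by move: hmb; case: (sl); rewrite ?mul1n.
rewrite /t -/L; nia.
Qed.

End BlockMachine.

(** * Uniformity *)

Lemma bits_binary y t : nth false (binary y) t = odd (y %/ 2 ^ t).
Proof.
rewrite /binary; case: (ltnP t (up_log 2 y.+1)) => h; first by rewrite nth_mkseq.
rewrite nth_default ?size_mkseq // divn_small //.
by apply: leq_trans (up_logP _ (ltnSn 1)) _; rewrite leq_exp2l.
Qed.

Lemma size_binary_lt y : y < 2 ^ size (binary y).
Proof. by rewrite size_mkseq; apply: up_logP. Qed.

Lemma track_val_mkseq (A : Type) b (t : A -> nat) (g : nat -> A) m :
  track_val b t (mkseq g m) = from_digits b m (fun i => t (g i)).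
Proof.
elim: m g => [|m IH] g; first by rewrite /from_digits big_ord0.
rewrite from_digitsS -(IH (fun i => g i.+1)) /mkseq /= -[1]/(0.+1).
by rewrite (iotaDl 1 0) -map_comp.
Qed.

Lemma from_digits_ext b L d d' : (forall i, i < L -> d i = d' i) ->
  from_digits b L d = from_digits b L d'.
Proof. by move=> h; rewrite /from_digits; apply: eq_bigr => i _; rewrite h. Qed.

Lemma from_digits_widen b L m d : L <= m -> (forall i, L <= i -> i < m -> d i = 0) ->
  from_digits b m d = from_digits b L d.
Proof.
move=> hL h; rewrite /from_digits [RHS](big_ord_widen_cond m predT (fun i => b ^ i * d i)) //.
rewrite [RHS]big_mkcond; apply: eq_bigr => i _; rewrite /=.
by case: ltnP => hi //; rewrite h // muln0.
Qed.

(** * Numbers read off the blocks *)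

Definition tick0 : tick := (false, false, None).
Definition hi_a (x : tick) : bool := x.1.1.
Definition hi_b (x : tick) : bool := x.1.2.
Definition lo_a (x : tick) : bool := if x.2 is Some y then y.1.1 else false.
Definition lo_b (x : tick) : bool := if x.2 is Some y then y.1.2 else false.
Definition bit_n (x : tick) : bool := if x.2 is Some y then odflt false y.2 else false.
Definition in_low (x : tick) : bool := isSome x.2.

Definition digit (f : tick -> bool) (o w : nat) (s : seq tick) : nat :=
  \sum_(j < w) 2 ^ j * f (nth tick0 s (o + j)).

Definition low_block (s : seq tick) : bool := in_low (nth tick0 s 0).

Lemma digit_lt f o w s : digit f o w s < 2 ^ w.
Proof.
rewrite /digit; elim: w => [|w IH]; first by rewrite big_ord0.
rewrite big_ord_recr /= expnS; have : f (nth tick0 s (o + w)) <= 1 by case: (f _).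
move: (2 ^ w) (f _ : nat) (\sum_(_ < _) _) IH => a c e; nia.
Qed.

Lemma track_digit f o w : track (2 ^ w) (track_val (2 ^ w) (digit f o w)).
Proof. by exists (digit f o w); split=> //; exists (2 ^ w) => s; apply: ltnW (digit_lt _ _ _ _). Qed.

(** Cutting the high part off after the low blocks reduces it modulo the number of vertices, as the
    row index of an entry requires. *)
Definition hi_digit o w s := if low_block s then digit hi_a o w s else 0.
(** Gives the bounds [2^(w L) - 1], which depend on [n] only through the number of blocks. *)
Definition ones w s := if low_block s then (2 ^ w).-1 else 0.

Lemma track_hi o w : track (2 ^ w) (track_val (2 ^ w) (hi_digit o w)).
Proof.
exists (hi_digit o w); split=> //; exists (2 ^ w) => s; rewrite /hi_digit.
by case: ifP => _ //; apply: ltnW (digit_lt _ _ _ _).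
Qed.

Lemma track_ones w : track (2 ^ w) (track_val (2 ^ w) (ones w)).
Proof. by exists (ones w); split=> //; exists (2 ^ w) => s; rewrite /ones; case: ifP => // _; apply: leq_pred. Qed.

Section Readers.
Variables (K' : nat) (sl : bool).
Let K := K'.+1.

Section Values.
Variables n a b m : nat.
Let L := (size (binary n)).+1.
Hypothesis Lm : L <= m.
Let W := input_word K' sl n a b m.

Lemma nth_block i j : j < K -> nth tick0 (block_at K' sl n a b i) j = tick_at K' sl n a b (K * i + j).
Proof. by move=> h; rewrite nth_mkseq. Qed.

Lemma block_low i j : j < K -> (K * i + j < K * L) = (i < L).
Proof.
move=> hj; apply/idP/idP => h; last first.
  by apply: leq_trans (_ : K * i.+1 <= _); rewrite ?leq_mul2l ?h ?orbT // mulnS; lia.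
by rewrite -(ltn_pmul2l (ltn0Sn K' : 0 < K)); apply: leq_ltn_trans h; rewrite leq_addr.
Qed.

Lemma sum_bits y s w : \sum_(j < w) 2 ^ j * odd (y %/ 2 ^ (s + j)) = y %/ 2 ^ s %% 2 ^ w.
Proof. by rewrite modn_bits; apply: eq_bigr => j _; rewrite expnD divnMA. Qed.

Lemma low_blockE i : low_block (block_at K' sl n a b i) = (i < L).
Proof. by rewrite /low_block nth_block // -(block_low i (ltn0Sn K')) /in_low /tick_at /=; case: ifP. Qed.

Lemma lo_a_val o w : o + w <= K -> track_val (2 ^ w) (digit lo_a o w) W = slice L K o w a.
Proof.
move=> h; rewrite track_val_mkseq (from_digits_widen _ Lm).
  apply: from_digits_ext => i hi; rewrite -sum_bits; apply: eq_bigr => j _.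
  have hj : o + j < K by apply: leq_trans h; rewrite ltn_add2l.
  by rewrite nth_block // /lo_a /tick_at /= block_low // hi /= bits_binary addnA.
move=> i hi _; rewrite /digit big1 // => j _.
have hj : o + j < K by apply: leq_trans h; rewrite ltn_add2l.
by rewrite nth_block // /lo_a /tick_at /= block_low // ltnNge hi /= muln0.
Qed.

Lemma lo_b_val o w : sl = false -> o + w <= K -> track_val (2 ^ w) (digit lo_b o w) W = slice L K o w b.
Proof.
move=> hsl h; rewrite track_val_mkseq (from_digits_widen _ Lm).
  apply: from_digits_ext => i hi; rewrite -sum_bits; apply: eq_bigr => j _.
  have hj : o + j < K by apply: leq_trans h; rewrite ltn_add2l.
  by rewrite nth_block // /lo_b /tick_at /= block_low // hi /= hsl bits_binary addnA.
move=> i hi _; rewrite /digit big1 // => j _.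
have hj : o + j < K by apply: leq_trans h; rewrite ltn_add2l.
by rewrite nth_block // /lo_b /tick_at /= block_low // ltnNge hi /= muln0.
Qed.

Lemma hi_a_val o w : o + w <= K ->
  track_val (2 ^ w) (hi_digit o w) W = slice L K o w (a %/ 2 ^ (K * L)).
Proof.
move=> h; rewrite track_val_mkseq (from_digits_widen _ Lm).
  apply: from_digits_ext => i hi; rewrite /hi_digit low_blockE hi -sum_bits; apply: eq_bigr => j _.
  have hj : o + j < K by apply: leq_trans h; rewrite ltn_add2l.
  by rewrite nth_block // /hi_a /tick_at /= bits_binary expnD divnMA addnA.
by move=> i hi _; rewrite /hi_digit low_blockE ltnNge hi.
Qed.

Lemma hi_full (f : tick -> bool) y :
  (forall t, f (tick_at K' sl n a b t) = odd (y %/ 2 ^ t)) -> y < 2 ^ (K * m) ->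
  track_val (2 ^ K) (digit f 0 K) W = y.
Proof.
move=> hf hy; rewrite expnM in hy; rewrite track_val_mkseq -[RHS](from_digitsK (exp2_gt0 K) hy).
apply: from_digits_ext => i hi; rewrite -expnM -sum_bits; apply: eq_bigr => j _.
have hj : 0 + j < K by exact: ltn_ord.
by rewrite nth_block // hf.
Qed.

Lemma hi_a_full : size (binary a) <= K * L + K * m ->
  track_val (2 ^ K) (digit hi_a 0 K) W = a %/ 2 ^ (K * L).
Proof.
move=> h; apply: hi_full => [t|].
  by rewrite /hi_a /tick_at /= bits_binary expnD divnMA.
rewrite ltn_divLR ?exp2_gt0 // -expnD; apply: leq_trans (size_binary_lt a) _.
by rewrite leq_exp2l // addnC.
Qed.

Lemma hi_b_full : size (binary b) <= (if sl then 1 else K) * L + K * m ->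
  track_val (2 ^ K) (digit hi_b 0 K) W = b %/ 2 ^ ((if sl then 1 else K) * L).
Proof.
move=> h; apply: hi_full => [t|].
  by rewrite /hi_b /tick_at /= bits_binary expnD divnMA; case: (sl); rewrite ?mul1n.
rewrite ltn_divLR ?exp2_gt0 // -expnD; apply: leq_trans (size_binary_lt b) _.
by rewrite leq_exp2l // addnC.
Qed.

Lemma n_val : track_val 2 (digit bit_n 0 1) W = n.
Proof.
have hn : n < 2 ^ L by apply: leq_trans (size_binary_lt n) _; rewrite leq_exp2l.
rewrite track_val_mkseq (from_digits_widen _ Lm).
  rewrite -[RHS](from_digitsK (ltn0Sn 1) hn); apply: from_digits_ext => i hi.
  rewrite /digit big_ord1 expn0 mul1n addn0 nth_block // modn2 -bits_binary.
  rewrite /bit_n /tick_at /= block_low // hi /= addn0 mulKn //.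
  by congr nat_of_bool; rewrite -(odflt_onth false); case: onth.
move=> i hi _; rewrite /digit big_ord1 nth_block // /bit_n /tick_at /= block_low //.
by rewrite ltnNge hi.
Qed.

Lemma slow_b_val : sl = true -> track_val 2 (digit lo_b 0 1) W = b %% 2 ^ L.
Proof.
move=> hsl; have hb : b %% 2 ^ L < 2 ^ L by rewrite ltn_pmod ?exp2_gt0.
rewrite track_val_mkseq (from_digits_widen _ Lm).
  rewrite -[RHS](from_digitsK (ltn0Sn 1) hb); apply: from_digits_ext => i hi.
  rewrite /digit big_ord1 expn0 mul1n addn0 nth_block //.
  rewrite /lo_b /tick_at /= block_low // hi /= addn0 mulKn // hsl bits_binary.
  rewrite -modn2; have := @mod_div_mod b i 1 L; rewrite addn1 hi => /(_ isT).
  by rewrite expn1 => ->.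
move=> i hi _; rewrite /digit big_ord1 nth_block // /lo_b /tick_at /= block_low //.
by rewrite ltnNge hi.
Qed.

Lemma ones_val w : track_val (2 ^ w) (ones w) W = (2 ^ (w * L)).-1.
Proof.
rewrite track_val_mkseq (from_digits_widen _ Lm); last first.
  by move=> i hi _; rewrite /ones low_blockE ltnNge hi.
rewrite (@from_digits_ext _ _ _ (fun=> (2 ^ w).-1)) => [|i hi]; last by rewrite /ones low_blockE hi.
rewrite expnM; elim: (L) => [|k IH]; first by rewrite /from_digits big_ord0.
rewrite from_digitsS IH expnS; have := exp2_gt0 w.
have : 0 < (2 ^ w) ^ k by rewrite expn_gt0 exp2_gt0.
by move: ((2 ^ w) ^ k) (2 ^ w) => x y; nia.
Qed.

End Values.
End Readers.

Section Atoms.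
Variables (A : Type) (b : nat) (f g : seq A -> nat).
Hypotheses (b1 : 1 < b) (hf : track b f) (hg : track b g).

Lemma regular_eqc c : regular (fun w => f w == c).
Proof.
by apply: regular_ext (regular_eqn 0 c b1 hf (track0 _ b)) => w; rewrite addn0.
Qed.

Lemma regular_eq_addc c : regular (fun w => f w == g w + c).
Proof. by apply: regular_ext (regular_eqn 0 c b1 hf hg) => w; rewrite addn0. Qed.

Lemma regular_eq : regular (fun w => f w == g w).
Proof. by apply: regular_ext (regular_eqn 0 0 b1 hf hg) => w; rewrite !addn0. Qed.

Lemma regular_le : regular (fun w => f w <= g w).
Proof. by apply: regular_ext (regular_leq 0 0 b1 hf hg) => w; rewrite !addn0. Qed.

Lemma regular_lt : regular (fun w => f w < g w).
Proof. by apply: regular_ext (regular_leq 1 0 b1 hf hg) => w; rewrite !addn0 addn1. Qed.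

Lemma regular_ltc c : regular (fun w => f w < c).
Proof. by apply: regular_ext (regular_leq 1 c b1 hf (track0 _ b)) => w; rewrite addn1. Qed.

Lemma regular_clt c : regular (fun w => c < f w).
Proof. by apply: regular_ext (regular_leq c.+1 0 b1 (track0 _ b) hf) => w; rewrite addn0. Qed.

End Atoms.

(** The closure properties of regular sets apply to a disjunction, not to a match on a field. *)
Lemma valid_cellE m c : valid_cell m c = (al c < 2) &&
  [|| [&& tg c == 0, ga c == 0, ti c == 0, vv c == 0, uu c == 0, ii c == 0 & kk c == 0],
      [&& tg c == 1, ga c < 2, ii c <= m & kk c == 0] |
      [&& tg c == 2, ga c < 2, ii c <= m, kk c <= m & 0 < ti c]].
Proof. by rewrite /valid_cell; case: (tg c) => [|[|[|t]]] /=; rewrite ?orbF. Qed.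

Lemma exp2_gt1 w : 0 < w -> 1 < 2 ^ w.
Proof. by move=> h; rewrite -{1}(expn0 2) ltn_exp2l. Qed.

(** * Adjacency is decided by an automaton *)

Section Adjacency.
Variables (M : ntm) (be : nat).
Hypothesis be0 : 0 < be.
Let A := seq tick.
Notation reader := (nat -> nat -> seq A -> nat).
Notation wr := (mod_width be).
Notation wt := (conf_width be).
Notation cw := (cell_widths be).
Notation vw := (vert_widths be).

(** A reader stands for one of the two vertices of an entry, found in the low or the high part of a
    gate number, and delivers its slices as tracks. *)
Definition read_field (rd : reader) (ws : seq nat) (o k : nat) : seq A -> nat :=
  rd (o + sumn (take k ws)) (nth 0 ws k).
Definition read_conf (rd : reader) (o : nat) (w : seq A) : conf4 :=
  let f k := read_field rd (conf_widths be) o k w in Conf4 (f 0) (f 1) (f 2) (f 3).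
Definition read_cell (rd : reader) (o : nat) (w : seq A) : cell :=
  let f k := read_field rd cw o k w in
  Cell (f 0) (f 1) (f 2) (f 3) (f 4) (f 5) (f 6) (f 7) (f 8).
Definition read_vert (rd : reader) (w : seq A) : xvert :=
  let f k := read_field rd vw 0 k w in XVert (f 0) (f 1) (f 2) (f 3) (f 4).

Definition x_off := sumn (take 2 vw).
Definition y_off := sumn (take 4 vw).
Definition rung_off o := o + sumn (take 3 cw).
Definition read_mod (rd : reader) o := read_field rd (rung_widths be) (rung_off o) 0.
Definition read_res (rd : reader) o := read_field rd (rung_widths be) (rung_off o) 1.

Variables (nn tmax jmax : seq A -> nat) (v0 : nat).
Hypotheses (nnT : track (2 ^ 1) nn) (tmaxT : track (2 ^ wt) tmax)
  (jmaxT : track (2 ^ sumn (rung_widths be)) jmax).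

Definition read_edge (c : bool) (rd : reader) (w : seq A) : bool :=
  conf_rel M (nn w) c (read_conf rd (x_off + sumn (take 6 cw)) w)
    (read_conf rd (x_off + sumn (take 5 cw)) w).

Definition read_link (s : nat) (c : bool) (rd : reader) (w : seq A) : bool :=
  xA (cell_un (tmax w).+1 (jmax w).+1 v0 0 (read_mod rd x_off w) (read_res rd x_off w) s
        (read_cell rd x_off w) (read_cell rd y_off w))
     (cell_bin (tmax w).+1 (read_mod rd x_off w) (read_mod rd y_off w) (read_edge c rd w)
        (read_cell rd x_off w) (read_cell rd y_off w)) (read_vert rd w).

Definition read_adj (s : nat) (c : bool) (rd rd' : reader) (w : seq A) : bool :=
  xadj1 (read_link s c rd' w) (xB (read_vert rd' w)) (read_vert rd w) (read_vert rd' w) ||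
  xadj1 (read_link s c rd w) (xB (read_vert rd w)) (read_vert rd' w) (read_vert rd w).

Variables (rd rd' : reader).
Hypotheses (rdT : forall o w, track (2 ^ w) (rd o w)) (rdT' : forall o w, track (2 ^ w) (rd' o w)).

Lemma read_fieldT r ws o k : (forall o w, track (2 ^ w) (r o w)) ->
  track (2 ^ nth 0 ws k) (read_field r ws o k).
Proof. by move=> h; apply: h. Qed.

Ltac tracks := first
  [ exact: rdT | exact: rdT' | exact: nnT | exact: tmaxT | exact: jmaxT
  | (apply: trackM; tracks) | (apply: trackD; tracks) ].

Ltac big := first [ exact: exp2_gt1 | by apply: exp2_gt1; rewrite /conf_width /= ?addn_gt0 ?be0 ?orbT ].

Ltac reg := repeat first
  [ assumption | apply: regular_exists => ? | apply: regular_and | apply: regular_or | apply: regular_not | apply: regular_const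
  | apply: regular_if
  | (eapply regular_eqc; [ | tracks ]; big)
  | (eapply regular_eq_addc; [ | tracks | tracks ]; big)
  | (eapply regular_eq; [ | tracks | tracks ]; big)
  | (eapply regular_ltc; [ | tracks ]; big)
  | (eapply regular_clt; [ | tracks ]; big)
  | (eapply regular_le; [ | tracks | tracks ]; big)
  | (eapply regular_lt; [ | tracks | tracks ]; big) ].

Lemma regular_xadj1 (p q : seq A -> bool) : regular p -> regular q ->
  regular (fun w => xadj1 (p w) (q w) (read_vert rd w) (read_vert rd' w)).
Proof.
move=> hp hq; rewrite /xadj1 /no_x /no_y /same_x /x_is_y /= /read_field /=.
reg.
Qed.

Lemma regular_xB : regular (fun w => xB (read_vert rd w)).
Proof. rewrite /xB /= /read_field /=; reg. Qed.

Lemma regular_xA (p q : seq A -> bool) : regular p -> regular q ->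
  regular (fun w => xA (p w) (q w) (read_vert rd w)).
Proof. move=> hp hq; rewrite /xA /= /read_field /=; reg. Qed.

Lemma regular_valid o (m : seq A -> nat) : track (2 ^ wr) m ->
  regular (fun w => valid_cell (m w) (read_cell rd o w)).
Proof.
move=> hm; eapply regular_ext; first by move=> w; symmetry; apply: valid_cellE.
rewrite /= /read_field /=; reg; (eapply regular_le; [|tracks|exact: hm]; big).
Qed.

Lemma regular_cell_un s : regular (fun w => cell_un (tmax w).+1 (jmax w).+1 v0 0
  (read_mod rd x_off w) (read_res rd x_off w) s (read_cell rd x_off w) (read_cell rd y_off w)).
Proof.
rewrite /cell_un; apply: regular_and; first by apply: regular_valid; apply: read_fieldT.
rewrite /name_lab /flat_lab /zero_cond /mark_cond /= /read_res /read_field /=; reg.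
Qed.

Lemma regular_cell_bin p : regular p -> regular (fun w => cell_bin (tmax w).+1
  (read_mod rd x_off w) (read_mod rd y_off w) (p w) (read_cell rd x_off w) (read_cell rd y_off w)).
Proof.
move=> hp; rewrite /cell_bin; apply: regular_and; first by apply: regular_valid; apply: read_fieldT.
apply: regular_and; first by apply: regular_valid; apply: read_fieldT.
rewrite /rung /add_link /= /read_mod /read_field /=; reg.
Qed.

Lemma regular_edge c : regular (read_edge c rd).
Proof.
rewrite /read_edge /conf_rel; apply: regular_or; first by rewrite /= /read_field /=; reg.
apply: regular_or.
  apply: regular_and; last by rewrite /= /read_field /=; reg.
  by do 2![apply: regular_exists => ?]; rewrite /= /read_field /=; reg.
do 5![apply: regular_exists => ?]; apply: regular_has => a; apply: regular_has => d.
apply: regular_has => e.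
do 3![apply: regular_and; first by rewrite /= /read_field /=; reg].
apply: regular_and.
  by case: a => [|x|]; rewrite /= /read_field /=; reg.
apply: regular_and.
  by case: d; rewrite /= /read_field /=; reg.
by case: e; rewrite /= /read_field /=; reg.
Qed.

End Adjacency.

Lemma slice_modn L K o w y : o + w <= K -> slice L K o w (y %% 2 ^ (K * L)) = slice L K o w y.
Proof.
move=> h; apply: eq_bigr => i _; congr (_ * _); rewrite mod_div_mod //.
rewrite -addnA (leq_trans (leq_add (leqnn _) h)) // -mulnSr leq_mul2l ltn_ord orbT //.
Qed.

Lemma slice_modn_full L K y : slice L K 0 K y = y %% 2 ^ (K * L).
Proof. by rewrite -(slice_modn L y (leqnn (0 + K))) slice_full // ltn_pmod // exp2_gt0. Qed.

Lemma sumn_take_nth ws k : k < size ws -> sumn (take k ws) + nth 0 ws k <= sumn ws.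
Proof. by move=> hk; rewrite -{3}(cat_take_drop k ws) sumn_cat (drop_nth 0) //= leq_add2l leq_addr. Qed.

Lemma field_slice L K o ws k y : k < size ws ->
  field L ws k (slice L K o (sumn ws) y) = slice L K (o + sumn (take k ws)) (nth 0 ws k) y.
Proof. by move=> hk; rewrite /field slice_slice // sumn_take_nth. Qed.

Lemma x_off_le be : x_off be + cell_width be <= vert_width be.
Proof. by rewrite /x_off /vert_width /vert_widths /=; move: (cell_width be) => c; lia. Qed.

Lemma y_off_le be : y_off be + cell_width be <= vert_width be.
Proof. by rewrite /y_off /vert_width /vert_widths /=; move: (cell_width be) => c; lia. Qed.

Section Fields.
Variables (M : ntm) (be : nat).
Hypothesis be_states : #|{: nstate M * nsym M}| < 2 ^ be.
Notation K := (vert_width be).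
Variables (n : nat) (W : seq (seq tick)).
Notation L := (blocks n).

Lemma start_numE : start_num M be n = state_rank (nstart M) (nblank M).
Proof.
rewrite /start_num /pack_conf /= !join00 join_small //.
exact: leq_ltn_trans (state_rank_le _ _) be_states.
Qed.

Section Reader.
Variables (rd : nat -> nat -> seq (seq tick) -> nat) (y : nat).
Hypothesis rdE : forall o w, o + w <= K -> rd o w W = slice L K o w y.

Lemma read_fieldE ws o k : k < size ws -> o + sumn ws <= K ->
  read_field rd ws o k W = field L ws k (slice L K o (sumn ws) y).
Proof.
move=> hk ho.
rewrite field_slice // /read_field rdE // -addnA (leq_trans _ ho) // leq_add2l.
exact: sumn_take_nth.
Qed.

Lemma read_confE o : o + conf_width be <= K ->
  read_conf be rd o W = unpack_conf L be (slice L K o (conf_width be) y).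
Proof. by move=> ho; rewrite /read_conf /unpack_conf !read_fieldE. Qed.

Lemma read_cellE o : o + cell_width be <= K ->
  read_cell be rd o W = unpack_cell L be (slice L K o (cell_width be) y).
Proof. by move=> ho; rewrite /read_cell /unpack_cell !read_fieldE. Qed.

Hypothesis yN : y < nverts be n.

Lemma read_vertE : read_vert be rd W = unpack_vert L be y.
Proof.
rewrite /read_vert /unpack_vert !read_fieldE // ?add0n //.
by rewrite /sumn -/sumn -/K slice_full.
Qed.

Lemma read_xcellE : read_cell be rd (x_off be) W = unpack_cell L be (xu (unpack_vert L be y)).
Proof. by rewrite read_cellE // x_off_le. Qed.

Lemma read_ycellE : read_cell be rd (y_off be) W = unpack_cell L be (yu (unpack_vert L be y)).
Proof. by rewrite read_cellE // y_off_le. Qed.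

Lemma read_rungE o k : k < 3 -> o + cell_width be <= K ->
  read_field rd (rung_widths be) (rung_off be o) k W =
  field L (rung_widths be) k (jj (unpack_cell L be (slice L K o (cell_width be) y))).
Proof.
move=> hk ho; rewrite read_fieldE // /rung_off; last first.
  by apply: leq_trans ho; rewrite -addnA leq_add2l /cell_width /cell_widths /=; lia.
rewrite /rung_off -[jj _]/(field L (cell_widths be) 3 (slice L K o (sumn (cell_widths be)) y)).
rewrite field_slice // [field L (cell_widths be) 3 _]field_slice // field_slice //.
Qed.

Lemma read_edgeE c nn : nn W = n ->
  read_edge M be nn c rd W = edge_bit M be n c (unpack_vert L be y).
Proof.
move=> hn; have part k : k < 9 -> nth 0 (cell_widths be) k = conf_width be ->
    read_conf be rd (x_off be + sumn (take k (cell_widths be))) W =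
    unpack_conf L be (field L (cell_widths be) k (xu (unpack_vert L be y))).
  move=> hk hw; rewrite read_confE -1?hw.
    by congr (unpack_conf _ _ _); rewrite -[xu _]/(slice L K (x_off be) (cell_width be) y) field_slice.
  rewrite -addnA (leq_trans (leq_add (leqnn _) (sumn_take_nth (hk : k < size (cell_widths be))))) //.
  exact: x_off_le.
rewrite /read_edge /edge_bit hn (part 6 erefl erefl) (part 5 erefl erefl).
reflexivity.
Qed.

Lemma read_linkE s c nn tmax jmax : nn W = n -> (tmax W).+1 = nconfs be n -> (jmax W).+1 = nrungs be n ->
  read_link M be nn tmax jmax (state_rank (nstart M) (nblank M)) s c rd W =
  let z := unpack_vert L be y in link_num M be n s (edge_bit M be n c z) z.
Proof.
move=> hn ht hj; cbv zeta; rewrite /read_link read_xcellE read_ycellE read_vertE (read_edgeE c hn) ht hj.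
rewrite /read_mod /read_res !read_rungE ?x_off_le ?y_off_le //.
rewrite /link_num /un_num /un_ start_numE.
reflexivity.
Qed.

End Reader.

Lemma read_adjE s c nn tmax jmax rd rd' u v :
  nn W = n -> (tmax W).+1 = nconfs be n -> (jmax W).+1 = nrungs be n ->
  u < nverts be n -> v < nverts be n ->
  (forall o w, o + w <= K -> rd o w W = slice L K o w u) ->
  (forall o w, o + w <= K -> rd' o w W = slice L K o w v) ->
  read_adj M be nn tmax jmax (state_rank (nstart M) (nblank M)) s c rd rd' W =
  adj_num M be n s (edge_bit M be n c) u v.
Proof.
move=> hn ht hj hu hv rE rE'; rewrite /read_adj /adj_num.
rewrite (read_linkE rE hu s c hn ht hj) (read_linkE rE' hv s c hn ht hj).
by rewrite (read_vertE rE hu) (read_vertE rE' hv).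
Qed.

End Fields.

Section RegularAdjacency.
Variables (M : ntm) (be : nat).
Hypothesis be0 : 0 < be.
Variables (nn tmax jmax : seq (seq tick) -> nat) (v0 : nat).
Hypotheses (nnT : track (2 ^ 1) nn) (tmaxT : track (2 ^ conf_width be) tmax)
  (jmaxT : track (2 ^ sumn (rung_widths be)) jmax).

Lemma regular_link s c rd : (forall o w, track (2 ^ w) (rd o w)) ->
  regular (read_link M be nn tmax jmax v0 s c rd).
Proof.
move=> h; exact: (regular_xA be h (regular_cell_un be0 v0 tmaxT jmaxT h s)
  (regular_cell_bin be0 tmaxT h (regular_edge M be0 nnT h c))).
Qed.

Lemma regular_adj s c rd rd' : (forall o w, track (2 ^ w) (rd o w)) ->
  (forall o w, track (2 ^ w) (rd' o w)) ->
  regular (read_adj M be nn tmax jmax v0 s c rd rd').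
Proof.
move=> h h'; apply: regular_or.
  exact: (regular_xadj1 be h h' (regular_link s c h') (regular_xB be h')).
exact: (regular_xadj1 be h' h (regular_link s c h) (regular_xB be h)).
Qed.

End RegularAdjacency.

Section BlockRegular.
Variables (K' : nat) (sl : bool).
Let K := K'.+1.

Definition on_blocks (T : Type) (f : seq (seq tick) -> T) (g : nat -> nat -> nat -> T) : Prop :=
  forall n a b m, (size (binary n)).+1 <= m ->
    size (binary a) <= K * (size (binary n)).+1 + K * m ->
    size (binary b) <= (if sl then 1 else K) * (size (binary n)).+1 + K * m ->
    f (input_word K' sl n a b m) = g n a b.

Definition block_regular (R : nat -> nat -> nat -> bool) : Prop := exists2 P, regular P & on_blocks P R.
Definition block_track (B : nat) (f : nat -> nat -> nat -> nat) : Prop :=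
  exists2 t, track B t & on_blocks t f.

Lemma block_linear_time R : block_regular R -> linear_time R.
Proof. by case=> P hP h; apply: (linear_time_regular (K' := K') (sl := sl)) hP h. Qed.

Lemma block_regular_ext R R' : (forall n a b, R n a b = R' n a b) -> block_regular R -> block_regular R'.
Proof. by move=> e [P hP h]; exists P => // n a b m *; rewrite h. Qed.

Lemma block_and R R' : block_regular R -> block_regular R' ->
  block_regular (fun n a b => R n a b && R' n a b).
Proof.
by move=> [P hP h] [P' hP' h']; exists (fun w => P w && P' w); [exact: regular_and | move=> n a b m *; rewrite h ?h'].
Qed.

Lemma block_or R R' : block_regular R -> block_regular R' ->
  block_regular (fun n a b => R n a b || R' n a b).
Proof.
by move=> [P hP h] [P' hP' h']; exists (fun w => P w || P' w); [exact: regular_or | move=> n a b m *; rewrite h ?h'].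
Qed.

Lemma block_not R : block_regular R -> block_regular (fun n a b => ~~ R n a b).
Proof. by move=> [P hP h]; exists (fun w => ~~ P w); [exact: regular_not | move=> n a b m *; rewrite h]. Qed.

Lemma block_if R R1 R2 : block_regular R -> block_regular R1 -> block_regular R2 ->
  block_regular (fun n a b => if R n a b then R1 n a b else R2 n a b).
Proof.
move=> [P hP h] [P1 hP1 h1] [P2 hP2 h2]; exists (fun w => if P w then P1 w else P2 w).
  exact: regular_if.
by move=> n a b m *; rewrite h // h1 // h2.
Qed.

Lemma block_eqb R R' : block_regular R -> block_regular R' ->
  block_regular (fun n a b => R n a b == R' n a b).
Proof.
by move=> [P hP h] [P' hP' h']; exists (fun w => P w == P' w); [exact: regular_eqb | move=> n a b m *; rewrite h ?h'].
Qed.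

Lemma block_trackD B f g : block_track B f -> block_track B g ->
  block_track B (fun n a b => f n a b + g n a b).
Proof.
by move=> [t ht h] [t' ht' h']; exists (fun w => t w + t' w); [exact: trackD | move=> n a b m *; rewrite h ?h'].
Qed.

Lemma block_trackM B f k : block_track B f -> block_track B (fun n a b => k * f n a b).
Proof. by move=> [t ht h]; exists (fun w => k * t w); [exact: trackM | move=> n a b m *; rewrite h]. Qed.

Lemma block_track0 B : block_track B (fun _ _ _ => 0).
Proof. by exists (fun _ => 0); [exact: track0|]. Qed.

Lemma block_leq B f g c d : 1 < B -> block_track B f -> block_track B g ->
  block_regular (fun n a b => f n a b + c <= g n a b + d).
Proof.
move=> B1 [t ht h] [t' ht' h']; exists (fun w => t w + c <= t' w + d); first exact: regular_leq B1 ht ht'.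
by move=> n a b m *; rewrite h ?h'.
Qed.

Lemma block_eqn B f g c d : 1 < B -> block_track B f -> block_track B g ->
  block_regular (fun n a b => f n a b + c == g n a b + d).
Proof.
move=> B1 [t ht h] [t' ht' h']; exists (fun w => t w + c == t' w + d); first exact: regular_eqn B1 ht ht'.
by move=> n a b m *; rewrite h ?h'.
Qed.

Lemma block_track_ext B f g : (forall n a b, f n a b = g n a b) -> block_track B f -> block_track B g.
Proof. by move=> e [P hP h]; exists P => // n a b m *; rewrite h. Qed.

Lemma block_hi_a : block_track (2 ^ K) (fun n a b => a %/ 2 ^ (K * blocks n)).
Proof.
exists (track_val (2 ^ K) (digit hi_a 0 K)); first exact: track_digit.
by move=> n a b m hm ha hb; exact: hi_a_full.
Qed.

Lemma block_lo_a o w : o + w <= K -> block_track (2 ^ w) (fun n a b => slice (blocks n) K o w a).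
Proof.
move=> how; exists (track_val (2 ^ w) (digit lo_a o w)); first exact: track_digit.
by move=> n a b m hm ha hb; exact: lo_a_val.
Qed.

Lemma block_hi_slice o w : o + w <= K ->
  block_track (2 ^ w) (fun n a b => slice (blocks n) K o w (a %/ 2 ^ (K * blocks n))).
Proof.
move=> how; exists (track_val (2 ^ w) (hi_digit o w)); first exact: track_hi.
by move=> n a b m hm ha hb; exact: hi_a_val.
Qed.

Lemma block_n : block_track 2 (fun n _ _ => n).
Proof.
exists (track_val 2 (digit bit_n 0 1)); first exact: (track_digit bit_n 0 1).
by move=> n a b m hm ha hb; exact: n_val.
Qed.

Lemma block_ones w : block_track (2 ^ w) (fun n _ _ => (2 ^ (w * blocks n)).-1).
Proof.
exists (track_val (2 ^ w) (ones w)); first exact: track_ones.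
by move=> n a b m hm ha hb; exact: ones_val.
Qed.

Lemma block_hi_b : sl = false -> block_track (2 ^ K) (fun n a b => b %/ 2 ^ (K * blocks n)).
Proof.
move=> hs; exists (track_val (2 ^ K) (digit hi_b 0 K)); first exact: track_digit.
by move=> n a b m hm ha hb; rewrite hi_b_full // hs.
Qed.

Lemma block_lo_b o w : sl = false -> o + w <= K ->
  block_track (2 ^ w) (fun n a b => slice (blocks n) K o w b).
Proof.
move=> hs how; exists (track_val (2 ^ w) (digit lo_b o w)); first exact: track_digit.
by move=> n a b m hm ha hb; exact: lo_b_val.
Qed.

Lemma block_slow_hi : sl -> block_track (2 ^ K) (fun n a b => b %/ 2 ^ blocks n).
Proof.
move=> hs; exists (track_val (2 ^ K) (digit hi_b 0 K)); first exact: track_digit.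
by move=> n a b m hm ha hb; rewrite hi_b_full // hs mul1n.
Qed.

Lemma block_slow_lo : sl -> block_track 2 (fun n a b => b %% 2 ^ blocks n).
Proof.
move=> hs; exists (track_val 2 (digit lo_b 0 1)); first exact: (track_digit lo_b 0 1).
by move=> n a b m hm ha hb; exact: slow_b_val.
Qed.

End BlockRegular.

(** * The direct connection language *)

Section Uniformity.
Variables (M : ntm) (be : nat).
Hypotheses (be0 : 0 < be) (be_states : #|{: nstate M * nsym M}| < 2 ^ be).
Notation K := (vert_width be).
Let K' := K.-1.
Notation N := (nverts be).

Definition pos_off : nat :=
  x_off be + sumn (take 6 (cell_widths be)) + sumn (take 1 (conf_widths be)).

Lemma head_slice L u :
  cP (unpack_conf L be (uu (unpack_cell L be (xu (unpack_vert L be u))))) = slice L K pos_off 1 u.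
Proof.
rewrite -[xu _]/(slice L K (x_off be) (sumn (cell_widths be)) u).
rewrite -[uu _]/(field L (cell_widths be) 6 _) field_slice //.
by rewrite -[cP _]/(field L (conf_widths be) 1 _) -[nth _ _ _]/(sumn (conf_widths be)) field_slice.
Qed.

Lemma pos_off_lt : pos_off + 1 <= K.
Proof.
apply: leq_trans (x_off_le be).
have h1 : 6 < size (cell_widths be) by [].
have h2 : 1 < size (conf_widths be) by [].
have := sumn_take_nth h1; have := sumn_take_nth h2.
by rewrite /pos_off -[nth 0 (cell_widths be) 6]/(sumn (conf_widths be)) -[nth 0 (conf_widths be) 1]/1 -/(cell_width be);
  move: (sumn (take 6 _)) (sumn (take 1 _)) (sumn (conf_widths be)) (cell_width be) (x_off be) => *; lia.
Qed.

Section Queries.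
Variable sl : bool.
Notation regular := (block_regular K' sl).
Notation btrack := (block_track K' sl).

Lemma exp_K : 1 < 2 ^ K. Proof. exact: exp2_gt1. Qed.

(** The tracks contain [N - 1], being all ones, rather than [N]; this turns linear terms in [N] into
    tracks plus constants. *)
Lemma mulNE c n : c * N n = c * (N n).-1 + c.
Proof. by rewrite -mulnSr prednK ?exp2_gt0. Qed.

Lemma block_N : btrack (2 ^ K) (fun n _ _ => (N n).-1).
Proof. exact: block_ones. Qed.

Lemma block_hi : btrack (2 ^ K) (fun n a b => hi (N n) a).
Proof. exact: block_hi_a. Qed.

Lemma block_lo : btrack (2 ^ K) (fun n a b => lo (N n) a).
Proof.
apply: block_track_ext (block_lo_a _ (leqnn (0 + K))) => n a b.
exact: slice_modn_full.
Qed.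

Lemma block_u o w : o + w <= K ->
  btrack (2 ^ w) (fun n a b => slice (blocks n) K o w (hi (N n) a %% N n)).
Proof. by move=> h; apply: block_track_ext (block_hi_slice _ h) => n a b; rewrite slice_modn. Qed.

Lemma block_v o w : o + w <= K ->
  btrack (2 ^ w) (fun n a b => slice (blocks n) K o w (lo (N n) a)).
Proof. by move=> h; apply: block_track_ext (block_lo_a _ h) => n a b; rewrite slice_modn. Qed.

Lemma block_adj (s : bool) c :
  regular (fun n a b => adj_bit M be n c s (hi (N n) a %% N n) (lo (N n) a)).
Proof.
pose nn := track_val 2 (digit bit_n 0 1).
pose tmax := track_val (2 ^ conf_width be) (ones (conf_width be)).
pose jmax := track_val (2 ^ sumn (rung_widths be)) (ones (sumn (rung_widths be))).
pose rd o w := track_val (2 ^ w) (hi_digit o w).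
pose rd' o w := track_val (2 ^ w) (digit lo_a o w).
exists (read_adj M be nn tmax jmax (state_rank (nstart M) (nblank M)) s c rd rd').
  apply: regular_adj => //; rewrite ?/nn ?/tmax ?/jmax.
  - exact: (track_digit _ 0 1).
  - exact: track_ones.
  - exact: track_ones.
  - by move=> o w; apply: track_hi.
  by move=> o w; apply: track_digit.
move=> n a b m hm ha hb; apply: read_adjE => //.
- exact: n_val.
- by rewrite /tmax ones_val // prednK // exp2_gt0.
- by rewrite /jmax ones_val // prednK // exp2_gt0.
- by rewrite ltn_pmod // exp2_gt0.
- by rewrite ltn_pmod // exp2_gt0.
- by move=> o w h; rewrite slice_modn // /rd hi_a_val.
by move=> o w h; rewrite slice_modn // /rd' lo_a_val.
Qed.

Lemma block_ge c d : regular (fun n a b => c * N n + d <= hi (N n) a).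
Proof.
apply: block_regular_ext (block_leq (c + d) 0 exp_K (block_trackM c block_N) block_hi) => n a b.
by rewrite addn0 addnA mulNE.
Qed.

Lemma block_matrix : regular (fun n a b => is_matrix (N n) a).
Proof. by apply: block_regular_ext (block_ge 1 0) => n a b; rewrite addn0 mul1n. Qed.

Lemma block_bit c : regular (fun n a b => gate_bit (N n) (adj_bit M be n c) a).
Proof.
apply: block_regular_ext (block_if (block_ge 2 0) (block_adj true c) (block_adj false c)) => n a b.
by rewrite addn0 /gate_bit; case: (2 * N n <= _).
Qed.

Lemma block_gate : regular (fun n a b => a < ngates (N n)).
Proof.
apply: block_regular_ext (block_not (block_ge 3 0)) => n a b.
by rewrite addn0 -ltnNge /hi /ngates ltn_divLR // exp2_gt0.
Qed.

Lemma block_hi_eq c d : regular (fun n a b => hi (N n) a == c * N n + d).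
Proof.
apply: block_regular_ext (block_eqn 0 (c + d) exp_K block_hi (block_trackM c block_N)) => n a b.
by rewrite addn0 addnA mulNE.
Qed.

Lemma block_lo_eq d : regular (fun n a b => lo (N n) a == d).
Proof.
apply: block_regular_ext (block_eqn 0 d exp_K block_lo (block_track0 _ _ _)) => n a b.
by rewrite addn0.
Qed.

Definition spread_width := K.-1.

Lemma block_inp : btrack 2 (fun n a b => unspread (blocks n) spread_width a).
Proof. exact: (@block_lo_a K' sl 0 1 isT). Qed.

Lemma block_isin : regular (fun n a b => is_spread (blocks n) spread_width a).
Proof.
have h : btrack (2 ^ spread_width) (fun n a b => slice (blocks n) K 1 spread_width a).
  exact: (@block_lo_a K' sl 1 spread_width (leqnn _)).
apply: block_regular_ext (block_eqn 0 0 _ h (block_track0 _ _ _)) => [n a b|].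
  by rewrite !addn0.
exact: exp2_gt1.
Qed.

Lemma block_input : regular (fun n a b =>
  is_input (N n) n (is_spread (blocks n) spread_width) (unspread (blocks n) spread_width) a).
Proof.
apply: block_and; first by apply: block_regular_ext (block_hi_eq 0 0).
apply: block_and; first exact: block_isin.
by apply: block_regular_ext (block_leq 1 0 _ block_inp (block_n _ _)) => // n a b; rewrite addn0 addn1.
Qed.

Lemma block_is_and : regular (fun n a b =>
  is_and (N n) (adj_bit M be n false) (adj_bit M be n true) a).
Proof.
apply: block_or; last by do 2![apply: block_and; [exact: block_matrix || exact: block_bit|]]; exact: block_bit.
apply: block_regular_ext (block_and (block_hi_eq 0 1) (block_lo_eq 0)) => n a b.
have N0 : 0 < N n by exact: exp2_gt0.
rewrite mul0n add0n; apply/andP/eqP => [[/eqP h /eqP h']|->]; last by rewrite /hi /lo divnn modnn N0.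
by rewrite (divn_eq a (N n)) -/(hi _ _) -/(lo _ _) h h' mul1n addn0.
Qed.

Lemma block_is_not : regular (fun n a b =>
  is_not (N n) (adj_bit M be n false) (adj_bit M be n true) a).
Proof.
apply: block_and; first exact: block_matrix.
by apply: block_and; [exact: block_bit | apply: block_not; exact: block_bit].
Qed.

Lemma block_pos f : btrack 2 f ->
  regular (fun n a b => f n a b + 1 == head_pos be n (hi (N n) a %% N n) (lo (N n) a)).
Proof.
move=> hf; have h3 : 0 + 3 <= K by [].
have H := block_if (block_eqn 0 3 (exp2_gt1 (ltn0Sn 2)) (block_u h3) (block_track0 _ _ _))
  (block_eqn 1 0 (ltnSn 1) hf (block_u pos_off_lt)) (block_eqn 1 0 (ltnSn 1) hf (block_v pos_off_lt)).
apply: block_regular_ext H => n a b.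
rewrite !addn0 -!head_slice /head_pos /sel_vert -[kd _]/(slice (blocks n) K 0 3 _).
by case: ifP.
Qed.

End Queries.

Section Pairs.
Notation regular := (block_regular K' false).
Notation btrack := (block_track K' false).

Lemma block_hi2 : btrack (2 ^ K) (fun n a b => hi (N n) b).
Proof. exact: block_hi_b. Qed.

Lemma block_lo2 : btrack (2 ^ K) (fun n a b => lo (N n) b).
Proof.
apply: block_track_ext (block_lo_b erefl (leqnn (0 + K))) => n a b.
exact: slice_modn_full.
Qed.

Lemma block_wires : regular (fun n a b =>
  wires (N n) (adj_bit M be n false) (adj_bit M be n true) (head_pos be n)
    (is_spread (blocks n) spread_width) (unspread (blocks n) spread_width) a b).
Proof.
apply: block_and; first exact: block_matrix.
apply: block_and; first by apply: block_not; apply: block_eqb; apply: block_bit.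
apply: block_and.
  apply: block_regular_ext (block_eqn 0 0 exp_K block_hi2 (block_track0 _ _ _)) => n a b.
  by rewrite !addn0.
apply: block_and.
  have h : btrack (2 ^ spread_width) (fun n a b => slice (blocks n) K 1 spread_width b).
    exact: (@block_lo_b K' false 1 spread_width erefl (leqnn _)).
  apply: block_regular_ext (block_eqn 0 0 _ h (block_track0 _ _ _)) => [n a b|].
    by rewrite !addn0.
  exact: exp2_gt1.
apply: block_pos; exact: (@block_lo_b K' false 0 1 erefl isT).
Qed.

Lemma block_eqN f g c d c' d' : btrack (2 ^ K) f -> btrack (2 ^ K) g ->
  regular (fun n a b => f n a b + (c * N n + d) == g n a b + (c' * N n + d')).
Proof.
move=> hf hg; have H := block_eqn (c + d) (c' + d') exp_K
  (block_trackD hf (block_trackM c (block_N _))) (block_trackD hg (block_trackM c' (block_N _))).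
by apply: block_regular_ext H => n a b; rewrite !mulNE !addnA.
Qed.

Lemma block_leN f g c d c' d' : btrack (2 ^ K) f -> btrack (2 ^ K) g ->
  regular (fun n a b => f n a b + (c * N n + d) <= g n a b + (c' * N n + d')).
Proof.
move=> hf hg; have H := block_leq (c + d) (c' + d') exp_K
  (block_trackD hf (block_trackM c (block_N _))) (block_trackD hg (block_trackM c' (block_N _))).
by apply: block_regular_ext H => n a b; rewrite !mulNE !addnA.
Qed.

(** Every clause of [output_ok] compares two digits after adding [c N + d] to each; the four
    numerals are these coefficients on the two sides. *)
Lemma block_output : regular (fun n a b => output_ok (N n) a b).
Proof.
pose z := block_track0 K' false (2 ^ K); pose ha := block_hi false; pose la := block_lo false.
pose hb := block_hi2; pose lb := block_lo2.
pose E f g c d c' d' hf hg := @block_eqN f g c d c' d' hf hg.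
pose G f g c d c' d' hf hg := @block_leN f g c d c' d' hf hg.
have H := block_or
  (block_and (E _ _ 0 0 0 1 ha z) (block_and (E _ _ 0 0 0 0 la z)
    (block_or (E _ _ 0 0 0 0 hb z) (block_or
      (block_and (E _ _ 0 0 1 1 hb z) (G _ _ 0 1 0 0 z lb))
      (block_and (E _ _ 0 0 1 2 hb z) (E _ _ 0 0 0 0 lb z))))))
  (block_or
  (block_and (E _ _ 0 0 0 1 ha z) (block_and (E _ _ 0 0 0 1 la z)
    (block_or (block_and (E _ _ 0 0 0 1 hb z) (E _ _ 0 0 0 0 lb z))
      (block_and (E _ _ 0 0 1 2 hb z) (E _ _ 0 0 0 1 lb z)))))
  (block_or
  (block_and (G _ _ 1 0 0 0 z ha) (block_and (G _ _ 0 1 2 0 ha z)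
    (block_or (block_and (E _ _ 0 0 0 1 lb la) (E _ _ 1 0 0 1 hb ha))
      (block_and (E _ _ 0 1 1 0 la z) (block_and (E _ _ 0 0 0 0 lb z) (E _ _ 1 0 0 2 hb ha))))))
  (block_and (G _ _ 2 0 0 0 z ha) (block_and (G _ _ 0 1 3 0 ha z)
    (block_or (block_and (E _ _ 0 0 0 2 lb la) (E _ _ 1 0 0 2 hb ha))
      (block_and (E _ _ 1 0 0 2 lb la) (E _ _ 1 0 0 3 hb ha))))))).
apply: block_regular_ext H => n a b.
by rewrite /output_ok !mul0n !mul1n !add0n !addn0 !addn1.
Qed.

End Pairs.

(** [b] is compared with a number of [blocks n] bits, so its high part must vanish and its low part
    can be read along with [a]. *)
Lemma input_split n a b : unspread (blocks n) spread_width a = b <->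
  b %/ 2 ^ blocks n = 0 /\ unspread (blocks n) spread_width a = b %% 2 ^ blocks n.
Proof.
have h : unspread (blocks n) spread_width a < 2 ^ blocks n by rewrite -{2}(mul1n (blocks n)) slice_lt.
split=> [<-|[e ->]]; first by rewrite divn_small // modn_small.
by rewrite [in RHS](divn_eq b (2 ^ blocks n)) e.
Qed.

Theorem reduction_uniform : dlogtime_uniform (reduction_circuit M be).
Proof.
case.
(* Here [b] is an input index, written without spreading: it is read one bit per block, in step with
   the spread bits of [a]. *)
- apply: (@block_linear_time K' true).
  have z := block_track0 K' true (2 ^ K).
  have H := block_and (block_input true) (block_and
    (block_eqn 0 0 exp_K (block_slow_hi K' isT) z)
    (block_eqn 0 0 (ltnSn 1) (block_inp true) (block_slow_lo K' isT))).
  apply: block_regular_ext H => n a b; rewrite connection_QInput !addn0; congr (_ && _).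
  by apply/andP/eqP => [[/eqP h /eqP h']|/input_split[-> ->]]; [apply/input_split|rewrite !eqxx].
- apply: (@block_linear_time K' false); have H := block_and (block_gate false) (block_is_not false).
  by apply: block_regular_ext H => n a b; rewrite connection_QNot.
- apply: (@block_linear_time K' false); have H := block_and (block_gate false) (block_is_and false).
  by apply: block_regular_ext H => n a b; rewrite connection_QAnd.
- apply: (@block_linear_time K' false).
  have H := block_and (block_gate false) (block_and (block_not (block_input false))
    (block_and (block_not (block_is_and false)) (block_not (block_is_not false)))).
  by apply: block_regular_ext H => n a b; rewrite connection_QOr.
- apply: (@block_linear_time K' false); have H := block_and (block_gate false) block_wires.
  by apply: block_regular_ext H => n a b; rewrite connection_QWire.
apply: (@block_linear_time K' false); apply: block_regular_ext block_output => n a b.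
by rewrite connection_QOutput // nverts_gt2.
Qed.

End Uniformity.

(** * Hardness *)

Lemma encode_iso (X Y X' Y' : graph) :
  encode_graph X ++ encode_graph Y = encode_graph X' ++ encode_graph Y' ->
  isomorphic (graphic_matroid X') (graphic_matroid Y') ->
  isomorphic (graphic_matroid X) (graphic_matroid Y).
Proof.
move=> e iso; have [h bh [ah e']] := encode_graph_inj e.
have [h' bh' [ah' _]] := @encode_graph_inj Y Y' [::] [::] (congr1 (cat^~ [::]) e').
apply: isomorphic_trans (graph_iso_matroid bh ah) _; apply: isomorphic_trans iso _.
exact/isomorphic_sym/(graph_iso_matroid bh' ah').
Qed.

Lemma GMI_encode (X Y : graph) :
  GMI (encode_graph X ++ encode_graph Y) <-> isomorphic (graphic_matroid X) (graphic_matroid Y).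
Proof.
split=> [[X' [Y' [e iso]]]|iso]; first exact: encode_iso e iso.
by exists X, Y.
Qed.

(** If [n > 0] has [u] bits, then [2^(u - 1)] is at most [n], so [2^(u + 1)] is at most [4 n]. *)
Lemma nverts_le be n : nverts be n <= (4 * maxn n 1) ^ vert_width be.
Proof.
rewrite /nverts mulnC expnM leq_exp2r // expnS size_mkseq -[4]/(2 * 2) -mulnA leq_mul2l /=.
case: n => [|n]; first by rewrite up_log1.
have := up_log_gtn (ltnSn 1) (isT : 1 < n.+2); have : 0 < up_log 2 n.+2 by rewrite up_log_gt0.
by rewrite (maxn_idPl _) //; case: (up_log 2 _) => // u _ /= h; rewrite expnS leq_mul2l.
Qed.

(** The same number serves as exponent and as additive constant: for [n >= 2] the factor [2^(4K+4)]
    is absorbed by the exponent, for [n <= 1] the additive constant is enough. *)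
Lemma size_polynomial (K N n : nat) : 0 < N <= (4 * maxn n 1) ^ K ->
  3 * N * N + 2 * (N + 1 + N * N) <= n ^ 2 ^ (6 * K + 4) + 2 ^ (6 * K + 4).
Proof.
case/andP=> N0 hN; set m := maxn n 1 in hN.
have m0 : 0 < m by rewrite leq_maxr.
have h : 3 * N * N + 2 * (N + 1 + N * N) <= 2 ^ (4 * K + 4) * m ^ (2 * K).
  apply: leq_trans (_ : 16 * N ^ 2 <= _); first by rewrite expnS expn1; nia.
  have -> : 2 ^ (4 * K + 4) * m ^ (2 * K) = 16 * ((4 * m) ^ K) ^ 2.
    rewrite -expnM expnMn (_ : 4 ^ (K * 2) = (2 ^ 2) ^ (K * 2)) // -expnM (mulnC 2 K).
    by rewrite (_ : 4 * K + 4 = 4 + 2 * (K * 2)) ?expnD ?mulnA //; lia.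
  by rewrite leq_mul2l leq_exp2r.
apply: leq_trans h _.
have [n2|n1] := leqP 2 n.
  have e : m = n by apply/maxn_idPl/ltnW.
  rewrite e; apply: leq_trans (leq_addr _ _).
  apply: leq_trans (_ : n ^ (4 * K + 4 + 2 * K) <= _).
    by rewrite [n ^ (4 * K + 4 + _)]expnD leq_mul2r leq_exp2r ?n2 ?orbT // addnS.
  rewrite leq_pexp2l ?(ltnW n2) //; apply: leq_trans (ltnW (ltn_expl _ (ltnSn 1))); lia.
have -> : m = 1 by apply/maxn_idPr.
by rewrite exp1n muln1; apply: leq_trans (leq_addl _ _); rewrite leq_exp2l //; lia.
Qed.

Theorem theorem10 : NL_hard GMI.
Proof.
move=> A [M [k [space acc]]].
(* Since [2^be] exceeds [be], this leaves room for the states with scanned symbols and, per block,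
   for the digits of a half tape. *)
pose be := (#|{: nstate M * nsym M}| + #|nsym M|.+1 ^ k).+1.
have be1 : #|{: nstate M * nsym M}| < 2 ^ be.
  by apply: leq_trans (ltn_expl be (ltnSn 1)); rewrite /be; lia.
have be2 : #|nsym M|.+1 ^ k <= 2 ^ be.
  by apply: leq_trans (ltnW (ltn_expl be (ltnSn 1))); rewrite /be; lia.
have be0 : 0 < be by [].
exists (fun x => circuit_eval (reduction_circuit M be (size x)) (in_tuple x)); last first.
  move=> x; rewrite acc -(gadget_iso be1 be2 space) reduction_eval.
  by symmetry; apply: GMI_encode.
exists (reduction_circuit M be); split=> //.
- by exists 1 => n; apply: projection_depth.
- exists (2 ^ (6 * vert_width be + 4)) => n; rewrite projection_size.
  by apply: size_polynomial; rewrite exp2_gt0 nverts_le.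
exact: reduction_uniform.
Qed.
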